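(* Primitive ideals in $U$ with nonzero central charge are exactly the annihilators of simple highest weight modules with nonzero central charge; that is, the set of annihilators in $U$ of simple $U$-modules on which $z$ acts by a nonzero scalar equals $\{\mathrm{Ann}_U(L(\lambda)) : \lambda\in\mathfrak{h}^*,\ \lambda(z)\neq0\}$.
   Context: The Schrödinger algebra $\mathfrak{s}$ is the complex Lie algebra with basis $e,h,f,p,q,z$, with $z$ central and the remaining brackets $[h,e]=2e$, $[e,f]=h$, $[h,f]=-2f$, $[e,q]=p$, $[e,p]=0$, $[h,p]=p$, $[f,p]=q$, $[f,q]=0$, $[h,q]=-q$, $[p,q]=z$. Put $U=U(\mathfrak{s})$, $\mathfrak{h}=\mathbb{C}h\oplus\mathbb{C}z$, $\mathfrak{n}_+=\mathbb{C}e\oplus\mathbb{C}p$, $\mathfrak{b}=\mathfrak{h}\oplus\mathfrak{n}_+$. The Verma module is $\Delta(\lambda)=U\otimes_{U(\mathfrak{b})}\mathbb{C}_\lambda$, where $\mathfrak{n}_+$ acts on the one-dimensional module $\mathbb{C}_\lambda$ by $0$ and $\mathfrak{h}$ acts via $\lambda$; the simple highest weight module $L(\lambda)$ is its unique simple quotient. A primitive ideal is the annihilator of a simple module. On each simple $U$-module $z$ acts by a scalar, called the central charge. *)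

(* Defs.v *)
From HB Require Import structures.
From mathcomp Require Import all_boot all_order all_algebra.
From mathcomp Require Import boolp classical_sets reals.
From mathcomp Require Import complex.
From mathcomp Require Import finmap monalg.
From mathcomp Require Import ring.

Set Implicit Arguments.
Unset Strict Implicit.
Unset Printing Implicit Defensive.

Import GRing.Theory.
Local Open Scope ring_scope.
Local Open Scope quotient_scope.

HB.mixin Record Lmodule_isLieAlgebra (K : fieldType) L of GRing.Lmodule K L := {
  lie : L -> L -> L;
  lie_is_linearl : forall y, linear (lie^~ y);
  lie_is_linearr : forall x, linear (lie x);
  lie_alternating : forall x, lie x x = 0;
  lie_jacobi : forall x y z,
    lie x (lie y z) + lie y (lie z x) + lie z (lie x y) = 0
}.

#[short(type="lieAlgType")]
HB.structure Definition LieAlgebra (K : fieldType) :=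
  {L of Lmodule_isLieAlgebra K L & GRing.Lmodule K L}.

Definition is_lie_morphism (K : fieldType) (g : lieAlgType K) (A : algType K)
    (f : g -> A) : Prop :=
  linear f /\ forall x y, f (lie x y) = f x * f y - f y * f x.

Section Enveloping.
Variables (K : fieldType) (g : lieAlgType K).

(* Noncommutative polynomials over [K] with one indeterminate per element of
   [g]; the relations below make [x |-> 'X_x] linear, so that this quotient is
   the tensor algebra of [g] modulo [x (x) y - y (x) x - [x, y]]. *)
Definition free_alg := {malg K[{fmonom g}]}.
HB.instance Definition _ := GRing.Lalgebra.on free_alg.

Definition free_gen (x : g) : free_alg := << fmu x >>.

Definition uea_rel (r : free_alg) : Prop :=
  (exists a x y, r = free_gen (a *: x + y) - (a *: free_gen x + free_gen y)) \/
  (exists x y, r = free_gen x * free_gen y - free_gen y * free_gen x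
                   - free_gen (lie x y)).

Definition two_sided_ideal (I : {pred free_alg}) : Prop :=
  zmod_closed I /\ forall a x b, x \in I -> a * x * b \in I.

Definition uea_ideal : {pred free_alg} := fun r =>
  `[< forall I : {pred free_alg}, two_sided_ideal I ->
        (forall s, uea_rel s -> s \in I) -> r \in I >].

Lemma uea_idealP r : reflect (forall I : {pred free_alg}, two_sided_ideal I ->
  (forall s, uea_rel s -> s \in I) -> r \in I) (r \in uea_ideal).
Proof. exact: asboolP. Qed.

Lemma uea_ideal_two_sided : two_sided_ideal uea_ideal.
Proof.
split; first split.
- by apply/uea_idealP => I [[I0 _] _] _.
- move=> x y /uea_idealP xI /uea_idealP yI; apply/uea_idealP => I II SI.
  by case: (II) => -[_ IB] _; apply: IB; [apply: xI | apply: yI].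
- move=> a x b /uea_idealP xI; apply/uea_idealP => I II SI.
  by case: (II) => _; apply; apply: xI.
Qed.

HB.instance Definition _ := GRing.isZmodClosed.Build free_alg uea_ideal
  (proj1 uea_ideal_two_sided).

Lemma uea_idealM a x b : x \in uea_ideal -> a * x * b \in uea_ideal.
Proof. exact: (proj2 uea_ideal_two_sided). Qed.

Lemma uea_ideal_rel s : uea_rel s -> s \in uea_ideal.
Proof. by move=> Ss; apply/uea_idealP => I _; apply. Qed.

Definition uea := Quotient.quot uea_ideal.
HB.instance Definition _ := GRing.Zmodule.on uea.
HB.instance Definition _ := ZmodQuotient.on uea.

Definition uea_pi (x : free_alg) : uea := \pi_uea x.

Lemma uea_pi_zmod : zmod_morphism uea_pi.
Proof. by move=> x y; rewrite /uea_pi raddfB. Qed.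
HB.instance Definition _ := GRing.isZmodMorphism.Build free_alg uea uea_pi
  uea_pi_zmod.

Lemma uea_pi_eq x y : uea_pi x = uea_pi y <-> x - y \in uea_ideal.
Proof.
by rewrite Quotient.idealrBE; split=> [/eqP|/eqP].
Qed.

Lemma uea_pi_repr u : uea_pi (repr u) = u.
Proof. exact: reprK. Qed.

Lemma uea_pi_surj u : exists x, u = uea_pi x.
Proof. by exists (repr u); rewrite uea_pi_repr. Qed.

Definition uea_mul (u v : uea) : uea := uea_pi (repr u * repr v).
Definition uea_scale (a : K) (u : uea) : uea := uea_pi (a *: repr u).

Lemma uea_piM x y : uea_pi (x * y) = uea_mul (uea_pi x) (uea_pi y).
Proof.
apply/uea_pi_eq; set x' := repr _; set y' := repr _.
have xx' : x - x' \in uea_ideal by apply/uea_pi_eq; rewrite uea_pi_repr.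
have yy' : y - y' \in uea_ideal by apply/uea_pi_eq; rewrite uea_pi_repr.
have -> : x * y - x' * y' = 1 * (x - x') * y + x' * (y - y') * 1.
  by rewrite mul1r mulr1 mulrBl mulrBr addrA subrK.
by rewrite rpredD ?uea_idealM.
Qed.

Lemma uea_piZ a x : uea_pi (a *: x) = uea_scale a (uea_pi x).
Proof.
apply/uea_pi_eq; rewrite -scalerBr -mul_malgC -[X in X \in _]mulr1.
by apply: uea_idealM; apply/uea_pi_eq; rewrite uea_pi_repr.
Qed.

Lemma free_algC a (x : free_alg) : (a%:MP : free_alg) * x = x * a%:MP.
Proof.
rewrite !malgM_def fgmulUg fgmulgU; apply: eq_bigr => k _.
by rewrite mulrC mul1m mulm1.
Qed.

Section FreeLift.
Variables (A : algType K) (f : g -> A).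

Definition free_monom (m : {fmonom g}) : A := \prod_(x <- m : seq g) f x.

Lemma free_monom_mmorphism : mmorphism free_monom.
Proof.
split=> [x y|]; rewrite /free_monom ?fmM ?big_cat //.
by rewrite fm1 big_nil.
Qed.
HB.instance Definition _ := isMultiplicative.Build _ _ free_monom
  free_monom_mmorphism.

Definition free_lift : free_alg -> A := mmap (in_alg A) free_monom.

Lemma free_lift_zmod : zmod_morphism free_lift.
Proof. exact: raddfB. Qed.

Lemma free_lift_monoid : monoid_morphism free_lift.
Proof.
have [|h1 h2] := @commr_mmap_is_multiplicative _ _ _ (in_alg A) free_monom.
  by move=> p m m'; rewrite /GRing.comm /= mulr_algl mulr_algr.
by [].
Qed.
HB.instance Definition _ := GRing.isZmodMorphism.Build free_alg A free_lift
  free_lift_zmod.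
HB.instance Definition _ := GRing.isMonoidMorphism.Build free_alg A free_lift
  free_lift_monoid.

Lemma free_liftZ : scalable free_lift.
Proof. by move=> a x; rewrite /free_lift mmapZ mulr_algl. Qed.

Lemma free_lift_gen x : free_lift (free_gen x) = f x.
Proof.
by rewrite /free_lift mmapU /free_monom /= fmU big_seq1 scale1r mul1r.
Qed.

Lemma free_liftB x y : free_lift (x - y) = free_lift x - free_lift y.
Proof. exact: raddfB. Qed.
Lemma free_liftD x y : free_lift (x + y) = free_lift x + free_lift y.
Proof. exact: raddfD. Qed.
Lemma free_liftM x y : free_lift (x * y) = free_lift x * free_lift y.
Proof. exact: rmorphM. Qed.

Lemma free_lift_comm x y t : free_lift (x * y - y * x - t) =
  free_lift x * free_lift y - free_lift y * free_lift x - free_lift t.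
Proof. rewrite (free_liftB (x * y - y * x)) (free_liftB (x * y)); congr (_ - _ - _);
exact: free_liftM. Qed.

Hypothesis fL : is_lie_morphism f.

Lemma free_lift_ideal r : r \in uea_ideal -> free_lift r = 0.
Proof.
move=> /uea_idealP rI; apply/eqP.
apply: (rI [pred r | free_lift r == 0]).
- split; first split.
  + by rewrite inE raddf0.
  + by move=> x y; rewrite !inE => /eqP x0 /eqP y0; rewrite raddfB /= x0 y0 subr0.
  + by move=> a x b; rewrite !inE !rmorphM /= => /eqP->; rewrite mulr0 mul0r.
- case: fL => fl fb s [[a [x [y ->]]]|[x [y ->]]]; rewrite inE.
  + by rewrite free_liftB free_liftD free_liftZ !free_lift_gen fl subrr.
  + by rewrite free_lift_comm !free_lift_gen fb subrr.
Qed.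
End FreeLift.

Lemma uea_mulA : associative uea_mul.
Proof.
move=> x y z; have [x' ->] := uea_pi_surj x; have [y' ->] := uea_pi_surj y.
by have [z' ->] := uea_pi_surj z; rewrite -!uea_piM mulrA.
Qed.
Lemma uea_mul1 : left_id (uea_pi 1) uea_mul.
Proof. by move=> x; have [x' ->] := uea_pi_surj x; rewrite -uea_piM mul1r. Qed.
Lemma uea_mulr1 : right_id (uea_pi 1) uea_mul.
Proof. by move=> x; have [x' ->] := uea_pi_surj x; rewrite -uea_piM mulr1. Qed.
Lemma uea_mulDl : left_distributive uea_mul +%R.
Proof.
move=> x y z; have [x' ->] := uea_pi_surj x; have [y' ->] := uea_pi_surj y.
have [z' ->] := uea_pi_surj z.
by rewrite -raddfD /= -!uea_piM mulrDl raddfD.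
Qed.
Lemma uea_mulDr : right_distributive uea_mul +%R.
Proof.
move=> x y z; have [x' ->] := uea_pi_surj x; have [y' ->] := uea_pi_surj y.
have [z' ->] := uea_pi_surj z.
by rewrite -raddfD /= -!uea_piM mulrDr raddfD.
Qed.
Lemma uea_1_neq0 : uea_pi 1 != 0.
Proof.
apply/eqP; rewrite -(raddf0 uea_pi) => /uea_pi_eq; rewrite subr0.
move=> /(@free_lift_ideal K^o (fun=> 0)); rewrite rmorph1 => h.
have /eqP : (1 : K^o) = 0.
  by apply: h; split=> [a x y|x y]; rewrite ?scaler0 ?addr0 // mulr0 subr0.
by rewrite oner_eq0.
Qed.
HB.instance Definition _ := GRing.Zmodule_isNzRing.Build uea
  uea_mulA uea_mul1 uea_mulr1 uea_mulDl uea_mulDr uea_1_neq0.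

Lemma uea_scaleA a b u : uea_scale a (uea_scale b u) = uea_scale (a * b) u.
Proof. by have [x ->] := uea_pi_surj u; rewrite -!uea_piZ scalerA. Qed.
Lemma uea_scale1 : left_id 1 uea_scale.
Proof. by move=> u; have [x ->] := uea_pi_surj u; rewrite -!uea_piZ scale1r. Qed.
Lemma uea_scaleDr : right_distributive uea_scale +%R.
Proof.
move=> a u v; have [x ->] := uea_pi_surj u; have [y ->] := uea_pi_surj v.
by rewrite -raddfD /= -!uea_piZ scalerDr raddfD.
Qed.
Lemma uea_scaleDl u : {morph uea_scale^~ u : a b / a + b}.
Proof.
by move=> a b; have [x ->] := uea_pi_surj u; rewrite -!uea_piZ scalerDl raddfD.
Qed.
HB.instance Definition _ := GRing.Zmodule_isLmodule.Build K uea
  uea_scaleA uea_scale1 uea_scaleDr uea_scaleDl.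

Lemma uea_scaleAl a (u v : uea) : a *: (u * v) = a *: u * v.
Proof.
have [x ->] := uea_pi_surj u; have [y ->] := uea_pi_surj v.
by rewrite /GRing.mul /GRing.scale /= -!(uea_piM, uea_piZ) scalerAl.
Qed.
HB.instance Definition _ := GRing.Lmodule_isLalgebra.Build K uea uea_scaleAl.
Lemma uea_scaleAr a (u v : uea) : a *: (u * v) = u * (a *: v).
Proof.
have [x ->] := uea_pi_surj u; have [y ->] := uea_pi_surj v.
rewrite /GRing.mul /GRing.scale /= -!(uea_piM, uea_piZ).
by rewrite -!mul_malgC mulrA free_algC mulrA.
Qed.
HB.instance Definition _ := GRing.Lalgebra_isAlgebra.Build K uea uea_scaleAr.

Definition uea_inj (x : g) : uea := uea_pi (free_gen x).

Lemma uea_inj_lie : is_lie_morphism uea_inj.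
Proof.
split=> [a x y|x y]; rewrite /uea_inj.
  rewrite /GRing.scale /= -uea_piZ -raddfD; apply/uea_pi_eq.
  by apply: uea_ideal_rel; left; exists a, x, y.
rewrite /GRing.mul /= -!uea_piM -raddfB; apply/esym/uea_pi_eq.
by apply: uea_ideal_rel; right; exists x, y.
Qed.

Section UeaLift.
Variables (A : algType K) (f : g -> A) (fL : is_lie_morphism f).

Definition uea_lift of is_lie_morphism f := fun u : uea => free_lift f (repr u).

Local Notation lift := (uea_lift fL).

Lemma uea_lift_pi x : lift (uea_pi x) = free_lift f x.
Proof.
apply/eqP; rewrite -subr_eq0 -raddfB; apply/eqP; apply: (free_lift_ideal fL).
by apply/uea_pi_eq; rewrite uea_pi_repr.
Qed.

Lemma uea_lift_linear : linear lift.
Proof.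
move=> a u v; have [x ->] := uea_pi_surj u; have [y ->] := uea_pi_surj v.
rewrite /GRing.scale /= -uea_piZ -raddfD !uea_lift_pi raddfD /=.
by rewrite free_liftZ.
Qed.

Lemma uea_lift_monoid : monoid_morphism lift.
Proof.
split=> [|u v]; first by rewrite [LHS]uea_lift_pi rmorph1.
have [x ->] := uea_pi_surj u; have [y ->] := uea_pi_surj v.
by rewrite [X in lift X]/GRing.mul /= -uea_piM !uea_lift_pi rmorphM.
Qed.

HB.instance Definition _ := GRing.isLinear.Build K uea A _ lift uea_lift_linear.
HB.instance Definition _ := GRing.isMonoidMorphism.Build uea A lift
  uea_lift_monoid.

Lemma uea_lift_inj x : lift (uea_inj x) = f x.
Proof. by rewrite uea_lift_pi free_lift_gen. Qed.
End UeaLift.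
End Enveloping.

Definition uea_map (K : fieldType) (b g : lieAlgType K) (i : b -> g)
    (iL : is_lie_morphism (@uea_inj K g \o i)) : uea b -> uea g :=
  uea_lift iL.
HB.instance Definition _ K b g i iL :=
  GRing.LRMorphism.on (@uea_map K b g i iL).

Section Modules.
Variables (A : pzRingType) (V : lmodType A).

Definition simple_module : Prop :=
  (exists v : V, v != 0) /\
  forall N : {pred V}, GRing.submod_closed N ->
    (forall v, v \in N -> v = 0) \/ (forall v, v \in N).

Definition annihilator : set A := [set u | forall v : V, u *: v = 0].

Definition submod_gen (S : set V) : {pred V} := fun v =>
  `[< forall N : {pred V}, GRing.submod_closed N ->
        (forall s, S s -> s \in N) -> v \in N >].

Lemma submod_genP (S : set V) v :
  reflect (forall N : {pred V}, GRing.submod_closed N ->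
            (forall s, S s -> s \in N) -> v \in N) (v \in submod_gen S).
Proof. exact: asboolP. Qed.

Lemma submod_gen_closed S : GRing.submod_closed (submod_gen S).
Proof.
split=> [|a u v /submod_genP uS /submod_genP vS].
  by apply/submod_genP => N [].
apply/submod_genP => N Nc SN; case: (Nc) => _; apply; first exact: uS.
exact: vS.
Qed.
HB.instance Definition _ S := GRing.isSubmodClosed.Build A V (submod_gen S)
  (submod_gen_closed S).

Lemma submod_gen_sub S s : S s -> s \in submod_gen S.
Proof. by move=> Ss; apply/submod_genP => N _; apply. Qed.

Definition mod_quot (S : set V) := Quotient.quot (submod_gen S).
End Modules.

Section ModQuot.
Variables (A : pzRingType) (V : lmodType A) (S : set V).

HB.instance Definition _ := GRing.Zmodule.on (mod_quot S).
HB.instance Definition _ := ZmodQuotient.on (mod_quot S).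

Definition mod_pi (v : V) : mod_quot S := \pi_(mod_quot S) v.

Lemma mod_pi_zmod : zmod_morphism mod_pi.
Proof. by move=> x y; rewrite /mod_pi raddfB. Qed.
HB.instance Definition _ := GRing.isZmodMorphism.Build V (mod_quot S) mod_pi
  mod_pi_zmod.

Lemma mod_pi_eq x y : mod_pi x = mod_pi y <-> x - y \in submod_gen S.
Proof. by rewrite Quotient.idealrBE; split=> [/eqP|/eqP]. Qed.

Lemma mod_pi_repr u : mod_pi (repr u) = u.
Proof. exact: reprK. Qed.

Lemma mod_pi_surj u : exists x, u = mod_pi x.
Proof. by exists (repr u); rewrite mod_pi_repr. Qed.

Definition mod_scale (a : A) (u : mod_quot S) : mod_quot S := mod_pi (a *: repr u).

Lemma mod_piZ a x : mod_pi (a *: x) = mod_scale a (mod_pi x).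
Proof.
apply/mod_pi_eq; rewrite -scalerBr rpredZ //.
by apply/mod_pi_eq; rewrite mod_pi_repr.
Qed.

Lemma mod_scaleA a b u : mod_scale a (mod_scale b u) = mod_scale (a * b) u.
Proof. by have [x ->] := mod_pi_surj u; rewrite -!mod_piZ scalerA. Qed.
Lemma mod_scale1 : left_id 1 mod_scale.
Proof. by move=> u; have [x ->] := mod_pi_surj u; rewrite -!mod_piZ scale1r. Qed.
Lemma mod_scaleDr : right_distributive mod_scale +%R.
Proof.
move=> a u v; have [x ->] := mod_pi_surj u; have [y ->] := mod_pi_surj v.
by rewrite -raddfD /= -!mod_piZ scalerDr raddfD.
Qed.
Lemma mod_scaleDl u : {morph mod_scale^~ u : a b / a + b}.
Proof.
by move=> a b; have [x ->] := mod_pi_surj u; rewrite -!mod_piZ scalerDl raddfD.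
Qed.
HB.instance Definition _ := GRing.Zmodule_isLmodule.Build A (mod_quot S)
  mod_scaleA mod_scale1 mod_scaleDr mod_scaleDl.

Lemma mod_pi_linear : linear mod_pi.
Proof. by move=> a x y; rewrite raddfD /= mod_piZ. Qed.
HB.instance Definition _ := GRing.isLinear.Build A V (mod_quot S) _ mod_pi
  mod_pi_linear.
End ModQuot.

Definition char_module (A K : pzRingType) (chi : A -> K) : Type := K.

Section CharModule.
Variables (A K : pzRingType) (chi : {rmorphism A -> K}).
Local Notation M := (char_module chi).
HB.instance Definition _ := GRing.Zmodule.on M.
Definition char_scale (a : A) (x : M) : M := chi a * x.
Lemma char_scaleA a b x : char_scale a (char_scale b x) = char_scale (a * b) x.
Proof. by rewrite /char_scale rmorphM mulrA. Qed.
Lemma char_scale1 : left_id 1 char_scale.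
Proof. by move=> x; rewrite /char_scale rmorph1 mul1r. Qed.
Lemma char_scaleDr : right_distributive char_scale +%R.
Proof. by move=> a x y; rewrite /char_scale mulrDr. Qed.
Lemma char_scaleDl x : {morph char_scale^~ x : a b / a + b}.
Proof. by move=> a b; rewrite /char_scale rmorphD mulrDl. Qed.
HB.instance Definition _ := GRing.Zmodule_isLmodule.Build A M
  char_scaleA char_scale1 char_scaleDr char_scaleDl.
End CharModule.

Section ExtScalars.
Variables (A B : nzRingType) (phi : {rmorphism A -> B}) (N : lmodType A).

(* Left [B]-module presentation of [B (x)_A N], where [B] is a right [A]-module
   through [phi]: the symbol [<< b *g n >>] of the free left [B]-module on the
   set [N] is [b (x) n], and additivity in [b] holds in that free module. *)
Definition tensor_rel (r : {malg B[N]}) : Prop :=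
  (exists n n', r = << n + n' >> - (<< n >> + << n' >>)) \/
  (exists a n, r = << a *: n >> - << phi a *g n >>).

Definition ext_scalars : Type := mod_quot tensor_rel.
HB.instance Definition _ := GRing.Lmodule.on ext_scalars.

Definition tens (b : B) (n : N) : ext_scalars :=
  mod_pi tensor_rel << b *g n >>.

Lemma malgZU (c b : B) (n : N) :
  c *: (<< b *g n >> : {malg B[N]}) = << c * b *g n >>.
Proof. by apply/malgP => k; rewrite mcoeffZ !mcoeffU mulrnAr. Qed.

Lemma tensZ c b n : c *: tens b n = tens (c * b) n.
Proof. by rewrite /tens -malgZU [RHS]linearZ. Qed.

Lemma tensE b n : tens b n = b *: tens 1 n.
Proof. by rewrite tensZ mulr1. Qed.

Lemma tensDl b b' n : tens (b + b') n = tens b n + tens b' n.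
Proof. by rewrite /tens monalgUD raddfD. Qed.

Lemma tensDr b n n' : tens b (n + n') = tens b n + tens b n'.
Proof.
rewrite ![tens b _]tensE -scalerDr; congr (_ *: _).
rewrite /tens -raddfD; apply/mod_pi_eq.
by apply: submod_gen_sub; left; exists n, n'.
Qed.

Lemma tens_balanced b a n : tens (b * phi a) n = tens b (a *: n).
Proof.
rewrite [RHS]tensE -tensZ; congr (_ *: _); apply/esym/mod_pi_eq.
by apply: submod_gen_sub; right; exists a, n.
Qed.
(* [tens] is the universal biadditive balanced map, so that [ext_scalars] is the
   tensor product over [A] as an abelian group. *)
Section Universal.
Variables (G : zmodType) (f : B -> N -> G).
Hypothesis fDl : forall b b' n, f (b + b') n = f b n + f b' n.
Hypothesis fDr : forall b n n', f b (n + n') = f b n + f b n'.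
Hypothesis f_balanced : forall b a n, f (b * phi a) n = f b (a *: n).

Let lift (r : {malg B[N]}) : G := \sum_(n <- msupp r) f r@_n n.

Let f0 n : f 0 n = 0.
Proof. by apply: (@addrI _ (f 0 n)); rewrite -fDl !addr0. Qed.

Let liftEw (d : {fset N}) r : (msupp r `<=` d)%fset ->
  lift r = \sum_(n <- d) f r@_n n.
Proof.
move=> le; rewrite [LHS](big_fset_incl _ le) => //= x xd /mcoeff_outdom ->.
exact: f0.
Qed.

Let liftD r r' : lift (r + r') = lift r + lift r'.
Proof.
pose d := (msupp r `|` msupp r')%fset.
rewrite (@liftEw d (r + r')) ?msuppD_le // (@liftEw d r) ?fsubsetUl //.
rewrite (@liftEw d r') ?fsubsetUr // -big_split; apply: eq_bigr => n _.
by rewrite mcoeffD fDl.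
Qed.

Let liftU b n : lift << b *g n >> = f b n.
Proof. by rewrite (liftEw msuppU_le) big_seq_fset1 mcoeffUU. Qed.

Let lift0 : lift 0 = 0.
Proof. by apply: (@addrI _ (lift 0)); rewrite -liftD !addr0. Qed.

Let liftN r : lift (- r) = - lift r.
Proof. by apply: (@addrI _ (lift r)); rewrite -liftD !subrr lift0. Qed.

Let lift_rel r : r \in submod_gen tensor_rel -> lift r = 0.
Proof.
move=> /submod_genP h; suff /asboolP/(_ 1) : r \in
    [pred r : {malg B[N]} | `[< forall b, lift (b *: r) = 0 >]].
  by rewrite scale1r.
apply: h; first split.
- by rewrite inE; apply/asboolP => b; rewrite scaler0 lift0.
- move=> a x y; rewrite !inE => /asboolP x0 /asboolP y0; apply/asboolP => b.
  by rewrite scalerDr scalerA liftD x0 y0 addr0.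
move=> _ [[n [n' ->]]|[a [n ->]]]; rewrite inE; apply/asboolP => b.
  by rewrite scalerBr scalerDr !malgZU !mulr1 liftD liftN liftD !liftU fDr subrr.
by rewrite scalerBr !malgZU !mulr1 liftD liftN !liftU f_balanced subrr.
Qed.

Lemma tens_universal : exists2 F : ext_scalars -> G,
  {morph F : x y / x + y} & forall b n, F (tens b n) = f b n.
Proof.
pose F (x : ext_scalars) := lift (repr x).
have FE r : F (mod_pi tensor_rel r) = lift r.
  apply/eqP; rewrite /F -subr_eq0 -liftN -liftD; apply/eqP/lift_rel.
  by apply/mod_pi_eq; rewrite mod_pi_repr.
exists F => [x y|b n]; last by rewrite FE liftU.
have [r ->] := mod_pi_surj x; have [r' ->] := mod_pi_surj y.
by rewrite -raddfD !FE liftD.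
Qed.
End Universal.

Lemma tens_span (x : ext_scalars) :
  exists r : {malg B[N]}, x = \sum_(n <- msupp r) tens r@_n n.
Proof.
have [r ->] := mod_pi_surj x; exists r.
by rewrite {1}[r]monalgE raddf_sum.
Qed.
End ExtScalars.

Definition schrodinger (K : fieldType) : Type := 'rV[K]_6.
HB.instance Definition _ (K : fieldType) := Vector.on (schrodinger K).

Section Schrodinger.
Variable K : fieldType.
Local Notation s := (schrodinger K).

Definition basis_vec (k : nat) : s := delta_mx 0 (inord k).

Definition sch_e : s := basis_vec 0.
Definition sch_h : s := basis_vec 1.
Definition sch_f : s := basis_vec 2.
Definition sch_p : s := basis_vec 3.
Definition sch_q : s := basis_vec 4.
Definition sch_z : s := basis_vec 5.

(* Each nonzero bracket of two basis vectors is listed in one order only. *)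
Definition bracket_table (i j : nat) : s :=
  match i, j with
  | 1, 0 => 2 *: sch_e
  | 0, 2 => sch_h
  | 1, 2 => - (2 *: sch_f)
  | 0, 4 => sch_p
  | 1, 3 => sch_p
  | 2, 3 => sch_q
  | 1, 4 => - sch_q
  | 3, 4 => sch_z
  | _, _ => 0
  end.

Definition sch_bracket (x y : s) : s :=
  \sum_(i < 6) \sum_(j < 6)
    (x 0 i * y 0 j) *: (bracket_table i j - bracket_table j i).

Lemma sch_bracketl y : linear (sch_bracket^~ y).
Proof.
move=> a x x'; rewrite /sch_bracket scaler_sumr -big_split; apply: eq_bigr => i _.
rewrite scaler_sumr -big_split; apply: eq_bigr => j _ /=.
by rewrite !mxE mulrDl scalerDl scalerA mulrA.
Qed.

Lemma sch_bracketC x y : sch_bracket x y = - sch_bracket y x.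
Proof.
rewrite /sch_bracket exchange_big -sumrN; apply: eq_bigr => j _.
rewrite -sumrN; apply: eq_bigr => i _.
by rewrite -scalerN opprB [x 0 i * _]mulrC.
Qed.

Lemma sch_bracketr x : linear (sch_bracket x).
Proof.
move=> a y y'; rewrite ![sch_bracket x _]sch_bracketC sch_bracketl.
by rewrite opprD scalerN.
Qed.

Definition coord (k : nat) (x : s) : K := x 0 (inord k).

Lemma sch_bracketE x y :
  sch_bracket x y =
    (2 * (coord 1 x * coord 0 y - coord 0 x * coord 1 y)) *: sch_e
  + (coord 0 x * coord 2 y - coord 2 x * coord 0 y) *: sch_h
  - (2 * (coord 1 x * coord 2 y - coord 2 x * coord 1 y)) *: sch_f
  + (coord 0 x * coord 4 y - coord 4 x * coord 0 y
     + (coord 1 x * coord 3 y - coord 3 x * coord 1 y)) *: sch_p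
  + (coord 2 x * coord 3 y - coord 3 x * coord 2 y
     - (coord 1 x * coord 4 y - coord 4 x * coord 1 y)) *: sch_q
  + (coord 3 x * coord 4 y - coord 4 x * coord 3 y) *: sch_z.
Proof.
have expand (F : 'I_6 -> K -> s) (v : s) :
    \sum_(i < 6) F i (v 0 i) = F (inord 0) (coord 0 v) + (F (inord 1) (coord 1 v)
    + (F (inord 2) (coord 2 v) + (F (inord 3) (coord 3 v)
    + (F (inord 4) (coord 4 v) + F (inord 5) (coord 5 v))))).
  rewrite !big_ord_recl big_ord0 addr0 /coord.
  by do !congr (_ + _); do ?congr F; do ?congr (v 0);
     apply: val_inj; rewrite /= inordK.
rewrite /sch_bracket (expand (fun i a => \sum_(j < 6)
  (a * y 0 j) *: (bracket_table i j - bracket_table j i)) x).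
rewrite !(expand (fun j b => (_ * b) *: (bracket_table _ j - bracket_table j _)) y).
rewrite !inordK //=; apply/rowP => k; rewrite !mxE /=.
ring.
Qed.

Lemma coord_linear k : linear_for *%R (coord k).
Proof. by move=> a x y; rewrite /coord !mxE. Qed.
HB.instance Definition _ k := GRing.isLinear.Build K s K _ (coord k)
  (coord_linear k).

Lemma coord_basis k j : (k < 6)%N -> (j < 6)%N ->
  coord k (basis_vec j) = (k == j)%:R.
Proof.
move=> k6 j6; rewrite /coord mxE eqxx /=.
by rewrite -val_eqE /= !inordK.
Qed.

Lemma coord_bracket x y :
  [/\ coord 0 (sch_bracket x y) =
        2 * (coord 1 x * coord 0 y - coord 0 x * coord 1 y),
      coord 1 (sch_bracket x y) = coord 0 x * coord 2 y - coord 2 x * coord 0 y,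
      coord 2 (sch_bracket x y) =
        - (2 * (coord 1 x * coord 2 y - coord 2 x * coord 1 y)) &
  [/\ coord 3 (sch_bracket x y) =
        coord 0 x * coord 4 y - coord 4 x * coord 0 y
        + (coord 1 x * coord 3 y - coord 3 x * coord 1 y),
      coord 4 (sch_bracket x y) =
        coord 2 x * coord 3 y - coord 3 x * coord 2 y
        - (coord 1 x * coord 4 y - coord 4 x * coord 1 y) &
      coord 5 (sch_bracket x y) = coord 3 x * coord 4 y - coord 4 x * coord 3 y]].
Proof.
rewrite sch_bracketE; do !split; rewrite !(linearD, linearN, linearZ) /=;
  rewrite !coord_basis //= ?(mulr0, mulr1, addr0, add0r, oppr0) //.
Qed.

Lemma coordP x y : (forall k, (k < 6)%N -> coord k x = coord k y) -> x = y.
Proof.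
by move=> xy; apply/rowP => k; move: (xy k (ltn_ord k)); rewrite /coord inord_val.
Qed.

Lemma sch_bracket_basis :
  [/\ sch_bracket sch_h sch_e = 2 *: sch_e, sch_bracket sch_e sch_f = sch_h,
      sch_bracket sch_h sch_f = - (2 *: sch_f) &
  [/\ sch_bracket sch_e sch_q = sch_p, sch_bracket sch_e sch_p = 0,
      sch_bracket sch_h sch_p = sch_p, sch_bracket sch_f sch_p = sch_q &
  [/\ sch_bracket sch_f sch_q = 0, sch_bracket sch_h sch_q = - sch_q,
      sch_bracket sch_p sch_q = sch_z & forall x, sch_bracket sch_z x = 0]]].
Proof.
do !split=> *; rewrite sch_bracketE !coord_basis //= ?(mul0r, mulr0, mulr1, mul1r,
  subr0, sub0r, addr0, add0r, oppr0, scale0r, scale1r, scaleNr) //.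
Qed.

Lemma sch_bracketxx x : sch_bracket x x = 0.
Proof.
have [h0 h1 h2 [h3 h4 h5]] := coord_bracket x x.
by apply: coordP; case=> [|[|[|[|[|[|//]]]]]] _; rewrite linear0 ?(h0, h1, h2, h3, h4, h5);
  ring.
Qed.

Lemma sch_jacobi x y t : sch_bracket x (sch_bracket y t)
  + sch_bracket y (sch_bracket t x) + sch_bracket t (sch_bracket x y) = 0.
Proof.
have [d0 d1 d2 [d3 d4 d5]] := coord_bracket x y.
have [e0 e1 e2 [e3 e4 e5]] := coord_bracket y t.
have [f0 f1 f2 [f3 f4 f5]] := coord_bracket t x.
have [a0 a1 a2 [a3 a4 a5]] := coord_bracket x (sch_bracket y t).
have [b0 b1 b2 [b3 b4 b5]] := coord_bracket y (sch_bracket t x).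
have [c0 c1 c2 [c3 c4 c5]] := coord_bracket t (sch_bracket x y).
by apply: coordP; case=> [|[|[|[|[|[|//]]]]]] _; rewrite linear0 !linearD /=
  ?(a0, a1, a2, a3, a4, a5) ?(b0, b1, b2, b3, b4, b5) ?(c0, c1, c2, c3, c4, c5)
  ?(d0, d1, d2, d3, d4, d5) ?(e0, e1, e2, e3, e4, e5) ?(f0, f1, f2, f3, f4, f5);
  ring.
Qed.

HB.instance Definition _ := Lmodule_isLieAlgebra.Build K s
  sch_bracketl sch_bracketr sch_bracketxx sch_jacobi.

Definition cartan : {vspace s} := <<[:: sch_h; sch_z]>>%VS.
Definition nplus : {vspace s} := <<[:: sch_e; sch_p]>>%VS.
Definition borel : {vspace s} := (cartan + nplus)%VS.

Lemma cartanP x : reflect (exists a b, x = a *: sch_h + b *: sch_z) (x \in cartan).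
Proof.
rewrite /cartan span_cons span_seq1; apply: (iffP memv_addP).
  by case=> u /vlineP[a ->] [v /vlineP[b ->] ->]; exists a, b.
by case=> a [b ->]; exists (a *: sch_h); rewrite ?memvZ ?memv_line //;
   exists (b *: sch_z); rewrite ?memvZ ?memv_line.
Qed.

Lemma nplusP x : reflect (exists a b, x = a *: sch_e + b *: sch_p) (x \in nplus).
Proof.
rewrite /nplus span_cons span_seq1; apply: (iffP memv_addP).
  by case=> u /vlineP[a ->] [v /vlineP[b ->] ->]; exists a, b.
by case=> a [b ->]; exists (a *: sch_e); rewrite ?memvZ ?memv_line //;
   exists (b *: sch_p); rewrite ?memvZ ?memv_line.
Qed.

Lemma borel_coord x : x \in borel -> coord 2 x = 0 /\ coord 4 x = 0.
Proof.
case/memv_addP => u /cartanP[a [b ->]] [v /nplusP[c [d ->]] ->].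
by rewrite !(linearD, linearZ) /= !coord_basis //= !mulr0 !addr0.
Qed.

Lemma borel_bracket x y : x \in borel -> y \in borel -> sch_bracket x y \in nplus.
Proof.
move=> /borel_coord[x2 x4] /borel_coord[y2 y4]; apply/nplusP.
rewrite sch_bracketE x2 x4 y2 y4.
rewrite !(mulr0, mul0r, subr0, addr0, add0r, scale0r, oppr0).
by eexists; eexists.
Qed.

Lemma cartan_nplus_disjoint : (cartan :&: nplus)%VS = 0%VS.
Proof.
apply/eqP; rewrite -subv0; apply/subvP => x; rewrite memv_cap.
case/andP => /cartanP[a [b xab]] /nplusP[c [d xcd]]; rewrite memv0; apply/eqP.
have c0 : c = 0.
  have : coord 0 x = coord 0 x by [].
  rewrite {1}xab xcd !(linearD, linearZ) /= !coord_basis //=.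
  by rewrite !(mulr0, mulr1, addr0, add0r).
have d0 : d = 0.
  have : coord 3 x = coord 3 x by [].
  rewrite {1}xab xcd !(linearD, linearZ) /= !coord_basis //=.
  by rewrite !(mulr0, mulr1, addr0, add0r).
by rewrite xcd c0 d0 !scale0r addr0.
Qed.

Definition borel_alg : Type := subvs_of borel.
HB.instance Definition _ := Vector.on borel_alg.

Definition borel_incl (x : borel_alg) : s := vsval x.

Definition borel_lie (x y : borel_alg) : borel_alg :=
  vsproj borel (lie (borel_incl x) (borel_incl y)).

Lemma borel_inclP x : borel_incl x \in borel.
Proof. exact: subvsP. Qed.

Lemma borel_incl_lie x y :
  borel_incl (borel_lie x y) = lie (borel_incl x) (borel_incl y).
Proof.
rewrite /borel_incl vsprojK //; apply: (subvP (addvSr _ _)).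
by apply: borel_bracket; apply: borel_inclP.
Qed.

Lemma borel_incl_linear : linear borel_incl.
Proof. exact: linearP. Qed.
HB.instance Definition _ := GRing.isLinear.Build K borel_alg s _ borel_incl
  borel_incl_linear.

Lemma borel_incl_inj : injective borel_incl.
Proof. exact: val_inj. Qed.

Lemma borel_liel y : linear (borel_lie^~ y).
Proof.
move=> a x x'; apply: borel_incl_inj.
rewrite [RHS]linearP /= !borel_incl_lie [borel_incl (_ + _)]linearP /=.
exact: lie_is_linearl.
Qed.
Lemma borel_lier x : linear (borel_lie x).
Proof.
move=> a y y'; apply: borel_incl_inj.
rewrite [RHS]linearP /= !borel_incl_lie [borel_incl (_ + _)]linearP /=.
exact: lie_is_linearr.
Qed.
Lemma borel_liexx x : borel_lie x x = 0.
Proof. by apply: borel_incl_inj; rewrite borel_incl_lie lie_alternating linear0. Qed.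
Lemma borel_jacobi x y t : borel_lie x (borel_lie y t)
  + borel_lie y (borel_lie t x) + borel_lie t (borel_lie x y) = 0.
Proof.
apply: borel_incl_inj.
rewrite [RHS]linear0 !linearD /= !borel_incl_lie.
exact: lie_jacobi.
Qed.
HB.instance Definition _ := Lmodule_isLieAlgebra.Build K borel_alg
  borel_liel borel_lier borel_liexx borel_jacobi.

Lemma borel_incl_morphism : is_lie_morphism (@uea_inj K s \o borel_incl).
Proof.
have [injL injB] := @uea_inj_lie K s; split=> [a x y|x y] /=.
  by rewrite -[RHS]injL; congr uea_inj; exact: borel_incl_linear.
by rewrite borel_incl_lie injB.
Qed.

Definition weight : Type := 'Hom(subvs_of cartan, K^o).

Section HighestWeight.
Variable lambda : weight.

Definition borel_char (x : borel_alg) : K^o :=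
  lambda (vsproj cartan (daddv_pi cartan nplus (borel_incl x))).

Lemma borel_char_morphism : is_lie_morphism borel_char.
Proof.
split=> [a x y|x y]; first by rewrite /borel_char !linearP.
rewrite [X in _ - X]mulrC subrr /borel_char.
have xy : borel_incl (lie x y) \in nplus.
  by rewrite borel_incl_lie borel_bracket ?borel_inclP.
have := daddv_pi_add cartan_nplus_disjoint (borel_inclP (lie x y)).
have nc : (nplus :&: cartan)%VS = 0%VS by rewrite capvC cartan_nplus_disjoint.
by rewrite (daddv_pi_id nc xy) -[RHS]add0r => /addIr ->; rewrite !linear0.
Qed.

Definition one_dim_module := char_module (uea_lift borel_char_morphism).

Definition verma : lmodType (uea s) :=
  ext_scalars (uea_map borel_incl_morphism) one_dim_module.

(* The submodule generated by the union of all proper submodules is their sum;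
   in characteristic 0 it is the largest proper submodule, so that the quotient
   by it is the unique simple quotient. *)
Definition simple_hw : lmodType (uea s) :=
  mod_quot [set v : verma | exists2 N : {pred verma},
    GRing.submod_closed N /\ (exists w, w \notin N) & v \in N].

End HighestWeight.

(* [sch_z] belongs to [cartan], so that [vsproj] only changes its type. *)
Definition weight_z (lambda : weight) : K := lambda (vsproj cartan sch_z).

Definition central_charge (M : lmodType (uea s)) (c : K) : Prop :=
  forall m : M, uea_inj sch_z *: m = c%:A *: m.

End Schrodinger.

(* Main.v *)
(** On a module where z acts by c <> 0, the elements E = e - p^2/2c,
    F = f + q^2/2c and H = h + (pq + qp)/2c form an sl2-triple commuting with
    p and q, so that U acts through a quotient of U(sl2) (x) A_1.  A simple module
    has countable dimension over an uncountable algebraically closed field, so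
    the Casimir element of this triple acts on it by a scalar chi
    (Dixmier's form of Schur's lemma).  Modulo z - c and the relation
    Casimir = chi, every nonzero two-sided ideal contains a nonzero power of F:
    ad p and ad q reduce an element to U(sl2), ad H to the form E^k g(H)
    or F^k g(H), and ad E, ad F lower the degree of g.  Hence the annihilator
    is determined by c, chi and the powers of F that it contains.  If F^(k+1) = 0
    with k minimal, then chi = k(k+2), so that k is a function of chi and only
    the alternative "F nilpotent or not" matters.  The module L(lambda) with
    mu = lambda(h) + 1/2 has chi = mu(mu+2), and F is nilpotent on it exactly when
    mu is a natural number; since the two roots of mu(mu+2) = chi add up to -2, both
    alternatives are realized by highest weight modules. *)

Require Import Defs.
From HB Require Import structures.
From mathcomp Require Import all_boot all_order all_algebra.
From mathcomp Require Import boolp classical_sets functions reals.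
From mathcomp Require Import complex monalg.
From mathcomp Require Import ring lra.

Set Implicit Arguments.
Unset Strict Implicit.
Unset Printing Implicit Defensive.

Import Order.TTheory GRing.Theory Num.Theory.
Local Open Scope classical_set_scope.
Local Open Scope ring_scope.
Local Open Scope complex_scope.

(** * Subspaces, direct sums and eigencomponents *)

(** Two annihilators are compared on the product [M * L], where [c] and [chi] are common scalars. An
    element that kills [M] but not [L] generates a nonzero ideal in the algebra acting on the
    product, and the power of F found in this ideal kills [M] but not [L]. The acting algebra is a
    quotient of unknown size, in which powers of E or F may vanish. Its elements are therefore
    handled only as sums of monomials, and distinct eigenvalues of suitable operators take the place
    of linear independence. Every lowering step has to show that its result is still nonzero in the
    quotient; this is the purpose of the explicit leading coefficients, which are positive integers
    times that of [g] and hence invertible in characteristic 0. That [L(lambda)] is nonzero is read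
    off from a functional [eps], the coordinate of the highest weight vector, which comes from an
    explicit Fock space representation. The same functional describes the largest proper submodule
    of the Verma module. *)

Section Subspaces.
Variables (K : fieldType) (V : lmodType K).

Definition subspace (S : V -> Prop) : Prop :=
  S 0 /\ forall a x y, S x -> S y -> S (a *: x + y).

Lemma subspaceD S x y : subspace S -> S x -> S y -> S (x + y).
Proof. by case=> _ h Sx Sy; rewrite -[x]scale1r; apply: h. Qed.

Lemma subspaceZ S a x : subspace S -> S x -> S (a *: x).
Proof. by case=> S0 h Sx; rewrite -[_ *: _]addr0; apply: h. Qed.

Lemma subspaceB S x y : subspace S -> S x -> S y -> S (x - y).
Proof.
by move=> sS Sx Sy; rewrite -scaleN1r; apply: subspaceD => //; apply: subspaceZ.
Qed.

Lemma subspace_sum S (I : Type) (r : seq I) (F : I -> V) :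
  subspace S -> (forall i, S (F i)) -> S (\sum_(i <- r) F i).
Proof.
move=> sS SF; elim/big_ind: _ => [|x y|//]; first by case: sS.
exact: subspaceD.
Qed.

End Subspaces.

Lemma subspace_preim (K : fieldType) (V W : lmodType K) (T : W -> V) S :
  linear T -> subspace S -> subspace (fun x => S (T x)).
Proof.
move=> linT [S0 SP]; split=> [|a x y Tx Ty]; last by rewrite linT; apply: SP.
by have := linT (-1) 0 0; rewrite scaler0 addr0 scaleN1r addNr => ->.
Qed.

Section DirectSums.
Variables (K : fieldType) (V : lmodType K).
Variables (I : choiceType) (G : I -> V -> Prop).

(** Only the sum of the [G i], despite the name: independence is not part of the definition and
    enters through distinct eigenvalues in [eigencomponent_mem]. *)
Definition subspace_dsum (x : V) : Prop :=
  exists s : seq I, exists f : I -> V,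
    [/\ uniq s, forall i, G i (f i) & x = \sum_(i <- s) f i].

Hypothesis subG : forall i, subspace (G i).

Lemma dsum_subspace : subspace subspace_dsum.
Proof.
split=> [|a x y [s [f [us Gf ->]]] [t [g [ut Gg ->]]]].
  by exists [::], (fun=> 0); split=> [//|i|]; [case: (subG i)|rewrite big_nil].
(* Outside [s] the values of [f] are arbitrary, so both families are cut to 0 before they are added
   over the union of the supports. *)
pose f' i := if i \in s then f i else 0; pose g' i := if i \in t then g i else 0.
exists (undup (s ++ t)), (fun i => a *: f' i + g' i); split.
- exact: undup_uniq.
- move=> i; have [G0 GP] := subG i; apply: GP; rewrite /f' /g'; by case: ifP.
rewrite big_split -scaler_sumr; congr (_ *: _ + _).
  rewrite [LHS](eq_big_seq f') => [|i si]; last by rewrite /f' si.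
  rewrite [RHS](bigID (mem s)) /= [X in _ + X]big1 ?addr0; last first.
    by move=> i /negbTE si; rewrite /f' si.
  rewrite -[RHS]big_filter; apply: perm_big; apply: uniq_perm => //.
    by rewrite filter_uniq ?undup_uniq.
  by move=> i; rewrite mem_filter mem_undup mem_cat; case: (i \in s).
rewrite [LHS](eq_big_seq g') => [|i si]; last by rewrite /g' si.
rewrite [RHS](bigID (mem t)) /= [X in _ + X]big1 ?addr0; last first.
  by move=> i /negbTE si; rewrite /g' si.
rewrite -[RHS]big_filter; apply: perm_big; apply: uniq_perm => //.
  by rewrite filter_uniq ?undup_uniq.
by move=> i; rewrite mem_filter mem_undup mem_cat; case: (i \in t); rewrite ?orbT.
Qed.

Lemma dsum_in i x : G i x -> subspace_dsum x.
Proof.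
move=> Gx; exists [:: i], (fun j => if j == i then x else 0); split=> // [j|].
  by case: eqP => [->//|_]; case: (subG j).
by rewrite big_seq1 eqxx.
Qed.

Lemma dsum_sub S : subspace S -> (forall i x, G i x -> S x) ->
  forall x, subspace_dsum x -> S x.
Proof.
by move=> sS GS x [s [f [_ Gf ->]]]; apply: subspace_sum => // i; apply: (GS i).
Qed.

Lemma dsum_map (T : V -> V) S : linear T -> subspace S ->
  (forall i x, G i x -> S (T x)) -> forall x, subspace_dsum x -> S (T x).
Proof.
move=> linT sS GS.
exact: (@dsum_sub (fun x => S (T x)) (subspace_preim linT sS) GS).
Qed.

(** Applying [D - th j] removes the component at [j] and rescales the others by nonzero factors. By
    induction the others lie in [J], and subtracting them leaves [f j]. *)
Lemma eigencomponent_mem (D : {linear V -> V}) (th : I -> K)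
    (J : V -> Prop) (s : seq I) (f : I -> V) :
    injective th -> (forall i, D (f i) = th i *: f i) ->
    subspace J -> (forall x, J x -> J (D x)) ->
    uniq s -> J (\sum_(i <- s) f i) -> forall i, i \in s -> J (f i).
Proof.
move=> thI; elim: s f => [//|j s IH] f Df sJ DJ /= /andP[js us].
rewrite big_cons => Jx.
have Jf i : i \in s -> J (f i).
  move=> si; have /(IH (fun i => (th i - th j) *: f i)): J
      (\sum_(i <- s) (th i - th j) *: f i).
    have := subspaceB sJ (DJ _ Jx) (subspaceZ (th j) sJ Jx).
    rewrite (linearD D) /= Df scalerDr opprD addrACA subrr add0r.
    rewrite (linear_sum D) scaler_sumr -sumrB.
    by rewrite (eq_bigr (fun i => (th i - th j) *: f i)) // => l _; rewrite Df -scalerBl.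
  move=> h; have {h} : J ((th i - th j) *: f i).
    by apply: h => // k; rewrite (linearZZ D) /= Df !scalerA mulrC.
  move/(subspaceZ (th i - th j)^-1 sJ); rewrite scalerA mulVf ?scale1r //.
  by rewrite subr_eq0; apply: contraNneq js => /thI <-.
move=> i; rewrite inE => /predU1P[->|/Jf//].
rewrite -[f j](addrK (\sum_(i <- s) f i)); apply: subspaceB => //.
rewrite big_seq; elim/big_ind: _ => [|x y|//]; first by case: sJ.
exact: subspaceD.
Qed.

(** Serves to replace an element of an ideal by a homogeneous one, with [D] in turn [[P, x] Q],
    [[Q, x] P] and [ad H]. *)
Lemma dsum_eigen_nonzero (D : V -> V) (th : I -> K) (J : V -> Prop) x :
    linear D -> injective th -> (forall i y, G i y -> D y = th i *: y) ->
    subspace J -> (forall y, J y -> J (D y)) ->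
  subspace_dsum x -> J x -> x != 0 -> exists i y, [/\ G i y, J y & y != 0].
Proof.
move=> linD thI DG sJ DJ [s [f [us Gf ->]]] Jx xN0.
pose DL : {linear V -> V} := HB.pack D (GRing.isLinear.Build K V V _ D linD).
have [/allP f0|/allPn[i si fi]] := boolP (all (fun i => f i == 0) s).
  by rewrite big_seq big1 ?eqxx // in xN0 => i /f0/eqP.
exists i, (f i); split=> //.
by apply: (eigencomponent_mem (D := DL) thI _ sJ DJ us Jx si) => j; apply: DG.
Qed.

End DirectSums.

(** * The endomorphism algebra of a module *)

Section Endomorphisms.
Variables (K : fieldType) (V : lmodType K).

Definition is_linear : {pred V -> V} := fun f => `[< linear f >].

Lemma is_linearP f : reflect (linear f) (f \in is_linear).
Proof. exact: asboolP. Qed.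

Lemma is_linear_submod : GRing.submod_closed is_linear.
Proof.
split=> [|a f g /is_linearP fL /is_linearP gL]; apply/is_linearP => b x y.
  by change (0 = b *: (0 : V) + 0); rewrite scaler0 addr0.
change (a *: f (b *: x + y) + g (b *: x + y) =
  b *: (a *: f x + g x) + (a *: f y + g y)).
by rewrite fL gL !scalerDr !scalerA addrACA [a * b]mulrC.
Qed.
HB.instance Definition _ := GRing.isSubmodClosed.Build K (V -> V) is_linear
  is_linear_submod.

(* The nonzero vector makes the endomorphism ring nontrivial. *)
Record endo (v0 : {v : V | v != 0}) : Type :=
  Endo { endo_val :> V -> V; endo_valP : endo_val \in is_linear }.

Variable v0 : {v : V | v != 0}.
Local Notation end_ := (endo v0).

HB.instance Definition _ := [isSub for @endo_val v0].
HB.instance Definition _ := [Choice of end_ by <:].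
HB.instance Definition _ := [SubChoice_isSubLmodule of end_ by <:].

Lemma endoP (f g : end_) : f =1 g -> f = g.
Proof. by move=> fg; apply: val_inj; apply/funext. Qed.

Lemma endo_linear (f : end_) : linear f.
Proof. exact/is_linearP/endo_valP. Qed.
HB.instance Definition _ (f : end_) := GRing.isLinear.Build K V V _ (endo_val f)
  (endo_linear f).

Lemma endo1_subproof : id \in is_linear.
Proof. by apply/is_linearP => a x y. Qed.
Lemma endoM_subproof (f g : end_) : (fun x => f (g x)) \in is_linear.
Proof. by apply/is_linearP => a x y; rewrite !linearP. Qed.

Definition endo1 : end_ := Endo v0 endo1_subproof.
Definition endoM (f g : end_) : end_ := Endo v0 (endoM_subproof f g).

Lemma endoDE (f g : end_) x : (f + g) x = f x + g x. Proof. by []. Qed.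
Lemma endoNE (f : end_) x : (- f) x = - f x. Proof. by []. Qed.
Lemma endoZE a (f : end_) x : (a *: f) x = a *: f x. Proof. by []. Qed.
Lemma endo0E x : (0 : end_) x = 0. Proof. by []. Qed.

Lemma endoMA : associative endoM. Proof. by move=> f g h; apply: endoP. Qed.
Lemma endo1M : left_id endo1 endoM. Proof. by move=> f; apply: endoP. Qed.
Lemma endoM1 : right_id endo1 endoM. Proof. by move=> f; apply: endoP. Qed.
Lemma endoMDl : left_distributive endoM +%R.
Proof. by move=> f g h; apply: endoP. Qed.
Lemma endoMDr : right_distributive endoM +%R.
Proof. by move=> f g h; apply: endoP => x; rewrite /= linearD. Qed.
Lemma endo1_neq0 : endo1 != 0.
Proof.
by apply/eqP => /(congr1 (fun f : end_ => f (sval v0)))/eqP; apply/negP/(svalP v0).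
Qed.
HB.instance Definition _ := GRing.Zmodule_isNzRing.Build end_
  endoMA endo1M endoM1 endoMDl endoMDr endo1_neq0.

Lemma endoME (f g : end_) x : (f * g) x = f (g x). Proof. by []. Qed.
Lemma endo1E x : (1 : end_) x = x. Proof. by []. Qed.

Lemma endo_scaleAl a (f g : end_) : a *: (f * g) = a *: f * g.
Proof. exact: endoP. Qed.
HB.instance Definition _ := GRing.Lmodule_isLalgebra.Build K end_ endo_scaleAl.
Lemma endo_scaleAr a (f g : end_) : a *: (f * g) = f * (a *: g).
Proof. by apply: endoP => x; rewrite !(endoZE, endoME) linearZ. Qed.
HB.instance Definition _ := GRing.Lalgebra_isAlgebra.Build K end_ endo_scaleAr.

End Endomorphisms.

(** An alias of the carrier, so that the [K]-structure and the [A]-structure can coexist. *)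
Definition restrict_scalars (K : fieldType) (A : algType K) (M : lmodType A)
  : Type := M.

Section RestrictScalars.
Variables (K : fieldType) (A : algType K) (M : lmodType A).
Local Notation MK := (restrict_scalars M).
HB.instance Definition _ := GRing.Zmodule.on MK.

Definition restr_scale (a : K) (x : MK) : MK := (a%:A : A) *: (x : M).

Lemma restr_scaleA a b x : restr_scale a (restr_scale b x) = restr_scale (a * b) x.
Proof. by rewrite /restr_scale scalerA mulr_algl scalerA. Qed.
Lemma restr_scale1 : left_id 1 restr_scale.
Proof. by move=> x; rewrite /restr_scale !scale1r. Qed.
Lemma restr_scaleDr : right_distributive restr_scale +%R.
Proof. by move=> a x y; rewrite /restr_scale scalerDr. Qed.
Lemma restr_scaleDl x : {morph restr_scale^~ x : a b / a + b}.
Proof. by move=> a b; rewrite /restr_scale !scalerDl. Qed.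
HB.instance Definition _ := GRing.Zmodule_isLmodule.Build K MK
  restr_scaleA restr_scale1 restr_scaleDr restr_scaleDl.

Lemma restr_scaleE a (x : MK) : a *: x = (a%:A : A) *: (x : M).
Proof. by []. Qed.

Variable v0 : {v : MK | v != 0}.

Lemma act_subproof (u : A) : (fun x : MK => u *: (x : M)) \in @is_linear K MK.
Proof.
apply/is_linearP => a x y; rewrite !restr_scaleE scalerDr !scalerA.
by rewrite mulr_algl mulr_algr.
Qed.

Definition act (u : A) : endo v0 := Endo v0 (act_subproof u).

Lemma actE u (x : M) : act u x = u *: x. Proof. by []. Qed.

Lemma act_linear : linear act.
Proof.
move=> a u v; apply: endoP => x.
rewrite endoDE endoZE !actE scalerDl; congr (_ + _).
by rewrite restr_scaleE scalerA mulr_algl.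
Qed.
HB.instance Definition _ := GRing.isLinear.Build K A (endo v0) _ act act_linear.

Lemma act_monoid : monoid_morphism act.
Proof.
split=> [|u v]; apply: endoP => x; first by rewrite actE scale1r.
by rewrite endoME !actE scalerA.
Qed.
HB.instance Definition _ := GRing.isMonoidMorphism.Build A (endo v0) act act_monoid.

End RestrictScalars.

(** * Nonzero ideals contain a power of F *)

Section TopCoefficient.
Variable K : fieldType.
Implicit Types (p q : {poly K}) (a b : K).

(** Unlike for [lead_coef], the value [a] may vanish. This makes the relation additive, so that
    leading terms can be computed summand by summand. *)
Definition top_coef n p a : Prop := (size p <= n.+1)%N /\ p`_n = a.

Lemma top_coefD n p q a b :
  top_coef n p a -> top_coef n q b -> top_coef n (p + q) (a + b).
Proof.
move=> [sp <-] [sq <-]; split; last by rewrite coefD.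
by rewrite (leq_trans (size_polyD _ _)) // geq_max sp.
Qed.

Lemma top_coefZ n p a b : top_coef n p a -> top_coef n (b *: p) (b * a).
Proof.
by move=> [sp <-]; split; [rewrite (leq_trans (size_scale_leq _ _))|rewrite coefZ].
Qed.

Lemma top_coefN n p a : top_coef n p a -> top_coef n (- p) (- a).
Proof. by move=> [sp <-]; split; rewrite ?size_polyN ?coefN. Qed.

Lemma top_coefS n p a : top_coef n p a -> top_coef n.+1 p 0.
Proof. by move=> [sp _]; split; rewrite ?nth_default ?(leq_trans sp). Qed.

Lemma top_coefMX n p a : top_coef n p a -> top_coef n.+1 (p * 'X) a.
Proof.
move=> [sp <-]; split; last by rewrite coefMX.
by rewrite (leq_trans (size_polyMleq _ _)) // size_polyX addn2.
Qed.

Lemma top_coef_size n p : top_coef n p 0 -> (size p <= n)%N.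
Proof. by move=> [sp pn]; apply/leq_sizeP => j; case: ltngtP => // [?|<-//] _;
  apply: nth_default; apply: leq_trans sp _. Qed.

Lemma top_coef0 n : top_coef n 0 0.
Proof. by split; rewrite ?size_poly0 ?coef0. Qed.

(** This difference measures the failure of [g(H)] to commute with E (for [a = 2]) and with F (for
    [a = -2]). *)
Definition shift_diff a p := p \Po ('X + a%:P) - p.

Lemma shift_diff_const a b : shift_diff a b%:P = 0.
Proof. by rewrite /shift_diff comp_polyC subrr. Qed.

(** On leading terms the difference operator is [a] times the derivative. *)
Lemma top_coef_shift a n p b :
  top_coef n.+1 p b -> top_coef n (shift_diff a p) (a * n.+1%:R * b).
Proof.
elim: n p b => [|n IH] p b; elim/poly_ind: p => [|q d _] [].
- by move=> _ <-; rewrite -polyC0 shift_diff_const coef0 mulr0; apply: top_coef0.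
- rewrite size_MXaddC coefD coefMX coefC addr0 /= => sq <-.
  have /size1_polyC -> : (size q <= 1)%N.
    by move: sq; case: ifP => // /andP[/eqP-> _]; rewrite size_poly0.
  rewrite coefC /= /shift_diff comp_poly_MXaddC comp_polyC.
  rewrite [X in top_coef _ X](_ : _ = (a * 1 * q`_0)%:P).
    by split; rewrite ?coefC // size_polyC; case: eqP.
  by rewrite !polyCM mulrDr; ring.
- by move=> _ <-; rewrite -polyC0 shift_diff_const coef0 mulr0; apply: top_coef0.
rewrite size_MXaddC coefD coefMX coefC addr0 /= => sq qb.
have tq : top_coef n.+1 q b.
  by split=> //; move: sq; case: ifP => // /andP[/eqP-> _]; rewrite size_poly0.
(* A Leibniz rule for the product [q * 'X], twisted by the shift. *)
rewrite [X in top_coef _ X](_ : _ = shift_diff a q * 'X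
  + a *: (shift_diff a q) + a *: q); last first.
  rewrite /shift_diff comp_poly_MXaddC -!mul_polyC; ring.
rewrite [X in top_coef _ _ X](_ : _ = a * n.+1%:R * b + a * 0 + a * b); last first.
  by rewrite mulr0 addr0 [n.+2%:R]mulrSr; ring.
apply: top_coefD; last exact: top_coefZ.
apply: top_coefD; first exact/top_coefMX/IH.
by apply: top_coefZ; apply: top_coefS; apply: IH tq.
Qed.

Lemma size_shift_diff a n p : (size p <= n.+1)%N -> (size (shift_diff a p) <= n)%N.
Proof.
case: n => [/size1_polyC->|n sp]; first by rewrite shift_diff_const size_poly0.
by have [] := @top_coef_shift a n p p`_n.+1 (conj sp erefl).
Qed.

Lemma top_coef_shiftX a n p b :
  top_coef n p b -> top_coef n (shift_diff a p * 'X) (a * n%:R * b).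
Proof.
case: n => [[/size1_polyC-> _]|n tp]; last exact/top_coefMX/top_coef_shift.
by rewrite shift_diff_const mul0r mulr0 mul0r; apply: top_coef0.
Qed.

Lemma top_coef_shift2X a a' n p b : top_coef n p b ->
  top_coef n (shift_diff a' (shift_diff a p) * 'X * 'X)
    (a * a' * n%:R * (n%:R - 1) * b).
Proof.
case: n => [[/size1_polyC-> _]|n tp].
  rewrite shift_diff_const -polyC0 shift_diff_const !mul0r mulr0 !mul0r.
  exact: top_coef0.
rewrite (_ : _ * _ = a' * n%:R * (a * n.+1%:R * b)).
  exact/top_coefMX/top_coef_shiftX/top_coef_shift.
by rewrite mulrSr; ring.
Qed.
End TopCoefficient.

Section HeisenbergStep.
Variables (K : numFieldType) (A : algType K) (c : K) (P Q : A).
Hypotheses (cN0 : c != 0) (relPQ : P * Q = Q * P + c%:A).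

Lemma heis_pow n : P * Q ^+ n.+1 = Q ^+ n.+1 * P + (n.+1%:R * c) *: Q ^+ n.
Proof.
elim: n => [|n IH]; first by rewrite !expr1 expr0 mul1r.
rewrite exprSr mulrA IH mulrDl -mulrA relPQ mulrDr mulrA -exprSr mulr_algr.
rewrite -scalerAl -exprSr -addrA -scalerDl; congr (_ + _ *: _).
by rewrite [n.+2%:R]mulrSr; ring.
Qed.

Variable X : A -> Prop.
Hypotheses (subX : subspace X) (commXP : forall x, X x -> P * x = x * P).

Definition heis_comp (i : nat) (y : A) : Prop := exists2 x, X x & y = x * Q ^+ i.

Lemma heis_comp_subspace i : subspace (heis_comp i).
Proof.
case: subX => X0 XP; split=> [|a _ _ [x Xx ->] [y Xy ->]].
  by exists 0; rewrite ?mul0r.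
by exists (a *: x + y); [apply: XP|rewrite mulrDl scalerAl].
Qed.

(* The map [x |-> [P, x] Q] has eigenvalue [i c] on [X Q^i]. *)
Lemma heis_step (J : A -> Prop) y :
    subspace J -> (forall x, J x -> J (P * x - x * P)) ->
    (forall x, J x -> J (x * Q)) ->
  subspace_dsum heis_comp y -> J y -> y != 0 ->
  exists x, [/\ X x, J x & x != 0].
Proof.
move=> subJ adP JQ Gy Jy yN0.
pose D x := (P * x - x * P) * Q.
have adPE x n : X x -> P * (x * Q ^+ n.+1) - x * Q ^+ n.+1 * P
    = (n.+1%:R * c) *: (x * Q ^+ n).
  move=> Xx; rewrite mulrA commXP // -!mulrA -mulrBr heis_pow addrC addKr.
  by rewrite scalerAr.
have [] := @dsum_eigen_nonzero _ _ _ heis_comp D (fun n => n%:R * c) J y.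
- move=> a u v; rewrite /D mulrDr [(_ + v) * P]mulrDl -scalerAr -scalerAl opprD addrACA.
  by rewrite -scalerBr mulrDl scalerAl.
- by move=> m n /(mulIf cN0)/eqP; rewrite eqr_nat => /eqP.
- move=> [|n] _ [x Xx ->]; rewrite /D.
    by rewrite expr0 mulr1 commXP // subrr !mul0r scale0r.
  by rewrite adPE // -scalerAl -mulrA -exprSr.
- by [].
- by move=> x Jx; apply/JQ/adP.
- by [].
- by [].
- by [].
move=> n [z [[x Xx ->] Jz zN0]]; exists x; split=> //; last first.
  by apply: contraNneq zN0 => ->; rewrite mul0r.
(* [ad P] sends [x Q^(n+1)] to a nonzero multiple of [x Q^n], which strips the powers of [Q] until
   [x] is reached. *)
elim: n Jz {zN0} => [|n IH] Jz; first by rewrite expr0 mulr1 in Jz.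
apply: IH; have /(subspaceZ (n.+1%:R * c)^-1 subJ) := adP _ Jz.
by rewrite adPE // scalerA mulVf ?scale1r // mulf_neq0 ?pnatr_eq0.
Qed.
End HeisenbergStep.

Lemma horner_algZ (K : fieldType) (A : algType K) (x : A) a g :
  horner_alg x (a *: g) = a *: horner_alg x g.
Proof. by rewrite linearZ /= ?mulr_algl. Qed.

Lemma horner_alg_shift (K : fieldType) (A : algType K) (x y : A) a g :
    x * y = y * (x + a%:A) ->
  horner_alg x g * y = y * horner_alg x (g \Po ('X + a%:P)).
Proof.
move=> xy; elim/poly_ind: g => [|g d IH].
  by rewrite comp_poly0 !rmorph0 mul0r mulr0.
rewrite comp_poly_MXaddC !(rmorphD, rmorphM) /= horner_algX !horner_algC.
by rewrite mulrDl -mulrA xy mulrA IH [RHS]mulrDr mulrA mulr_algl mulr_algr.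
Qed.

Section Sl2Step.
Variables (K : numFieldType) (A : algType K) (chi : K).

(** The first two relations are rules for moving [H] to the right. The Casimir element is normalized
    to take the value [mu (mu + 2)] on a highest weight vector of weight [mu]. *)
Record sl2_rel (E H F : A) : Prop := {
  sl2_HE : H * E = E * (H + 2%:A);
  sl2_HF : H * F = F * (H + (- 2)%:A);
  sl2_EF : E * F = F * E + H;
  sl2_casimir : H * H + 2 *: H + 4 *: (F * E) = chi%:A }.

(** The Chevalley involution up to signs; it turns formulas for [E F^n] into formulas for [F E^n].
    The Casimir relation survives because [4 EF - 2 H = 4 FE + 2 H]. *)
Lemma sl2_rel_sym E H F : sl2_rel E H F -> sl2_rel F (- H) E.
Proof.
case=> HE HF EF cas; split.
- by rewrite mulNr HF -mulrN opprD -scaleNr opprK.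
- by rewrite mulNr HE -mulrN opprD -scaleNr.
- by rewrite EF addrK.
- rewrite -cas mulNr mulrN opprK EF scalerDr scalerN [X in _ + X]addrC !addrA.
  rewrite -[_ - _ + _]addrA; congr (_ + _ + _); rewrite -scaleNr -scalerDl.
  by congr (_ *: _); ring.
Qed.

Lemma sl2_pow E H F n : sl2_rel E H F ->
  E * F ^+ n.+1 = F ^+ n.+1 * E + n.+1%:R *: (F ^+ n * (H - n%:R%:A)).
Proof.
case=> _ HF EF _; elim: n => [|n IH].
  by rewrite !expr1 expr0 mul1r scale0r subr0 scale1r.
rewrite exprSr mulrA IH mulrDl -mulrA EF mulrDr mulrA -exprSr.
rewrite -addrA; congr (_ + _).
have step : (H - n%:R%:A) * F = F * (H - n.+2%:R%:A).
  rewrite mulrBl HF mulr_algl -[n%:R *: F]mulr_algr -mulrBr -addrA.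
  by rewrite -scaleNr -scalerDl -scaleNr; congr (F * (_ + _%:A)); ring.
rewrite -scalerAl -mulrA step mulrA -exprSr !scalerAr -mulrDr; congr (_ * _).
rewrite !scalerBr !scalerA addrA -[X in X + _ *: H]scale1r -scalerDl.
by congr (_ *: _ - _ *: _); ring.
Qed.

Variables (E H F : A) (rel : sl2_rel E H F).
Local Notation ev := (horner_alg H).

(** Solving the Casimir relation for [F E] and for [E F] makes both polynomials in [H]. Every
    product of E, F and H therefore reduces to sums of [E^k g(H)] and [F^k g(H)]. *)
Definition poly_FE : {poly K} := 4^-1 *: (chi%:P - 'X * 'X - 2 *: 'X).
Definition poly_EF : {poly K} := 4^-1 *: (chi%:P - 'X * 'X + 2 *: 'X).

Lemma ev_FE : ev poly_FE = F * E.
Proof.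
case: rel => _ _ _ cas.
rewrite /poly_FE horner_algZ !rmorphB rmorphM /= horner_algX horner_algC -cas.
rewrite horner_algZ horner_algX -[H * H + _ + _]addrA [H * H + _]addrC addrK.
rewrite [2 *: H + _]addrC addrK.
by rewrite scalerA mulVf ?scale1r // pnatr_eq0.
Qed.

Lemma ev_EF : ev poly_EF = E * F.
Proof.
case: (rel) => _ _ -> _; rewrite -ev_FE -[X in _ + X](horner_algX H) -rmorphD.
congr (ev _); have i4 : (4 : {poly K}) * (4^-1)%:P = 1.
  by rewrite -[4]/(4%:R) -(rmorph_nat polyC) -polyCM mulfV ?pnatr_eq0.
(* The last summand is 0 by [i4]; with it the identity holds formally, for [ring] treats the inverse
   of 4 as an unknown. *)
transitivity (poly_FE + 'X + (4 * (4^-1)%:P - 1) * 'X).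
  by rewrite /poly_EF /poly_FE -!mul_polyC; ring.
by rewrite i4 subrr mul0r addr0.
Qed.

Lemma ev_mulE g : ev g * E = E * ev (g \Po ('X + 2%:P)).
Proof. by case: rel => HE _ _ _; apply: horner_alg_shift. Qed.

Lemma ev_mulF g : ev g * F = F * ev (g \Po ('X + (- 2)%:P)).
Proof. by case: rel => _ HF _ _; apply: horner_alg_shift. Qed.

Lemma adE_E k g : E * (E ^+ k * ev g) - E ^+ k * ev g * E
  = E ^+ k.+1 * ev (- shift_diff 2 g).
Proof.
rewrite -[E ^+ k * _ * E]mulrA ev_mulE !mulrA -exprS -exprSr -mulrBr -rmorphB.
by rewrite /shift_diff opprB.
Qed.

Lemma adF_F k g : F * (F ^+ k * ev g) - F ^+ k * ev g * F
  = F ^+ k.+1 * ev (- shift_diff (- 2) g).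
Proof.
rewrite -[F ^+ k * _ * F]mulrA ev_mulF !mulrA -exprS -exprSr -mulrBr -rmorphB.
by rewrite /shift_diff opprB.
Qed.

Lemma F_EpowS k : F * E ^+ k.+1 = E ^+ k * ev (poly_EF - k.+1%:R *: ('X + k%:R%:P)).
Proof.
rewrite (sl2_pow k (sl2_rel_sym rel)) exprSr -mulrA -ev_EF !scalerAr -mulrDr.
congr (_ * _); rewrite rmorphB /= [ev (k.+1%:R *: _)]horner_algZ rmorphD /=.
rewrite horner_algX horner_algC.
by rewrite -opprD scalerN.
Qed.

Lemma E_FpowS k : E * F ^+ k.+1 = F ^+ k * ev (poly_FE + k.+1%:R *: ('X - k%:R%:P)).
Proof.
rewrite (sl2_pow k rel) exprSr -mulrA -ev_FE !scalerAr -mulrDr.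
congr (_ * _); rewrite rmorphD /= [ev (k.+1%:R *: _)]horner_algZ rmorphB /=.
by rewrite horner_algX horner_algC.
Qed.

Lemma adF_E k g : F * (E ^+ k.+1 * ev g) - E ^+ k.+1 * ev g * F
  = E ^+ k * ev (poly_EF * - shift_diff (- 2) g - k.+1%:R *: ('X + k%:R%:P) * g).
Proof.
rewrite mulrA F_EpowS -[E ^+ k.+1 * _ * F]mulrA ev_mulF exprSr !mulrA.
rewrite -[_ * E * F]mulrA -ev_EF -!mulrA -mulrBr -!rmorphM -rmorphB.
congr (_ * ev _); rewrite /shift_diff; ring.
Qed.

Lemma adE_F k g : E * (F ^+ k.+1 * ev g) - F ^+ k.+1 * ev g * E
  = F ^+ k * ev (poly_FE * - shift_diff 2 g + k.+1%:R *: ('X - k%:R%:P) * g).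
Proof.
rewrite mulrA E_FpowS -[F ^+ k.+1 * _ * E]mulrA ev_mulE exprSr !mulrA.
rewrite -[_ * F * E]mulrA -ev_FE -!mulrA -mulrBr -!rmorphM -rmorphB.
congr (_ * ev _); rewrite /shift_diff; ring.
Qed.

Lemma size_poly_ind (S : {poly K} -> Prop) :
    (forall n (g : {poly K}), (forall g' : {poly K}, (size g' <= n)%N -> S g') ->
      (size g <= n.+1)%N -> S g) ->
    S 0 -> forall g : {poly K}, S g.
Proof.
move=> IH S0 g; move: {2}(size g) (leqnn (size g)) => n.
elim: n g => [|n IHn] g sg; last exact: (IH n).
by move: sg; rewrite leqn0 size_poly_eq0 => /eqP->.
Qed.

(* In the filtration by [size g], [ad E o ad F] multiplies the leading coefficient
   of [g] in [E^(k+1) g(H)] by [(n+1)(n+2k+2)], where [n] is the degree. *)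
Lemma adF_E_eq0 k g : F * (E ^+ k.+1 * ev g) = E ^+ k.+1 * ev g * F ->
  E ^+ k.+1 * ev g = 0.
Proof.
elim/size_poly_ind: g => [n g IH sg|]; last by rewrite rmorph0 mulr0.
move=> adF0; have := adF_E k g; rewrite adF0 subrr.
set w := (X in ev X) => w0.
(* The leading term [-X^2/4] of [poly_EF] meets the difference [2 n g_n X^(n-1)], which gives
   [-n/2]; the other summand of [w] gives [-(k+1)]. *)
have tw : top_coef n.+1 w (- ((2^-1 * n%:R + k.+1%:R) * g`_n)).
  rewrite (_ : w = (4^-1 * chi) *: (- shift_diff (- 2) g)
    + 4^-1 *: (shift_diff (- 2) g * 'X * 'X) + (- (2 * 4^-1)) *: (shift_diff (- 2) g * 'X)
    + (- k.+1%:R) *: (g * 'X) + (- k.+1%:R * k%:R) *: g); last first.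
    rewrite /w /poly_EF -!mul_polyC; ring.
  have tg : top_coef n g g`_n by [].
  have t1 := top_coef_shiftX (- 2) tg.
  have t2 : top_coef n (shift_diff (- 2) g) 0.
    by split; [apply: leqW|apply: nth_default]; apply: size_shift_diff.
  rewrite (_ : - _ = (4^-1 * chi) * - 0 + 4^-1 * (- 2 * n%:R * g`_n) + - (2 * 4^-1) * 0
    + - k.+1%:R * g`_n + (- k.+1%:R * k%:R) * 0); last by field.
  apply: top_coefD; last by apply/top_coefZ/top_coefS/tg.
  apply: top_coefD; last by apply/top_coefZ/top_coefMX.
  apply: top_coefD; last by apply/top_coefZ/top_coefS/t1.
  apply: top_coefD; last by apply/top_coefZ/top_coefMX.
  by apply/top_coefZ/top_coefN/top_coefS/t2.
have := adE_E k w; rewrite -w0 mulr0 mul0r subrr; set v := (X in ev X) => v0.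
have tv : top_coef n v (n.+1%:R * (n%:R + 2 * k.+1%:R) * g`_n).
  rewrite (_ : _ * _ = - (2 * n.+1%:R * (- ((2^-1 * n%:R + k.+1%:R) * g`_n)))).
    exact/top_coefN/top_coef_shift.
  by field.
set a : K := n.+1%:R * (n%:R + 2 * k.+1%:R) in tv.
have aN0 : a != 0.
  rewrite mulf_neq0 ?pnatr_eq0 // -natrM -natrD pnatr_eq0.
  by rewrite addn_eq0 negb_and orbT.
(* As [E^(k+1) v(H) = 0], a multiple of [v] may be subtracted from [g] so as to cancel its leading
   coefficient. *)
have gE : E ^+ k.+1 * ev g = E ^+ k.+1 * ev (g - a^-1 *: v).
  by rewrite rmorphB /= horner_algZ mulrBr -scalerAr -v0 scaler0 subr0.
rewrite gE; apply: IH; last by rewrite -gE.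
apply: top_coef_size; rewrite (_ : 0 = g`_n + - (a^-1 * (a * g`_n))); last first.
  by rewrite mulrA mulVf // mul1r subrr.
by apply: top_coefD => //; apply/top_coefN/top_coefZ.
Qed.

Variable J : A -> Prop.
Hypotheses (subJ : subspace J) (adFJ : forall x, J x -> J (F * x - x * F)).

(** By [adF_E_eq0], [ad F] never kills a nonzero [E^(k+1) g(H)], so it removes the powers of E one
    at a time. *)
Lemma ideal_lower_E k g : J (E ^+ k * ev g) -> E ^+ k * ev g != 0 ->
  exists2 g', J (ev g') & ev g' != 0.
Proof.
elim: k g => [|k IH] g; first by rewrite expr0 mul1r; exists g.
move=> /adFJ; rewrite adF_E; set w := (X in ev X) => Jw gN0.
apply: (IH w) => //; apply: contraNneq gN0 => w0.
by apply/eqP/adF_E_eq0/eqP; rewrite -subr_eq0 adF_E -/w w0.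
Qed.

(* Either [ad F] lowers the degree [n] of [g], or it kills [F^k g(H)]; in the latter
   case [ad E o ad F] yields an element [F^k w(H) = 0], where [w] has leading
   coefficient [n (n+2k+1)] times that of [g]. *)
Lemma ideal_lower_F k g : J (F ^+ k * ev g) -> F ^+ k * ev g != 0 ->
  exists2 m, J (F ^+ m) & F ^+ m != 0.
Proof.
elim/size_poly_ind: g k => [n g IH sg|] k; last by rewrite rmorph0 mulr0 eqxx.
move=> Jg gN0; have := adFJ Jg; rewrite adF_F; set u := (X in ev X) => Ju.
have tg : top_coef n g g`_n by [].
have su : (size u <= n)%N by rewrite size_polyN; apply: size_shift_diff.
have [u0|uN0] := eqVneq (F ^+ k.+1 * ev u) 0; last exact: (IH u su k.+1).
have := adE_F k u; rewrite u0 mulr0 mul0r subrr; set w := (X in ev X) => w0.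
(* For constant [g] the element is a nonzero multiple of [F^k], and the descent ends. *)
case: n => [|n] in IH sg tg su *.
  rewrite (size1_polyC sg) horner_algC mulr_algr in Jg gN0; exists k.
    have /(subspaceZ (g`_0)^-1 subJ) := Jg; rewrite scalerA mulVf ?scale1r //.
    by apply: contraNneq gN0 => ->; rewrite scale0r.
  by apply: contraNneq gN0 => ->; rewrite scaler0.
have tw : top_coef n.+1 w (n.+1%:R * (n.+1%:R + 2 * k%:R + 1) * g`_n.+1).
  have t1 : top_coef n.+1 (u * 'X) (2 * n.+1%:R * g`_n.+1).
    rewrite /u mulNr (_ : 2 * _ * _ = - (- 2 * n.+1%:R * g`_n.+1)); last by ring.
    exact/top_coefN/top_coef_shiftX.
  have t2 : top_coef n.+1 (shift_diff 2 u * 'X * 'X)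
      (4 * n.+1%:R * (n.+1%:R - 1) * g`_n.+1).
    have -> : shift_diff 2 u = - shift_diff 2 (shift_diff (- 2) g).
      by rewrite /shift_diff /u /shift_diff comp_polyB raddfN /= comp_polyB; ring.
    rewrite !mulNr (_ : 4 * _ * _ * _ = - (- 2 * 2 * n.+1%:R * (n.+1%:R - 1) * g`_n.+1)).
      exact/top_coefN/top_coef_shift2X.
    by ring.
  have tsu : top_coef n u u`_n by [].
  have t3 : top_coef n.+1 (shift_diff 2 u * 'X) 0.
    by apply: top_coefS; apply: top_coef_shiftX tsu.
  have t4 : top_coef n.+1 (shift_diff 2 u) 0.
    by split; [rewrite ltnW // ltnW // ltnS|apply: nth_default; apply: leqW];
      apply: size_shift_diff.
  rewrite (_ : w = (4^-1 * chi) *: - shift_diff 2 u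
    + 4^-1 *: (shift_diff 2 u * 'X * 'X) + (2 * 4^-1) *: (shift_diff 2 u * 'X)
    + k.+1%:R *: (u * 'X) + (- k.+1%:R * k%:R) *: u); last first.
    rewrite /w /poly_FE -!mul_polyC; ring.
  rewrite (_ : n.+1%:R * _ * _ = (4^-1 * chi) * - 0
    + 4^-1 * (4 * n.+1%:R * (n.+1%:R - 1) * g`_n.+1) + (2 * 4^-1) * 0
    + k.+1%:R * (2 * n.+1%:R * g`_n.+1) + (- k.+1%:R * k%:R) * 0); last first.
    by rewrite [k.+1%:R]mulrSr; field.
  apply: top_coefD; last by apply/top_coefZ/top_coefS/tsu.
  apply: top_coefD; last by apply/top_coefZ.
  apply: top_coefD; last by apply/top_coefZ.
  apply: top_coefD; last by apply/top_coefZ.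
  by apply/top_coefZ/top_coefN.
set a : K := n.+1%:R * (n.+1%:R + 2 * k%:R + 1) in tw; have aN0 : a != 0.
  by rewrite mulf_neq0 ?pnatr_eq0 // -natrM -natrD natr1 pnatr_eq0.
have gE : F ^+ k * ev g = F ^+ k * ev (g - a^-1 *: w).
  by rewrite rmorphB /= horner_algZ mulrBr -scalerAr -w0 scaler0 subr0.
rewrite gE in Jg gN0; apply: (IH _ _ k Jg gN0).
apply: top_coef_size; rewrite (_ : 0 = g`_n.+1 + - (a^-1 * (a * g`_n.+1))).
  by apply: top_coefD => //; apply/top_coefN/top_coefZ.
by rewrite mulrA mulVf // mul1r subrr.
Qed.
End Sl2Step.

(** * Ideals of a quotient of U(sl2) tensored with the Weyl algebra *)

Section SplitIdeals.
Variables (K : numFieldType) (A : algType K) (c chi : K) (E H F P Q : A).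

Record split_rel : Prop := {
  split_sl2 : sl2_rel chi E H F;
  split_PQ : P * Q = Q * P + c%:A;
  split_EP : P * E = E * P; split_EQ : Q * E = E * Q;
  split_HP : P * H = H * P; split_HQ : Q * H = H * Q;
  split_FP : P * F = F * P; split_FQ : Q * F = F * Q }.

Hypotheses (cN0 : c != 0) (rel : split_rel).
Local Notation ev := (horner_alg H).
Local Notation sl2 := (split_sl2 rel).

(* [ad H] has eigenvalue [2 k] here; [Negz n] is [-(n+1)]. *)
Definition wt_space (k : int) (x : A) : Prop :=
  match k with
  | Posz n => exists g, x = E ^+ n * ev g
  | Negz n => exists g, x = F ^+ n.+1 * ev g
  end.

Lemma mul_ev_subspace y : subspace (fun x => exists g, x = y * ev g).
Proof.
split=> [|a _ _ [g ->] [g' ->]]; first by exists 0; rewrite rmorph0 mulr0.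
by exists (a *: g + g'); rewrite rmorphD /= horner_algZ mulrDr scalerAr.
Qed.

Lemma wt_space_subspace k : subspace (wt_space k).
Proof. by case: k => n; apply: mul_ev_subspace. Qed.

(** [P] and [Q] are adjoined one after the other because [heis_step] asks for commutation: [P]
    commutes with [fock_alg], and [Q] with [sl2_alg]. *)
Definition sl2_alg := subspace_dsum wt_space.
Definition fock_alg := subspace_dsum (heis_comp P sl2_alg).
Definition split_alg := subspace_dsum (heis_comp Q fock_alg).

Lemma sl2_alg_subspace : subspace sl2_alg.
Proof. exact/dsum_subspace/wt_space_subspace. Qed.
Lemma fock_alg_subspace : subspace fock_alg.
Proof. exact/dsum_subspace/heis_comp_subspace/sl2_alg_subspace. Qed.
Lemma split_alg_subspace : subspace split_alg.
Proof. exact/dsum_subspace/heis_comp_subspace/fock_alg_subspace. Qed.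

Lemma mull_linear (T : A) : linear ( *%R T).
Proof. by move=> a x y; rewrite mulrDr scalerAr. Qed.

Lemma ad_linear (T : A) : linear (fun x => T * x - x * T).
Proof.
by move=> a x y; rewrite mulrDr mulrDl -scalerAr -scalerAl opprD addrACA scalerBr.
Qed.

Lemma comm_subspace (T : A) : subspace (fun x => T * x = x * T).
Proof.
split=> [|a x y Tx Ty]; first by rewrite mulr0 mul0r.
by rewrite mulrDr mulrDl -scalerAr -scalerAl Tx Ty.
Qed.

Lemma comm_ev (T : A) g : T * H = H * T -> T * ev g = ev g * T.
Proof.
move=> TH; elim/poly_ind: g => [|g d IH]; first by rewrite rmorph0 mulr0 mul0r.
rewrite rmorphD rmorphM /= horner_algX horner_algC mulrDr mulrDl.
by rewrite mulr_algr mulr_algl mulrA IH -!mulrA TH.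
Qed.

Lemma H_pow y a n : H * y = y * (H + a%:A) ->
  H * y ^+ n = y ^+ n * (H + (n%:R * a)%:A).
Proof.
move=> Hy; elim: n => [|n IH].
  by rewrite expr0 mulr1 mul0r scale0r addr0 mul1r.
rewrite exprSr mulrA IH -!mulrA mulrDl Hy mulr_algl -[_ *: y]mulr_algr -mulrDr.
by rewrite -addrA -scalerDl -natr1 mulrDl mul1r [a + _]addrC.
Qed.

Lemma H_pow_ev y a n g : H * y = y * (H + a%:A) ->
  H * (y ^+ n * ev g) = y ^+ n * ev (('X + (n%:R * a)%:P) * g).
Proof.
move=> Hy; rewrite mulrA (H_pow n Hy) -mulrA rmorphM rmorphD /= horner_algX.
by rewrite horner_algC.
Qed.

Lemma adH_wt k x : wt_space k x -> H * x - x * H = (2 * k%:~R) *: x.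
Proof.
have [HE HF _ _] := sl2.
have evH g : ev g * H = ev (g * 'X) by rewrite rmorphM /= horner_algX.
have adH y a n g : H * y = y * (H + a%:A) ->
    H * (y ^+ n * ev g) - y ^+ n * ev g * H = (n%:R * a) *: (y ^+ n * ev g).
  move=> Hy; rewrite (H_pow_ev _ _ Hy) -mulrA evH -mulrBr -rmorphB /=.
  by rewrite mulrDl [g * 'X]mulrC addrC addKr mul_polyC horner_algZ -scalerAr.
case: k => n [g ->]; first by rewrite (adH _ _ _ _ HE) mulrC.
by rewrite (adH _ _ _ _ HF) NegzE rmorphN /= !mulrN mulrC.
Qed.

(** Stability of the spans under left multiplication by the generators is the goal here and below,
    since [gen_ind] builds words from the left. *)
Lemma sl2_algH x : sl2_alg x -> sl2_alg (H * x).
Proof.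
move: x; apply: (dsum_map (mull_linear _) sl2_alg_subspace) => k y.
have [HE HF _ _] := sl2.
move=> yk; apply: (@dsum_in _ _ _ _ wt_space_subspace k).
by case: k yk => n [g ->]; eexists; [exact: H_pow_ev HE|exact: H_pow_ev HF].
Qed.

Lemma sl2_algE x : sl2_alg x -> sl2_alg (E * x).
Proof.
move: x; apply: (dsum_map (mull_linear _) sl2_alg_subspace) => k y.
case: k => [n|[|n]] /= [g ->]; rewrite mulrA.
- by rewrite -exprS; apply: (@dsum_in _ _ _ _ wt_space_subspace (Posz n.+1)); exists g.
- rewrite (E_FpowS sl2) -mulrA -rmorphM.
  by apply: (@dsum_in _ _ _ _ wt_space_subspace (Posz 0)); eexists.
- rewrite (E_FpowS sl2) -mulrA -rmorphM.
  by apply: (@dsum_in _ _ _ _ wt_space_subspace (Negz n)); eexists.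
Qed.

Lemma sl2_algF x : sl2_alg x -> sl2_alg (F * x).
Proof.
move: x; apply: (dsum_map (mull_linear _) sl2_alg_subspace) => k y.
case: k => [[|n]|n] [g ->]; rewrite mulrA.
- rewrite expr0 mulr1 -[F]expr1.
  by apply: (@dsum_in _ _ _ _ wt_space_subspace (Negz 0)); exists g.
- rewrite (F_EpowS sl2) -mulrA -rmorphM.
  by apply: (@dsum_in _ _ _ _ wt_space_subspace (Posz n)); eexists.
- by rewrite -exprS; apply: (@dsum_in _ _ _ _ wt_space_subspace (Negz n.+1)); exists g.
Qed.

Lemma sl2_alg_comm (T : A) : T * E = E * T -> T * H = H * T -> T * F = F * T ->
  forall x, sl2_alg x -> T * x = x * T.
Proof.
move=> TE TH TF; apply: (dsum_sub (comm_subspace T)) => k y.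
have pow G n : T * G = G * T -> T * G ^+ n = G ^+ n * T.
  by move=> TG; apply: (@commrX _ T G n TG).
by case: k => n [g ->]; rewrite mulrA pow // -!mulrA comm_ev.
Qed.

Lemma sl2_alg_commP x : sl2_alg x -> P * x = x * P.
Proof. by case: rel => _ _ EP _ HP _ FP _; apply: sl2_alg_comm. Qed.
Lemma sl2_alg_commQ x : sl2_alg x -> Q * x = x * Q.
Proof. by case: rel => _ _ _ EQ _ HQ _ FQ; apply: sl2_alg_comm. Qed.

Lemma heis_comp_mull (T Y : A) (X : A -> Prop) :
    subspace X -> (forall x, X x -> X (T * x)) ->
  forall y, subspace_dsum (heis_comp Y X) y -> subspace_dsum (heis_comp Y X) (T * y).
Proof.
move=> sX TX; have sC := dsum_subspace (heis_comp_subspace Y sX).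
apply: (dsum_map (mull_linear T) sC) => i _ [x Xx ->].
rewrite mulrA; apply: (@dsum_in _ _ _ _ _ i); first exact: heis_comp_subspace.
by exists (T * x) => //; apply: TX.
Qed.

Lemma sl2_alg1 : sl2_alg 1.
Proof.
apply: (@dsum_in _ _ _ _ wt_space_subspace (Posz 0)).
by exists 1; rewrite expr0 mul1r rmorph1.
Qed.

Lemma split_alg_mono x i j : sl2_alg x -> split_alg (x * P ^+ j * Q ^+ i).
Proof.
move=> Bx; apply: (@dsum_in _ _ _ _ _ i); first exact/heis_comp_subspace/fock_alg_subspace.
exists (x * P ^+ j) => //; apply: (@dsum_in _ _ _ _ _ j); last by exists x.
exact/heis_comp_subspace/sl2_alg_subspace.
Qed.

Lemma split_alg_ind (S : A -> Prop) : subspace S ->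
    (forall x i j, sl2_alg x -> S (x * P ^+ j * Q ^+ i)) ->
  forall y, split_alg y -> S y.
Proof.
move=> sS Sm; apply: (dsum_sub sS) => i _ [y Cy ->].
move: y Cy; apply: (@dsum_map _ _ _ _ ( *%R^~ (Q ^+ i)) _ _ sS).
  by move=> a u v; rewrite mulrDl scalerAl.
by move=> j _ [x Bx ->]; apply: Sm.
Qed.

Lemma split_alg1 : split_alg 1.
Proof. by have := split_alg_mono 0 0 sl2_alg1; rewrite !expr0 !mulr1. Qed.

Lemma split_algE x : split_alg x -> split_alg (E * x).
Proof.
apply: heis_comp_mull; first exact: fock_alg_subspace.
by apply: heis_comp_mull; [exact: sl2_alg_subspace|exact: sl2_algE].
Qed.
Lemma split_algH x : split_alg x -> split_alg (H * x).
Proof.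
apply: heis_comp_mull; first exact: fock_alg_subspace.
by apply: heis_comp_mull; [exact: sl2_alg_subspace|exact: sl2_algH].
Qed.
Lemma split_algF x : split_alg x -> split_alg (F * x).
Proof.
apply: heis_comp_mull; first exact: fock_alg_subspace.
by apply: heis_comp_mull; [exact: sl2_alg_subspace|exact: sl2_algF].
Qed.

Lemma split_algP x : split_alg x -> split_alg (P * x).
Proof.
move: x; apply: (split_alg_ind (subspace_preim (mull_linear P) split_alg_subspace)).
move=> x' i j Bx.
by rewrite !mulrA sl2_alg_commP // -(mulrA x') -exprS; apply: split_alg_mono.
Qed.

Lemma QP_rel : Q * P = P * Q + (- c)%:A.
Proof. by rewrite (split_PQ rel) scaleNr addrK. Qed.

Lemma split_algQ x : split_alg x -> split_alg (Q * x).
Proof.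
move: x; apply: (split_alg_ind (subspace_preim (mull_linear Q) split_alg_subspace)).
move=> x' i [|j] Bx.
- by rewrite expr0 mulr1 mulrA sl2_alg_commQ // -mulrA -exprS -[x']mulr1;
    apply: (split_alg_mono _ 0).
rewrite !mulrA sl2_alg_commQ // -(mulrA x') (heis_pow QP_rel) mulrDr !mulrDl addrC.
case: split_alg_subspace => _; rewrite -scalerAr -scalerAl; apply.
  exact: split_alg_mono.
by rewrite !mulrA -(mulrA _ Q) -exprS; apply: split_alg_mono.
Qed.

Theorem split_ideal_Fpow (J : A -> Prop) x :
    subspace J ->
    (forall y, J y -> J (F * y - y * F)) ->
    (forall y, J y -> J (H * y - y * H)) ->
    (forall y, J y -> J (P * y - y * P)) -> (forall y, J y -> J (Q * y - y * Q)) ->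
    (forall y, J y -> J (y * P)) -> (forall y, J y -> J (y * Q)) ->
  split_alg x -> J x -> x != 0 -> exists2 m, J (F ^+ m) & F ^+ m != 0.
Proof.
move=> sJ adF adH adP adQ JP JQ Ax Jx xN0.
have commP y : fock_alg y -> P * y = y * P.
  move: y; apply: (dsum_sub (comm_subspace P)) => j _ [y By ->].
  by rewrite mulrA sl2_alg_commP // -!mulrA -exprS exprSr.
have [y [Cy Jy yN0]] :=
  heis_step cN0 (split_PQ rel) commP sJ adP JQ Ax Jx xN0.
have NcN0 : - c != 0 by rewrite oppr_eq0.
have [b [Bb Jb bN0]] :=
  heis_step NcN0 QP_rel sl2_alg_commQ sJ adQ JP Cy Jy yN0.
have [|k [w [wk Jw wN0]]] := dsum_eigen_nonzero (ad_linear H)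
    (th := fun k : int => 2 * k%:~R) _ adH_wt sJ adH Bb Jb bN0.
  by move=> k l /mulfI; rewrite pnatr_eq0 => /(_ isT)/intr_inj.
case: k wk => n [g wE]; rewrite {w}wE in Jw wN0.
  have [g' Jg' g'N0] := ideal_lower_E sl2 adF Jw wN0.
  by apply: (ideal_lower_F sl2 sJ adF (k := 0) (g := g')); rewrite expr0 mul1r.
exact: (ideal_lower_F sl2 sJ adF Jw wN0).
Qed.
End SplitIdeals.

(** * The sl2-triple commuting with p and q *)

Section Brackets.
Variables (K : numFieldType) (A : algType K).

Definition br (x y : A) := x * y - y * x.

Lemma brDl x y w : br (x + y) w = br x w + br y w.
Proof. by rewrite /br mulrDl mulrDr opprD addrACA. Qed.
Lemma brZl a x w : br (a *: x) w = a *: br x w.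
Proof. by rewrite /br -scalerAl -scalerAr scalerBr. Qed.
Lemma brC x y : br y x = - br x y.
Proof. by rewrite /br opprB. Qed.
Lemma brDr x y w : br w (x + y) = br w x + br w y.
Proof. by rewrite brC brDl opprD -!brC. Qed.
Lemma brZr a x w : br w (a *: x) = a *: br w x.
Proof. by rewrite brC brZl -scalerN -brC. Qed.
Lemma brMl x y w : br (x * y) w = x * br y w + br x w * y.
Proof. by rewrite /br mulrBr mulrBl !mulrA subrKA. Qed.
Lemma brMr x y w : br w (x * y) = br w x * y + x * br w y.
Proof. by rewrite /br mulrBr mulrBl !mulrA subrKA. Qed.
Lemma br_eq0 x y : br x y = 0 -> x * y = y * x.
Proof. by move/subr0_eq. Qed.

Lemma brxx x : br x x = 0. Proof. exact: subrr. Qed.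

Definition casimir (E H F : A) : A := H * H + 2 *: H + 4 *: (F * E).

Variables (E H F : A).
Hypotheses (HE : br H E = 2 *: E) (HF : br H F = - (2 *: F)) (EF : br E F = H).

Lemma casimir_brE : br (casimir E H F) E = 0.
Proof.
rewrite /casimir !brDl !brZl !brMl HE brxx mulr0 add0r [br F E]brC EF mulNr.
have -> : 2 *: E * H = 2 *: (H * E) - 2 *: (2 *: E).
  by rewrite -scalerAl -scalerBr -HE /br opprB addrC subrK.
rewrite -scalerAr addrA subrK -scalerDl scalerN.
by rewrite (_ : 2 + 2 = 4) ?subrr //; ring.
Qed.

Lemma casimir_brF : br (casimir E H F) F = 0.
Proof.
rewrite /casimir !brDl !brZl !brMl HF EF brxx mul0r addr0 mulrN mulNr.
have -> : H * (2 *: F) = 2 *: (F * H) - 2 *: (2 *: F).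
  by rewrite -scalerAr -scalerBr -[2 *: F]opprK -HF /br opprK addrC subrK.
have L (a b : A) : a - b - b - a = - (b + b).
  by rewrite addrAC [a - b - a]addrAC subrr sub0r opprD.
rewrite -scalerAl opprB scalerN L -scalerDl.
by rewrite (_ : 2 + 2 = 4) ?addNr //; ring.
Qed.

Lemma casimir_brH : br (casimir E H F) H = 0.
Proof.
rewrite /casimir !brDl !brZl !brMl brxx mulr0 mul0r addr0 scaler0 !add0r.
rewrite [br E H]brC [br F H]brC HE HF opprK mulrN -scalerAr -scalerAl.
by rewrite addNr scaler0.
Qed.
End Brackets.

Section SplitSchrodinger.
Variables (K : numFieldType) (A : algType K).

Variables (c : K) (e h f p q : A).

Record schrodinger_rel : Prop := {
  sch_he : br h e = 2 *: e; sch_ef : br e f = h; sch_hf : br h f = - (2 *: f);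
  sch_eq : br e q = p; sch_ep : br e p = 0; sch_hp : br h p = p;
  sch_fp : br f p = q; sch_fq : br f q = 0; sch_hq : br h q = - q;
  sch_pq : br p q = c%:A }.

(* The correction terms are the oscillator representation of sl2 in the Weyl
   algebra generated by [p] and [q]. *)
Definition split_E := e - (2 * c)^-1 *: (p * p).
Definition split_H := h + (2 * c)^-1 *: (p * q + q * p).
Definition split_F := f + (2 * c)^-1 *: (q * q).

Hypotheses (cN0 : c != 0) (rel : schrodinger_rel).
Local Notation E := split_E.
Local Notation H := split_H.
Local Notation F := split_F.

Let qp : br q p = (- c)%:A.
Proof. by rewrite brC (sch_pq rel) scaleNr. Qed.

Let kc : (2 * c)^-1 * c = 2^-1.
Proof. by field. Qed.

Let kc2 (x : A) : (2 * c)^-1 *: (c *: x + c *: x) = x.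
Proof.
rewrite -scalerDr scalerA kc scalerDr -scalerDl.
by rewrite (_ : _ + _ = 1) ?scale1r //; field.
Qed.

Lemma split_brEP : br E p = 0.
Proof.
rewrite /E brDl -scaleNr brZl (sch_ep rel) brMl brxx.
by rewrite mulr0 mul0r addr0 scaler0 addr0.
Qed.
Lemma split_brEQ : br E q = 0.
Proof.
rewrite /E brDl -scaleNr brZl (sch_eq rel) brMl (sch_pq rel) mulr_algr mulr_algl.
by rewrite scaleNr kc2 subrr.
Qed.
Lemma split_brFQ : br F q = 0.
Proof. by rewrite /F brDl brZl (sch_fq rel) brMl brxx mulr0 mul0r addr0 scaler0 addr0. Qed.
Lemma split_brFP : br F p = 0.
Proof.
rewrite /F brDl brZl (sch_fp rel) brMl qp mulr_algr mulr_algl.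
by rewrite !scaleNr -opprD scalerN kc2 subrr.
Qed.
Lemma split_brHP : br H p = 0.
Proof.
rewrite /H brDl brZl (sch_hp rel) brDl !brMl qp brxx mulr0 mul0r add0r addr0.
by rewrite mulr_algr mulr_algl !scaleNr -opprD scalerN kc2 subrr.
Qed.
Lemma split_brHQ : br H q = 0.
Proof.
rewrite /H brDl brZl (sch_hq rel) brDl !brMl (sch_pq rel) brxx mulr0 mul0r add0r addr0.
by rewrite mulr_algr mulr_algl kc2 addNr.
Qed.

(** As [H] commutes with [p], the bracket with the correction term of [E] vanishes and only [br H e]
    is left. The same shortcut serves the next two brackets. *)
Lemma split_brHE : br H E = 2 *: E.
Proof.
rewrite {1}/E brDr -scaleNr brZr brMr split_brHP mul0r mulr0 addr0 scaler0 addr0.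
rewrite /H brDl brZl (sch_he rel) brDl !brMl [br q e]brC [br p e]brC.
rewrite (sch_eq rel) (sch_ep rel) oppr0 mul0r mulr0 add0r addr0 mulrN mulNr.
by rewrite -opprD scalerN /E scalerBr -mulr2n -scaler_nat !scalerA [_ * 2]mulrC.
Qed.
Lemma split_brHF : br H F = - (2 *: F).
Proof.
rewrite {1}/F brDr brZr brMr split_brHQ mul0r mulr0 addr0 scaler0 addr0.
rewrite /H brDl brZl (sch_hf rel) brDl !brMl [br q f]brC [br p f]brC.
rewrite (sch_fp rel) (sch_fq rel) oppr0 mul0r mulr0 add0r addr0 mulrN mulNr.
by rewrite -opprD scalerN -mulr2n -scaler_nat /F scalerDr opprD !scalerA [_ * 2]mulrC.
Qed.
Lemma split_brEF : br E F = H.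
Proof.
rewrite {1}/F brDr brZr brMr split_brEQ mul0r mulr0 addr0 scaler0 addr0.
rewrite /E brDl -scaleNr brZl (sch_ef rel) brMl [br p f]brC (sch_fp rel).
by rewrite mulrN mulNr -opprD scalerN scaleNr opprK.
Qed.

Lemma split_HE : H * E = E * (H + 2%:A).
Proof. by rewrite [RHS]mulrDr mulr_algr -split_brHE /br addrC subrK. Qed.
Lemma split_HF : H * F = F * (H + (- 2)%:A).
Proof. by rewrite [RHS]mulrDr mulr_algr scaleNr -split_brHF /br addrC subrK. Qed.
Lemma split_EF : E * F = F * E + H.
Proof. by rewrite -split_brEF /br addrC subrK. Qed.

Lemma split_relP chi : casimir E H F = chi%:A -> split_rel c chi E H F p q.
Proof.
move=> cas; split.
- by split; [exact: split_HE|exact: split_HF|exact: split_EF|].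
- by rewrite -(sch_pq rel) /br addrC subrK.
- exact/esym/br_eq0/split_brEP.
- exact/esym/br_eq0/split_brEQ.
- exact/esym/br_eq0/split_brHP.
- exact/esym/br_eq0/split_brHQ.
- exact/esym/br_eq0/split_brFP.
- exact/esym/br_eq0/split_brFQ.
Qed.
End SplitSchrodinger.

(** Monomials of the free algebra are lists of elements of [g], so their images span, and each
    arises from 1 by left multiplications. *)
Lemma uea_ind (K : fieldType) (g : lieAlgType K) (S : uea g -> Prop) :
    subspace S -> S 1 -> (forall x u, S u -> S (uea_inj x * u)) -> forall u, S u.
Proof.
move=> sS S1 SM u; have [r ->] := uea_pi_surj u.
rewrite [r]monalgE raddf_sum; apply: subspace_sum => // m.
suff Sm : S (uea_pi << m >>).
  have -> : << r@_m *g m >> = r@_m *: (<< m >> : free_alg g).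
    by apply/malgP => k; rewrite mcoeffZ !mcoeffU mulrnAr mulr1.
  by rewrite /= uea_piZ; apply: (subspaceZ _ sS Sm).
case: m => s; elim: s => [|x s IH].
  by rewrite -fmoneE.
have -> : << FMonom (x :: s) >> = free_gen x * (<< FMonom s >> : free_alg g).
  rewrite /free_gen malgM_def fgmulUU mulr1; congr << _ *g _ >>.
  by apply: val_inj; rewrite /= fmM fmU.
by rewrite uea_piM; apply: SM.
Qed.

Lemma subspace_lin6 (K : fieldType) (A : algType K) (S : A -> Prop) u
    x0 x1 x2 x3 x4 x5 (a0 a1 a2 a3 a4 a5 : K) : subspace S ->
    S (x0 * u) -> S (x1 * u) -> S (x2 * u) -> S (x3 * u) -> S (x4 * u) -> S (x5 * u) ->
  S ((a0 *: x0 + (a1 *: x1 + (a2 *: x2 + (a3 *: x3 + (a4 *: x4 + a5 *: x5))))) * u).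
Proof.
move=> sS S0 S1 S2 S3 S4 S5; rewrite !mulrDl -!scalerAl.
by do 5![apply: (subspaceD sS); first exact: subspaceZ]; apply: subspaceZ.
Qed.

Lemma br_morph (K : numFieldType) (B A : algType K) (phi : {lrmorphism B -> A}) x y :
  phi (br x y) = br (phi x) (phi y).
Proof. by rewrite /br rmorphB !rmorphM. Qed.

(** * Generators and relations of the enveloping algebra *)

Section SchrodingerGeneration.
Variables (K : numFieldType).
Local Notation U := (uea (schrodinger K)).
Local Notation inj := (@uea_inj K (schrodinger K)).
Local Notation coord := Defs.coord.

Lemma uea_injP a x y : inj (a *: x + y) = a *: inj x + inj y.
Proof. by have [injP _] := @uea_inj_lie K (schrodinger K); apply: injP. Qed.

Lemma uea_inj0 : inj 0 = 0.
Proof. by have := uea_injP (-1) 0 0; rewrite scaler0 addr0 scaleN1r addNr. Qed.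

Lemma uea_injZ a x : inj (a *: x) = a *: inj x.
Proof. by rewrite -[a *: x]addr0 uea_injP uea_inj0 addr0. Qed.

Lemma uea_injN x : inj (- x) = - inj x.
Proof.
rewrite -[- x]scaleN1r.
rewrite uea_injZ.
exact: scaleN1r.
Qed.

Lemma uea_inj_basis (x : schrodinger K) :
  inj x = coord 0 x *: inj (sch_e K) + (coord 1 x *: inj (sch_h K)
    + (coord 2 x *: inj (sch_f K) + (coord 3 x *: inj (sch_p K)
    + (coord 4 x *: inj (sch_q K) + coord 5 x *: inj (sch_z K))))).
Proof.
have {1}-> : x = coord 0 x *: sch_e K + (coord 1 x *: sch_h K
    + (coord 2 x *: sch_f K + (coord 3 x *: sch_p K
    + (coord 4 x *: sch_q K + coord 5 x *: sch_z K)))).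
  apply: coordP => k k6; rewrite !(linearD, linearZ) /=.
  by case: k k6 => [|[|[|[|[|[|//]]]]]] _; rewrite !Defs.coord_basis //=
    ?(mulr0, mulr1, addr0, add0r).
rewrite uea_injP.
rewrite uea_injP.
rewrite uea_injP.
rewrite uea_injP.
rewrite uea_injP.
by rewrite uea_injZ.
Qed.

Lemma sch_uea_ind (S : U -> Prop) : subspace S -> S 1 ->
    (forall u, S u -> [/\ S (inj (sch_e K) * u), S (inj (sch_h K) * u)
                        & S (inj (sch_f K) * u)]) ->
    (forall u, S u -> [/\ S (inj (sch_p K) * u), S (inj (sch_q K) * u)
                        & S (inj (sch_z K) * u)]) ->
  forall u, S u.
Proof.
move=> sS S1 S2 S3; apply: (uea_ind sS S1) => x u Su.
have [Se Sh Sf] := S2 u Su; have [Sp Sq Sz] := S3 u Su.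
rewrite uea_inj_basis.
exact: (subspace_lin6 _ _ _ _ _ _ sS Se Sh Sf Sp Sq Sz).
Qed.

Lemma uea_inj_bracket (x y : schrodinger K) :
  br (inj x) (inj y) = inj (sch_bracket x y).
Proof. by have [_ injB] := @uea_inj_lie K (schrodinger K); apply/esym/injB. Qed.

Lemma uea_z_comm u : inj (sch_z K) * u = u * inj (sch_z K).
Proof.
have [_ _ _ [_ _ _ _ [_ _ _ zx]]] := sch_bracket_basis K.
move: u; apply: uea_ind; first exact: comm_subspace.
  by rewrite mulr1 mul1r.
move=> x u zu; apply: commrM zu; apply: br_eq0.
rewrite uea_inj_bracket zx.
exact: uea_inj0.
Qed.

Variables (A : algType K) (phi : {lrmorphism U -> A}) (c : K).

Lemma uea_schrodinger_rel : phi (inj (sch_z K)) = c%:A ->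
  schrodinger_rel c (phi (inj (sch_e K))) (phi (inj (sch_h K)))
    (phi (inj (sch_f K))) (phi (inj (sch_p K))) (phi (inj (sch_q K))).
Proof.
move=> zc.
have [he ef hf [eq ep hp fp [fq hq pq _]]] := sch_bracket_basis K.
split; rewrite -(br_morph phi) uea_inj_bracket.
- by rewrite he uea_injZ (linearZZ phi).
- by rewrite ef.
- by rewrite hf uea_injN uea_injZ (rmorphN phi); congr (- _); apply: (linearZZ phi).
- by rewrite eq.
- by rewrite ep uea_inj0 (rmorph0 phi).
- by rewrite hp.
- by rewrite fp.
- by rewrite fq uea_inj0 (rmorph0 phi).
- by rewrite hq uea_injN (rmorphN phi).
- by rewrite pq.
Qed.

End SchrodingerGeneration.

(** Commuting E past [F^(k+1) = 0] gives [F^k (H - k) = 0]. In the product of [F^k] with the Casimir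
    element the term [F^(k+1) E] vanishes and [H] becomes [k]. *)
Lemma nilpotent_casimir (K : numFieldType) (A : algType K) chi (E H F : A) k :
    sl2_rel chi E H F -> F ^+ k.+1 = 0 -> F ^+ k != 0 ->
  chi = k%:R * (k%:R + 2).
Proof.
move=> rel F0 Fk; have := sl2_pow k rel; rewrite F0 mulr0 mul0r add0r.
move/esym/eqP; rewrite scaler_eq0 pnatr_eq0 /= mulrBr subr_eq0 mulr_algr.
move=> /eqP FkH; case: rel => _ _ _ cas.
have : F ^+ k * chi%:A = (k%:R * (k%:R + 2)) *: F ^+ k.
  rewrite -cas 2!mulrDr -!scalerAr !mulrA FkH -scalerAl FkH -exprSr F0 mul0r.
  by rewrite scaler0 addr0 !scalerA -scalerDl [2 * _]mulrC -mulrDr.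
rewrite mulr_algr => /eqP; rewrite -subr_eq0 -scalerBl scaler_eq0 (negPf Fk) orbF.
by rewrite subr_eq0 => /eqP.
Qed.

Section SplitMorph.
Variables (K : numFieldType) (B A : algType K) (phi : {lrmorphism B -> A}) (c : K).

Let phiD x y : phi (x + y) = phi x + phi y. Proof. exact: rmorphD. Qed.
Let phiB x y : phi (x - y) = phi x - phi y. Proof. exact: rmorphB. Qed.
Let phiM x y : phi (x * y) = phi x * phi y. Proof. exact: rmorphM. Qed.
Let phiZ a x : phi (a *: x) = a *: phi x. Proof. exact: linearZZ. Qed.

Lemma split_E_morph e p : phi (split_E c e p) = split_E c (phi e) (phi p).
Proof. by rewrite /split_E phiB phiZ phiM. Qed.
Lemma split_F_morph f q : phi (split_F c f q) = split_F c (phi f) (phi q).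
Proof. by rewrite /split_F phiD phiZ phiM. Qed.
Lemma split_H_morph h p q : phi (split_H c h p q) = split_H c (phi h) (phi p) (phi q).
Proof. by rewrite /split_H phiD phiZ phiD !phiM. Qed.
Lemma casimir_morph E H F : phi (casimir E H F) = casimir (phi E) (phi H) (phi F).
Proof. by rewrite /casimir !phiD !phiZ !phiM. Qed.
End SplitMorph.

(** * Comparing annihilators *)

Section SchrodingerModules.
Variables (K : numFieldType) (B : algType K) (e h f p q z : B).

(* All that is used of the enveloping algebra; the modules below live over an
   abstract algebra [B] with these properties. *)
Record schrodinger_gen : Prop := {
  gen_rel : forall (A : algType K) (phi : {lrmorphism B -> A}) c,
    phi z = c%:A -> schrodinger_rel c (phi e) (phi h) (phi f) (phi p) (phi q);
  gen_z : forall u, z * u = u * z;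
  gen_ind : forall S : B -> Prop, subspace S -> S 1 ->
    (forall u, S u -> [/\ S (e * u), S (h * u) & S (f * u)]) ->
    (forall u, S u -> [/\ S (p * u), S (q * u) & S (z * u)]) -> forall u, S u }.

Hypothesis gen : schrodinger_gen.
Variable c : K.
Hypothesis cN0 : c != 0.

Definition sl2e := split_E c e p.
Definition sl2h := split_H c h p q.
Definition sl2f := split_F c f q.
Definition sl2_cas := casimir sl2e sl2h sl2f.

Section OneModule.
Variables (M : lmodType B) (v0 : {v : restrict_scalars M | v != 0}).
Hypothesis zc : forall m : M, z *: m = c%:A *: m.
Local Notation phi := (@act K B M v0).

Lemma act_scalar (b : B) a : (forall m : M, b *: m = a%:A *: m) -> phi b = a%:A.
Proof. by move=> ba; apply: endoP => m; rewrite actE ba. Qed.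

Let srel := gen_rel gen (act_scalar zc).

Let actM x y : phi (x * y) = phi x * phi y. Proof. exact: rmorphM. Qed.
Let actB x y : phi (x - y) = phi x - phi y. Proof. exact: rmorphB. Qed.

Lemma act_sl2e : phi sl2e = split_E c (phi e) (phi p).
Proof. exact: (split_E_morph phi). Qed.
Lemma act_sl2h : phi sl2h = split_H c (phi h) (phi p) (phi q).
Proof. exact: (split_H_morph phi). Qed.
Lemma act_sl2f : phi sl2f = split_F c (phi f) (phi q).
Proof. exact: (split_F_morph phi). Qed.
Lemma act_sl2_cas : phi sl2_cas = casimir (phi sl2e) (phi sl2h) (phi sl2f).
Proof. exact: (casimir_morph phi). Qed.

Lemma act_eE : phi e = phi sl2e + (2 * c)^-1 *: (phi p * phi p).
Proof. by rewrite act_sl2e /split_E subrK. Qed.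
Lemma act_hE : phi h = phi sl2h - (2 * c)^-1 *: (phi p * phi q + phi q * phi p).
Proof. by rewrite act_sl2h /split_H addrK. Qed.
Lemma act_fE : phi f = phi sl2f - (2 * c)^-1 *: (phi q * phi q).
Proof. by rewrite act_sl2f /split_F addrK. Qed.

Lemma act_split_rel chi : (forall m : M, sl2_cas *: m = chi%:A *: m) ->
  split_rel c chi (phi sl2e) (phi sl2h) (phi sl2f) (phi p) (phi q).
Proof.
move=> Cc; rewrite act_sl2e act_sl2h act_sl2f; apply: split_relP => //.
by rewrite -act_sl2e -act_sl2h -act_sl2f -act_sl2_cas; apply: act_scalar.
Qed.

(** The generators [e], [h], [f] may be exchanged for the sl2-triple, from which they differ by
    quadratic expressions in [p] and [q]; the generator [z] acts by a scalar. *)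
Lemma act_ind (S : endo v0 -> Prop) : subspace S -> S 1 ->
    (forall x, S x -> [/\ S (phi sl2e * x), S (phi sl2h * x) & S (phi sl2f * x)]) ->
    (forall x, S x -> S (phi p * x) /\ S (phi q * x)) ->
  forall u, S (phi u).
Proof.
move=> sS S1 S2 S3; apply: (gen_ind gen (S := fun u => S (phi u))) => [||u Su|u Su].
- by apply: (subspace_preim _ sS); apply: linearP.
- by rewrite rmorph1.
- have [SE SH SF] := S2 _ Su; have [Sp Sq] := S3 _ Su.
  have [Spp Sqp] := S3 _ Sp; have [Spq Sqq] := S3 _ Sq.
  rewrite !actM act_eE act_hE act_fE !mulrBl !(mulrDl _ _ (phi u)) -!scalerAl
    !(mulrDl _ _ (phi u)) -!mulrA.
  split.
  + by apply: (subspaceD sS) => //; apply: (subspaceZ _ sS).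
  + by apply: (subspaceB sS) => //; apply: (subspaceZ _ sS); apply: (subspaceD sS).
  + by apply: (subspaceB sS) => //; apply: (subspaceZ _ sS).
- have [Sp Sq] := S3 _ Su; rewrite !actM (act_scalar zc) mulr_algl.
  by split=> //; apply: (subspaceZ _ sS).
Qed.

Lemma act_split_alg chi : (forall m : M, sl2_cas *: m = chi%:A *: m) ->
  forall u, split_alg (phi sl2e) (phi sl2h) (phi sl2f) (phi p) (phi q) (phi u).
Proof.
move=> /act_split_rel rel; apply: (act_ind (split_alg_subspace _ _ _ _ _)).
- exact: split_alg1.
- by move=> x Ax; split; [exact: split_algE rel _ Ax|exact: split_algH rel _ Ax|
    exact: split_algF rel _ Ax].
- by move=> x Ax; split; [exact: split_algP rel _ Ax|exact: split_algQ rel _ Ax].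
Qed.

(** Stated for images under [phi], because the relations of the triple rest on [z] acting by [c]. *)
Lemma sl2_cas_comm u : phi sl2_cas * phi u = phi u * phi sl2_cas.
Proof.
move: u; apply: (act_ind (comm_subspace (phi sl2_cas))).
- by rewrite mulr1 mul1r.
- move=> x Cx; rewrite act_sl2_cas act_sl2e act_sl2h act_sl2f in Cx *.
  have HE := split_brHE cN0 srel; have HF := split_brHF cN0 srel.
  have EF := split_brEF cN0 srel.
  split; apply: commrM Cx; apply: br_eq0.
  + exact: casimir_brE.
  + exact: casimir_brH.
  + exact: casimir_brF.
- have comm_cas T : br (phi sl2e) T = 0 -> br (phi sl2h) T = 0 -> br (phi sl2f) T = 0 ->
      br (phi sl2_cas) T = 0.
    move=> ET HT FT; rewrite act_sl2_cas /casimir !brDl !brZl !brMl ET HT FT.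
    by rewrite !(mulr0, mul0r, addr0, scaler0).
  move=> x Cx; split; apply: commrM Cx; apply: br_eq0; apply: comm_cas;
    rewrite ?act_sl2e ?act_sl2h ?act_sl2f.
  + exact: split_brEP srel.
  + exact: split_brHP cN0 srel.
  + exact: split_brFP cN0 srel.
  + exact: split_brEQ cN0 srel.
  + exact: split_brHQ cN0 srel.
  + exact: split_brFQ srel.
Qed.

(** [split_ideal_Fpow] applies to the image of [J]. Since [phi] may have a kernel, the outcome is an
    element of [J] that acts like a power of [sl2f]. *)
Theorem ideal_Fpow chi (J : B -> Prop) u :
    (forall m : M, sl2_cas *: m = chi%:A *: m) ->
    subspace J -> (forall x y, J x -> J (y * x) /\ J (x * y)) ->
    J u -> phi u != 0 ->
  exists m u', [/\ J u', phi u' = phi (sl2f ^+ m) & phi (sl2f ^+ m) != 0].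
Proof.
move=> Cc sJ Jid Ju uN0.
pose J' x := exists2 u, J u & x = phi u.
have sJ' : subspace J'.
  case: sJ => J0 JP; split=> [|a _ _ [u1 Ju1 ->] [u2 Ju2 ->]].
    by exists 0; rewrite ?rmorph0.
  by exists (a *: u1 + u2); rewrite ?linearP //; apply: JP.
have ad y x : J' x -> J' (phi y * x - x * phi y).
  case=> u1 Ju1 ->; exists (y * u1 - u1 * y); last by rewrite actB !actM.
  by have [] := Jid u1 y Ju1; apply: subspaceB.
have mr y x : J' x -> J' (x * phi y).
  case=> u1 Ju1 ->; exists (u1 * y); last by rewrite actM.
  by have [] := Jid u1 y Ju1.
have [m [u' Ju' Fm] FmN0] := split_ideal_Fpow cN0 (act_split_rel Cc) sJ'
  (ad sl2f) (ad sl2h) (ad p) (ad q) (mr p) (mr q) (act_split_alg Cc u)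
  (ex_intro2 _ _ u Ju erefl) uN0.
by exists m, u'; split; rewrite ?rmorphXn.
Qed.

Lemma nonzero_act u : phi u != 0 <-> ~ annihilator M u.
Proof.
split=> [/eqP uN0 uM|uM]; first by apply: uN0; apply: endoP => x; apply: uM.
apply/eqP => u0; apply: uM => x.
by have := congr1 (fun g : endo v0 => g x) u0.
Qed.
End OneModule.

(* On [M * L] both annihilators are compared inside one algebra in which the split
   relations hold exactly. *)
Lemma annihilator_sub (M L : lmodType B) chi :
    (exists v : M, v != 0) ->
    (forall m : M, z *: m = c%:A *: m) -> (forall m : L, z *: m = c%:A *: m) ->
    (forall m : M, sl2_cas *: m = chi%:A *: m) ->
    (forall m : L, sl2_cas *: m = chi%:A *: m) ->
    (forall n, annihilator M (sl2f ^+ n) -> annihilator L (sl2f ^+ n)) ->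
  annihilator M `<=` annihilator L.
Proof.
move=> [v vN0] zM zL CM CL MLF u uM; apply: contrapT => uL.
pose N : lmodType B := (M * L)%type.
have vN0' : ((v, 0) : restrict_scalars N) != 0.
  by apply: contraNneq vN0 => -[->].
pose v0 : {v : restrict_scalars N | v != 0} := exist _ ((v, 0) : N) vN0'.
have zN (m : N) : z *: m = c%:A *: m by case: m => m l; congr pair.
have CN (m : N) : sl2_cas *: m = chi%:A *: m by case: m => m l; congr pair.
have NM b : annihilator N b -> annihilator M b /\ annihilator L b.
  move=> bN; split=> m.
    by have := congr1 fst (bN (m, 0)).
  by have := congr1 snd (bN (0, m)).
(* The ideal is [annihilator M]. The element [u'] kills [M] and acts as [sl2f ^+ m], so this power
   kills [M], then [L] by hypothesis, and thus [N]: a contradiction. *)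
have [|||m [u' [u'M u'F FN0]]] :=
    @ideal_Fpow N v0 zN chi (annihilator M) u CN _ _ uM _.
- split=> [m|a x y xM yM m]; first by rewrite scale0r.
  by rewrite scalerDl yM addr0 -mulr_algl -scalerA xM scaler0.
- by move=> x y xM; split=> m; rewrite -scalerA xM ?scaler0.
- by apply/nonzero_act => /NM[].
move/nonzero_act: FN0; apply => -[a b].
have FE (x : N) : (sl2f ^+ m) *: x = u' *: x.
  by have := congr1 (fun g : endo v0 => g x) u'F; rewrite !actE.
have FM : annihilator M (sl2f ^+ m).
  move=> x; have := congr1 fst (FE (x, 0)); rewrite /= => ->; exact: u'M.
by congr pair; [exact: FM|exact: (MLF _ FM)].
Qed.

End SchrodingerModules.

(** * The Casimir element acts by a scalar *)

Definition line_span (K : fieldType) (V : lmodType K) (b : nat -> V) :=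
  subspace_dsum (fun i x => exists a, x = a *: b i).

Lemma line_subspace (K : fieldType) (V : lmodType K) (x : V) :
  subspace (fun y => exists a : K, y = a *: x).
Proof.
split=> [|r _ _ [a ->] [a' ->]]; first by exists 0; rewrite scale0r.
by exists (r * a + a'); rewrite scalerA scalerDl.
Qed.

(** Indices form an initial segment, so that combinations with a common bound can be the rows of a
    matrix. *)
Lemma line_span_bounded (K : fieldType) (V : lmodType K) (b : nat -> V) x :
  line_span b x -> exists n, exists r : nat -> K, x = \sum_(i < n) r i *: b i.
Proof.
case=> s [f [us fb ->]]; have [r rP] := choice fb.
exists (\max_(i <- s) i).+1, (fun i => if i \in s then r i else 0).
rewrite (eq_bigr (fun i : 'I_(\max_(i <- s) i).+1 =>
  if (val i) \in s then f i else 0)) => [|i _]; last first.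
  by case: ifP => _; rewrite ?scale0r // rP.
rewrite -(big_mkord predT (fun i => if i \in s then f i else 0)) -big_mkcond /=.
rewrite -[RHS]big_filter; apply: perm_big; apply: uniq_perm => //.
  by rewrite filter_uniq ?iota_uniq.
move=> i; rewrite mem_filter mem_iota /= add0n subn0 ltnS.
by case si: (i \in s) => //=; apply/esym/leq_bigmax_seq.
Qed.

(** Uncountability as a pigeonhole principle: every map to [nat] has an infinite fibre. *)
Definition uncountable_field (K : Type) : Prop := forall n : K -> nat,
  exists N, forall m, exists t : m.-tuple K, injective (tnth t) /\
    forall i, n (tnth t i) = N.

Section DixmierSchur.
Variables (K : numClosedFieldType) (B : algType K) (b : nat -> B).
Hypotheses (span_b : forall u, line_span b u) (uncK : uncountable_field K).
Variables (M : lmodType B) (T : M -> M).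
Hypotheses (simpleM : simple_module M) (TD : forall x y, T (x + y) = T x + T y)
  (TZ : forall (u : B) x, T (u *: x) = u *: T x).

Let aI (a : K) (u : B) : (a%:A : B) * u = u * a%:A.
Proof. by rewrite mulr_algl mulr_algr. Qed.

Let T0 : T 0 = 0.
Proof. by rewrite -(scale0r 0) TZ !scale0r. Qed.

Let simple_dichotomy (S : M -> Prop) :
    S 0 -> (forall (u : B) x y, S x -> S y -> S (u *: x + y)) ->
  (forall x, S x -> x = 0) \/ forall x, S x.
Proof.
move=> S0 SP; case: simpleM => _ /(_ [pred x | `[< S x >]]) []; last 1 first.
- by move=> Sx; right=> x; apply/asboolP/Sx.
- split=> [|u x y /asboolP Sx /asboolP Sy]; first exact/asboolP.
  by apply/asboolP/SP.
- by move=> Sx; left=> x Sxx; apply/Sx/asboolP.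
Qed.

Let D a x := T x - (a%:A : B) *: x.

Let D_submod a u x y : D a (u *: x + y) = u *: D a x + D a y.
Proof.
by rewrite /D TD TZ scalerDr scalerBr !scalerA aI opprD addrACA.
Qed.

(* Otherwise every [T - a] is bijective; uncountably many vectors [(T - a)^-1 v] in
   a space of countable dimension are dependent, so that a nonzero polynomial in
   [T] kills [v]. *)
Theorem dixmier_schur : exists chi : K, forall m : M, T m = (chi%:A : B) *: m.
Proof.
apply: contrapT => noeig.
have D0 a : exists x, D a x != 0.
  apply: contrapT => Da; apply: noeig; exists a => m; apply/subr0_eq/eqP.
  by apply: contrapT => /negP ?; apply: Da; exists m.
have Dinj a x : D a x = 0 -> x = 0.
  have [|u y w y0 w0|h|h] := @simple_dichotomy (fun x => D a x = 0).
  - by rewrite /D T0 scaler0 subrr.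
  - by rewrite D_submod y0 w0 scaler0 addr0.
  - exact: h.
  - by have [y] := D0 a; rewrite h eqxx.
have Dsurj a y : exists x, D a x = y.
  have [|u _ _ [x1 <-] [x2 <-]|h|h] := @simple_dichotomy (fun y => exists x, D a x = y).
  - by exists 0; rewrite /D T0 scaler0 subrr.
  - by exists (u *: x1 + x2); rewrite D_submod.
  - by have [x] := D0 a; rewrite (h (D a x)) ?eqxx //; exists x.
  - exact: h.
have [[v vN0] _] := simpleM.
have cyc x : exists w : B, x = w *: v.
  have [|u _ _ [w1 ->] [w2 ->]|h|h] := @simple_dichotomy (fun x => exists w : B, x = w *: v).
  - by exists 0; rewrite scale0r.
  - by exists (u * w1 + w2); rewrite scalerDl scalerA.
  - by move: vN0; rewrite (h v) ?eqxx //; exists 1; rewrite scale1r.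
  - exact: h.
have : forall a, exists nr : nat * (nat -> K),
    D a ((\sum_(i < nr.1) nr.2 i *: b i) *: v) = v.
  move=> a; have [x Dx] := Dsurj a v; have [w xE] := cyc x.
  by have [n [r wE]] := line_span_bounded (span_b w); exists (n, r); rewrite /= -wE -xE.
move=> /choice[nr nrP].
(* These are [N + 1] scalars for which the inverse image of [v] uses only [b 0, ..., b (N - 1)]; one
   row more than columns forces a linear relation. *)
have [N /(_ N.+1)[t [tI tN]]] := uncK (fun a => (nr a).1).
pose w i := \sum_(j < N) (nr (tnth t i)).2 j *: b j.
have wP i : D (tnth t i) (w i *: v) = v by have := nrP (tnth t i); rewrite tN.
pose R := \matrix_(i < N.+1, j < N) (nr (tnth t i)).2 j.
have [x xN0 xR] : exists2 x : 'rV[K]_N.+1, x != 0 & x *m R = 0.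
  have kN0 : kermx R != 0.
    by rewrite kermx_eq0 /row_free neq_ltn ltnS rank_leq_col.
  exists (nz_row (kermx R)); first by rewrite nz_row_eq0.
  by apply/sub_kermxP/nz_row_sub.
have sum0 : \sum_i x 0 i *: w i = 0.
  rewrite /w; under eq_bigr do rewrite scaler_sumr.
  rewrite exchange_big big1 //= => j _; under eq_bigr do rewrite scalerA.
  rewrite -scaler_suml; have := congr1 (fun X : 'rV_N => X 0 j) xR.
  rewrite !mxE => xR0; rewrite (eq_bigr (fun i => x 0 i * R i j)) ?xR0 ?scale0r //.
  by move=> i _; rewrite mxE.
pose MK := restrict_scalars M; pose v0 : {v : MK | v != 0} := exist _ (v : MK) vN0.
have TL : T \in @is_linear K MK.
  by apply/is_linearP => a y1 y2; rewrite TD !restr_scaleE TZ.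
pose tau : endo v0 := Endo v0 TL.
have DE a y : (horner_alg tau ('X - a%:P)) y = D a y.
  by rewrite rmorphB /= horner_algX horner_algC.
(* The relation between the vectors [(T - t_i)^-1 v] with its denominators cleared, hence
   [g(T) v = 0]. As in Lagrange interpolation, [g(t_i)] is [x_i] times a nonzero product. *)
pose g := \sum_i x 0 i *: \prod_(k | k != i) ('X - (tnth t k)%:P).
have gv : horner_alg tau g v = 0.
  have prodE i : horner_alg tau (\prod_(k | k != i) ('X - (tnth t k)%:P)) v
      = horner_alg tau (\prod_k ('X - (tnth t k)%:P)) (w i *: v : M).
    rewrite [in RHS](bigD1 i) //= mulrC rmorphM /=.
    by rewrite DE wP.
  have endo_sum (I : finType) (F : I -> endo v0) y :
      (\sum_i F i) y = \sum_i F i y.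
    by elim/big_rec2: _ => [//|i f y1 _ <-]; rewrite endoDE.
  rewrite /g rmorph_sum endo_sum /=.
  under eq_bigr do rewrite horner_algZ endoZE prodE -linearZ /= restr_scaleE scalerA mulr_algl.
  have sum0v : \sum_i (x 0 i *: w i) *: v = 0 by rewrite -scaler_suml sum0 scale0r.
  rewrite -linear_sum; apply: etrans (linear0 _); congr (endo_val _ _).
  exact: sum0v.
have gN0 : g != 0.
  have [i xi] : exists i, x 0 i != 0.
    by apply/existsP; apply: contraNT xN0 => /existsPn x0; apply/eqP/rowP => i;
      rewrite mxE; apply/eqP; have := x0 i; rewrite negbK.
  apply: contraNneq xi => g0; have := congr1 (horner^~ (tnth t i)) g0.
  rewrite horner0 /g horner_sum (bigD1 i) //= [X in _ + X]big1 ?addr0 => [|k ki].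
    rewrite hornerZ horner_prod => /eqP; rewrite mulf_eq0 => /orP[//|].
    rewrite prodf_seq_eq0 => /hasP[k _ /andP[ki]]; rewrite !hornerE subr_eq0.
    by move=> /eqP/tI ik; rewrite ik eqxx in ki.
  rewrite hornerZ horner_prod (bigD1 i) 1?eq_sym //=.
  by rewrite hornerXsubC subrr mul0r mulr0.
(* Over an algebraically closed field [g(T)] is a nonzero multiple of a product of injective maps
   [T - r], which cannot kill [v]. *)
have [rs gE] := closed_field_poly_normal g.
rewrite gE horner_algZ endoZE in gv.
have lN0 : lead_coef g != 0 by rewrite lead_coef_eq0.
move/eqP: gv; rewrite scaler_eq0 (negPf lN0) /= => /eqP.
suff Pinj (y : MK) : horner_alg tau (\prod_(r <- rs) ('X - r%:P)) y = 0 -> y = 0.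
  by move/Pinj/eqP; apply/negP.
elim: rs {gE} => [|r rs IH]; first by rewrite big_nil rmorph1.
by rewrite big_cons rmorphM /= DE => /Dinj/IH.
Qed.
End DixmierSchur.

(** * Uncountability of the complex numbers *)

Section Uncountability.
Variable R : realType.

Lemma real_not_enumerable (g : nat -> R) : exists x, forall n, g n != x.
Proof.
(* Each step keeps the outer third that avoids [g n]. *)
pose step (n : nat) (ab : R * R) : R * R :=
  if g n <= (ab.1 + ab.2) / 2 then ((ab.1 + 2 * ab.2) / 3, ab.2)
  else (ab.1, (2 * ab.1 + ab.2) / 3).
pose I := fix I n := if n is k.+1 then step k (I k) else (0 : R, 1 : R).
have Ilt n : (I n).1 < (I n).2.
  elim: n => [|n IH] /=; first exact: ltr01.
  by rewrite /step; case: ifP => _ /=; lra.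
have Isub n : (I n).1 <= (I n.+1).1 /\ (I n.+1).2 <= (I n).2.
  by have := Ilt n; rewrite /= /step; case: ifP => _ /=; split; lra.
have Imono n k : (I n).1 <= (I (n + k)%N).1 /\ (I (n + k)%N).2 <= (I n).2.
  elim: k => [|k [IH1 IH2]]; first by rewrite addn0.
  rewrite addnS; have [h1 h2] := Isub (n + k)%N.
  by split; [apply: le_trans IH1 h1|apply: le_trans h2 IH2].
have Icross n k : (I n).1 <= (I k).2.
  have [h1 _] := Imono n k; have [_ h2] := Imono k n; rewrite addnC in h2.
  by apply: (le_trans h1); apply: le_trans (ltW (Ilt _)) h2.
pose A := [set a | exists n, a = (I n).1].
have supA : has_sup A.
  by split; [exists (I 0%N).1, 0%N|exists (I 0%N).2 => _ [n ->]].
have xlo n : (I n).1 <= sup A by apply: ub_le_sup; [case: supA|exists n].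
have xhi n : sup A <= (I n).2.
  by apply: ge_sup => [|_ [k ->]]; [exists (I 0%N).1, 0%N|].
exists (sup A) => n; apply/eqP => gx.
have := Ilt n; have := xlo n.+1; have := xhi n.+1; rewrite -gx /= /step.
by case: ifPn => /=; rewrite -?ltNge => ? /=; lra.
Qed.

(** An injective tuple of maximal length lists all elements satisfying [P], for a missing one could
    be prepended. *)
Lemma no_injective_tuple (T : eqType) (P : T -> Prop) m :
    (forall t : m.-tuple T, injective (tnth t) -> ~ forall i, P (tnth t i)) ->
  exists s : seq T, forall x, P x -> x \in s.
Proof.
elim: m => [|m IH] noinj.
  by have := noinj [tuple]; case=> [[]|[]].
have [[t [tI tP]]|no] := pselect (exists t : m.-tuple T,
    injective (tnth t) /\ forall i, P (tnth t i)); last first.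
  by apply: IH => t tI tP; apply: no; exists t.
exists t => x Px; apply: contrapT => /negP xt.
have /tuple_uniqP : uniq [tuple of x :: t] by rewrite /= xt; apply/tuple_uniqP.
move=> /noinj; apply => i; have := mem_tnth i [tuple of x :: t].
by rewrite inE => /predU1P[->//|/tnthP[j ->]].
Qed.

(** If all fibres over the reals were finite, the fibre number together with the position in that
    fibre would enumerate the reals. *)
Lemma complex_uncountable : uncountable_field R[i].
Proof.
move=> n; apply: contrapT => noN.
have fin N : exists s : seq R, forall x : R, n x%:C = N -> x \in s.
  have [m mP] : exists m, ~ exists t : m.-tuple R[i],
      injective (tnth t) /\ forall i, n (tnth t i) = N.
    apply: contrapT => h; apply: noN; exists N => m.
    by apply: contrapT => h'; apply: h; exists m.
  apply: (@no_injective_tuple _ _ m) => t tI tN; apply: mP.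
  exists (map_tuple (real_complex R) t); split=> [i j|i]; rewrite !tnth_map //.
  by move=> /complexI/tI.
have [s sP] := choice fin.
pose g k := if @unpickle (nat * nat)%type k is Some (N, j) then nth 0 (s N) j else 0.
have [x /(_ (pickle (n x%:C, index x (s (n x%:C)))))] := real_not_enumerable g.
by rewrite /g pickleK nth_index ?eqxx // sP.
Qed.
End Uncountability.

Lemma schrodinger_countable_span (K : numFieldType) (B : algType K)
    (e h f p q z : B) : schrodinger_gen e h f p q z ->
  exists b : nat -> B, forall u, line_span b u.
Proof.
(* Letters from 6 on stand for 0, so that every list of numbers is a word. *)
move=> gen; pose g := nth 0 [:: e; h; f; p; q; z].
pose word (s : seq nat) := \prod_(i <- s) g i.
pose b n := if @unpickle (seq nat) n is Some s then word s else 0.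
have sG := fun n => line_subspace (b n); have sS := dsum_subspace sG.
have bw s : line_span b (word s).
  apply: (@dsum_in _ _ _ _ sG (pickle s)); exists 1.
  by rewrite scale1r /b pickleK.
have step i u : line_span b u -> line_span b (g i * u).
  move: u; apply: (dsum_map (mull_linear _) sS) => n _ [a ->]; rewrite -scalerAr.
  apply: (subspaceZ _ sS); rewrite /b; case: unpickle => [s|].
    by have := bw (i :: s); rewrite /word big_cons.
  by rewrite mulr0; case: sS.
exists b; apply: (gen_ind gen) => //.
- by have := bw [::]; rewrite /word big_nil.
- by move=> u Su; split; [exact: (step 0%N)|exact: (step 1%N)|exact: (step 2%N)].
- by move=> u Su; split; [exact: (step 3%N)|exact: (step 4%N)|exact: (step 5%N)].
Qed.

(** * Highest weight modules *)

Section HighestWeightVectors.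
Variables (K : numFieldType) (V : lmodType K) (v0 : {v : V | v != 0}).
Variables (c chi mu : K) (E H F P Q : endo v0) (w : V).
Hypotheses (rel : split_rel c chi E H F P Q).
Hypotheses (Ew : E w = 0) (Pw : P w = 0) (Hw : H w = mu *: w).

Local Notation sl2 := (split_sl2 rel).

Definition hw_mono (ij : nat * nat) : V := (F ^+ ij.1 * Q ^+ ij.2) w.

Lemma comm_pow (x y : endo v0) n : x * y = y * x -> x * y ^+ n = y ^+ n * x.
Proof. exact: commrX. Qed.

Lemma mono_F i j : F (hw_mono (i, j)) = hw_mono (i.+1, j).
Proof. by rewrite /hw_mono -endoME mulrA -exprS. Qed.

Lemma mono_Q i j : Q (hw_mono (i, j)) = hw_mono (i, j.+1).
Proof.
by rewrite /hw_mono -endoME mulrA (comm_pow _ (split_FQ rel)) -mulrA -exprS.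
Qed.

Lemma mono_P0 i : P (hw_mono (i, 0)) = 0.
Proof.
rewrite /hw_mono -endoME mulrA (comm_pow _ (split_FP rel)) !endoME endo1E.
by rewrite Pw linear0.
Qed.

Lemma mono_PS i j : P (hw_mono (i, j.+1)) = (j.+1%:R * c) *: hw_mono (i, j).
Proof.
rewrite /hw_mono -endoME mulrA (comm_pow _ (split_FP rel)) -mulrA.
by rewrite (heis_pow (split_PQ rel)) !endoME endoDE endoME Pw linear0 add0r endoZE linearZ.
Qed.

Lemma Q_pow_H j : H ((Q ^+ j) w) = mu *: (Q ^+ j) w.
Proof. by rewrite -endoME (comm_pow _ (esym (split_HQ rel))) endoME Hw linearZ. Qed.

Lemma mono_H i j : H (hw_mono (i, j)) = (mu - 2 * i%:R) *: hw_mono (i, j).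
Proof.
have [_ HF _ _] := sl2.
rewrite /hw_mono -endoME mulrA (H_pow i HF) !endoME endoDE Q_pow_H endoZE endo1E.
by rewrite -scalerDl linearZ; congr (_ *: _); ring.
Qed.

Lemma mono_E0 j : E (hw_mono (0, j)) = 0.
Proof.
rewrite /hw_mono expr0 mul1r -endoME (comm_pow _ (esym (split_EQ rel))).
by rewrite endoME Ew linear0.
Qed.

Lemma mono_ES i j :
  E (hw_mono (i.+1, j)) = (i.+1%:R * (mu - i%:R)) *: hw_mono (i, j).
Proof.
rewrite /hw_mono -endoME mulrA (sl2_pow i sl2) !endoME endoDE endoME endoZE endoME.
have := mono_E0 j; rewrite /hw_mono expr0 mul1r => ->.
rewrite linear0 add0r endoDE endoNE Q_pow_H endoZE endo1E -scalerBl linearZ.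
by rewrite scalerA.
Qed.

Lemma E_Fpow_w i : E ((F ^+ i.+1) w) = (i.+1%:R * (mu - i%:R)) *: (F ^+ i) w.
Proof. by have := mono_ES i 0; rewrite /hw_mono expr0 !mulr1. Qed.

Lemma casimir_hw : casimir E H F w = (mu * (mu + 2)) *: w.
Proof.
rewrite /casimir !endoDE !endoZE !endoME Ew linear0 scaler0 addr0 Hw linearZ /= Hw.
by rewrite !scalerA -scalerDl mulrDr [2 * _]mulrC.
Qed.

Definition hw_span := subspace_dsum (fun ij x => exists a, x = a *: hw_mono ij).

Lemma hw_span_sub (S : V -> Prop) : subspace S -> (forall ij, S (hw_mono ij)) ->
  forall x, hw_span x -> S x.
Proof.
by move=> sS Sm; apply: (dsum_sub sS) => ij _ [a ->]; apply: (subspaceZ _ sS).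
Qed.

Let sub_line ij := line_subspace (hw_mono ij).

Lemma hw_span_subspace : subspace hw_span.
Proof. exact: dsum_subspace sub_line. Qed.

Lemma hw_span_mono a ij : hw_span (a *: hw_mono ij).
Proof. by apply: (@dsum_in _ _ _ _ sub_line ij); exists a. Qed.

Lemma hw_span_stable (T : endo v0) : (forall ij, hw_span (T (hw_mono ij))) ->
  forall x, hw_span x -> hw_span (T x).
Proof.
move=> Tm; apply: hw_span_sub => //.
exact: (subspace_preim (endo_linear T) hw_span_subspace).
Qed.

Lemma hw_span_ops x : hw_span x ->
  [/\ hw_span (E x), hw_span (H x), hw_span (F x), hw_span (P x) & hw_span (Q x)].
Proof.
have [S0 _] := hw_span_subspace.
move=> Sx; split; move: x Sx; apply: hw_span_stable => -[i j].
- by case: i => [|i]; rewrite ?mono_E0 ?mono_ES //; apply: hw_span_mono.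
- by rewrite mono_H; apply: hw_span_mono.
- by rewrite mono_F -[hw_mono _]scale1r; apply: hw_span_mono.
- by case: j => [|j]; rewrite ?mono_P0 ?mono_PS //; apply: hw_span_mono.
- by rewrite mono_Q -[hw_mono _]scale1r; apply: hw_span_mono.
Qed.

Lemma hw_span_w : hw_span w.
Proof. by have := hw_span_mono 1 (0, 0); rewrite scale1r /hw_mono !expr0 mulr1. Qed.

(** The operator is the original [h]. On [F^i Q^j w] the sum [PQ + QP] acts by [(2j + 1) c], whence
    the contribution [- j - 1/2]. *)
Lemma mono_h i j : c != 0 ->
  (H - (2 * c)^-1 *: (P * Q + Q * P)) (hw_mono (i, j)) =
  (mu - 2^-1 - (2 * i + j)%:R) *: hw_mono (i, j).
Proof.
move=> cN0; rewrite endoDE endoNE endoZE endoDE !endoME mono_H mono_Q mono_PS.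
have -> : Q (P (hw_mono (i, j))) = (j%:R * c) *: hw_mono (i, j).
  case: j => [|j]; first by rewrite mono_P0 linear0 mul0r scale0r.
  by rewrite mono_PS linearZ /= mono_Q.
rewrite -scalerDl scalerA -scalerBl natrD natrM -natr1; congr (_ *: _).
by field.
Qed.

(** [F^n] commutes with every [F^i Q^j]. *)
Lemma Fpow_hw_span n : (F ^+ n) w = 0 -> forall x, hw_span x -> (F ^+ n) x = 0.
Proof.
move=> Fnw; apply: hw_span_sub => [|[i j]].
  by apply: (subspace_preim (endo_linear (F ^+ n)) (S := fun y => y = 0));
    split=> // a x y -> ->; rewrite scaler0 addr0.
rewrite /hw_mono -endoME mulrA -exprD addnC exprD -mulrA comm_pow.
  by rewrite mulrA endoME Fnw linear0.
by apply/esym/comm_pow; rewrite (split_FQ rel).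
Qed.

End HighestWeightVectors.

Section HighestWeightModules.
Variables (K : numFieldType) (B : algType K) (e h f p q z : B).
Hypothesis gen : schrodinger_gen e h f p q z.
Variable c : K.
Hypothesis cN0 : c != 0.
Local Notation sl2e := (sl2e e p c).
Local Notation sl2h := (sl2h h p q c).
Local Notation sl2f := (sl2f f q c).
Local Notation sl2_cas := (sl2_cas e h f p q c).

Section HighestWeightVector.
Variables (N : lmodType B) (v0 : {v : restrict_scalars N | v != 0}).
Hypothesis zN : forall x : N, z *: x = c%:A *: x.
Local Notation phi := (@act K B N v0).
Variables (w : restrict_scalars N) (theta : K).
Hypotheses (ew : phi e w = 0) (pw : phi p w = 0) (hw : phi h w = theta *: w).

Lemma hwv_E : phi sl2e w = 0.
Proof.
by rewrite act_sl2e /split_E endoDE endoNE endoZE endoME ew pw linear0 scaler0 subr0.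
Qed.

(** The shift by 1/2 is the oscillator's vacuum value: [(pq + qp) w = pq w = c w], divided by
    [2c]. *)
Lemma hwv_H : phi sl2h w = (theta + 2^-1) *: w.
Proof.
have /(gen_rel gen)/sch_pq pq := act_scalar v0 zN.
rewrite act_sl2h /split_H !endoDE endoZE endoDE !endoME pw linear0 addr0 hw.
have -> : phi p (phi q w) = c *: w.
  by rewrite -endoME -[phi p * phi q](subrK (phi q * phi p)) [_ - _]pq
    endoDE endoME pw linear0 addr0 endoZE endo1E.
by rewrite scalerA -scalerDl; congr (_ *: _); field.
Qed.

Lemma hwv_cas u :
  phi sl2_cas (phi u w) = ((theta + 2^-1) * (theta + 2^-1 + 2)) *: phi u w.
Proof.
rewrite -endoME (sl2_cas_comm gen cN0 v0 zN) endoME act_sl2_cas.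
by rewrite (casimir_hw _ hwv_E hwv_H) linearZ.
Qed.

(** The second clause records that the component of top weight is a multiple of [w]; [hw_mem]
    recovers [w] from it. *)
Definition hw_weight_space (k : nat) (x : restrict_scalars N) : Prop :=
  phi h x = (theta - k%:R) *: x /\ (k = 0%N -> exists a, x = a *: w).

Lemma hw_weight_subspace k : subspace (hw_weight_space k).
Proof.
split=> [|a x y [hx wx] [hy wy]].
  by split=> [|_]; [rewrite linear0 scaler0|exists 0; rewrite scale0r].
split=> [|k0]; first by rewrite (endo_linear (phi h)) hx hy scalerDr !scalerA mulrC.
have [a1 ->] := wx k0; have [a2 ->] := wy k0.
by exists (a * a1 + a2); rewrite scalerDl scalerA.
Qed.

Variable chi : K.
Hypothesis casN : forall x : N, sl2_cas *: x = chi%:A *: x.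
Let rel := act_split_rel gen cN0 v0 zN casN.

Lemma hw_span_act u : hw_span (phi sl2f) (phi q) w (phi u w).
Proof.
have sS := hw_span_subspace (phi sl2f) (phi q) w.
apply: (act_ind gen zN (c := c) (S := fun x : endo v0 => hw_span (phi sl2f) (phi q) w (x w))).
- by apply: (subspace_preim _ sS) => a x y.
- exact: hw_span_w.
- by move=> x /(hw_span_ops rel hwv_E pw hwv_H)[].
- by move=> x /(hw_span_ops rel hwv_E pw hwv_H)[].
Qed.

Lemma hw_decomp u : subspace_dsum hw_weight_space (phi u w).
Proof.
have sS := dsum_subspace hw_weight_subspace.
apply: (hw_span_sub sS _ (hw_span_act u)) => -[i j].
apply: (@dsum_in _ _ _ _ hw_weight_subspace (2 * i + j)); split; last first.
  case: i j => [|i] [|j] // _; exists 1.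
  by rewrite /hw_mono !expr0 mulr1 scale1r.
rewrite (act_hE h p q c v0) (mono_h rel pw hwv_H) //.
by congr (_ *: _); ring.
Qed.

Lemma Fpow_hwv n : (phi sl2f ^+ n) w = 0 -> forall u, (phi sl2f ^+ n) (phi u w) = 0.
Proof. by move=> Fn u; apply: (Fpow_hw_span rel Fn (hw_span_act u)). Qed.

(** E sends [F^(n+1) w] to [(n+1)(mu - n) F^n w], so one of the factors vanishes. *)
Lemma Fpow_hwv_lower n : (phi sl2f ^+ n.+1) w = 0 ->
  (phi sl2f ^+ n) w = 0 \/ theta + 2^-1 = n%:R.
Proof.
move=> Fn; have := E_Fpow_w rel hwv_E hwv_H n; rewrite Fn linear0.
move=> /esym/eqP; rewrite scaler_eq0 mulf_eq0 pnatr_eq0 /= => /orP[|/eqP->]; last by left.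
by rewrite subr_eq0 => /eqP->; right.
Qed.

(** The factor [mu - n] in the action of E vanishes, so [F^(n+1) w] is again annihilated by [e] and
    [p], of strictly lower weight. *)
Lemma Fpow_hwv_singular n : theta + 2^-1 = n%:R ->
  let w' := (phi sl2f ^+ n.+1) w in
  [/\ phi e w' = 0, phi p w' = 0 & phi h w' = (theta - 2 * n.+1%:R) *: w'].
Proof.
move=> muE w'.
have w'E : w' = hw_mono (phi sl2f) (phi q) w (n.+1, 0%N).
  by rewrite /hw_mono expr0 mulr1.
have pw' : phi p w' = 0 by rewrite w'E; apply: (mono_P0 rel pw).
split=> //.
  rewrite (act_eE e p c v0) endoDE endoZE endoME pw' linear0 scaler0 addr0 w'E.
  by rewrite (mono_ES rel hwv_E hwv_H) muE subrr mulr0 scale0r.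
rewrite w'E (act_hE h p q c v0) (mono_h rel pw hwv_H) //.
by congr (_ *: _); rewrite addn0 natrM; ring.
Qed.
End HighestWeightVector.
End HighestWeightModules.

(* [eps] is the coordinate of the highest weight vector [w]; the largest proper
   submodule of [N] consists of the [x] with [eps (U x) = 0]. *)
Section SimpleQuotient.
Variables (K : numFieldType) (B : algType K) (e h f p q z : B).
Hypothesis gen : schrodinger_gen e h f p q z.
Variable c : K.
Hypothesis cN0 : c != 0.
Local Notation sl2f := (sl2f f q c).
Local Notation sl2_cas := (sl2_cas e h f p q c).

Variables (N : lmodType B) (w : N) (theta : K) (eps : N -> K).
Hypotheses (zN : forall x : N, z *: x = c%:A *: x) (cyc : forall x, exists u : B, x = u *: w).
Hypotheses (ew : e *: w = 0) (pw : p *: w = 0) (hw : h *: w = theta%:A *: w).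
Hypotheses (epsP : forall a x y, eps ((a%:A : B) *: x + y) = a * eps x + eps y)
  (eps_h : forall x, eps (h *: x) = theta * eps x) (eps_w : eps w = 1).

Let mu := theta + 2^-1.
Local Notation V := (restrict_scalars N).

Lemma eps0 : eps 0 = 0.
Proof.
have := epsP (-1) 0 0; rewrite scaler0 addr0 mulN1r => /eqP.
by rewrite addNr => /eqP.
Qed.

Lemma eps_ker_subspace : subspace (fun x : V => eps x = 0).
Proof.
by split=> [|a x y x0 y0]; [exact: eps0|rewrite epsP x0 y0 mulr0 addr0].
Qed.

Lemma epsZ a x : eps ((a%:A : B) *: x) = a * eps x.
Proof. by have := epsP a x 0; rewrite !addr0 eps0 addr0. Qed.

Lemma hw_neq0 : (w : V) != 0.
Proof. by apply: contra_eq_neq eps_w => ->; rewrite eps0 eq_sym oner_eq0. Qed.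

Let v0 : {v : V | v != 0} := exist _ (w : V) hw_neq0.
Local Notation phi := (@act K B N v0).

Let ew' : phi e w = 0 := ew.
Let pw' : phi p w = 0 := pw.
Let hw' : phi h w = theta *: (w : V) := hw.

Let chi := mu * (mu + 2).

Lemma hw_casimir (x : N) : sl2_cas *: x = chi%:A *: x.
Proof. by have [u ->] := cyc x; apply: (hwv_cas gen cN0 zN ew' pw' hw'). Qed.

Lemma eps_weight a x : h *: x = a%:A *: x -> a != theta -> eps x = 0.
Proof.
move=> hx aN; have := eps_h x; rewrite hx epsZ => /eqP; rewrite -subr_eq0 -mulrBl.
by rewrite mulf_eq0 subr_eq0 (negPf aN) => /eqP.
Qed.

(** The submodule generated by the singular vector has weights [theta - 2(n+1) - k], all different
    from [theta], and [eps] vanishes on such weight vectors. *)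
Lemma eps_singular n : mu = n%:R -> forall u : B, eps (u *: ((sl2f ^+ n.+1) *: w)) = 0.
Proof.
move=> muE u; have [ew1 pw1 hw1] := Fpow_hwv_singular gen cN0 zN ew' pw' hw' hw_casimir muE.
have w1E : (phi sl2f ^+ n.+1) w = (sl2f ^+ n.+1) *: w by rewrite -rmorphXn.
rewrite -w1E.
have := hw_decomp gen cN0 zN ew1 pw1 hw1 hw_casimir u.
apply: (dsum_sub eps_ker_subspace) => k x [hx _]; apply: eps_weight hx _.
rewrite -subr_eq0 addrAC [_ - theta]addrAC subrr sub0r -opprD oppr_eq0.
by rewrite -natrM -natrD pnatr_eq0 addn_eq0 muln_eq0.
Qed.

(** A submodule contains the weight components of its elements. Only the component of weight [theta]
    is seen by [eps], and it is a multiple of [w]. *)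
Lemma hw_mem (J : N -> Prop) x : J 0 ->
    (forall (u : B) x y, J x -> J y -> J (u *: x + y)) ->
  J x -> eps x != 0 -> J w.
Proof.
move=> J0 JP Jx ex; have sJ : subspace (J : V -> Prop) by split=> // a; apply: JP.
have JZ (u : B) y : J y -> J (u *: y) by move=> Jy; rewrite -[_ *: y]addr0; apply: JP.
have [u xE] := cyc x.
have [s [g [us gw xs]]] := hw_decomp gen cN0 zN ew' pw' hw' hw_casimir u.
have {}xs : x = \sum_(i <- s) (g i : V) by rewrite xE; exact: xs.
have gJ := @eigencomponent_mem _ V _ (phi h) (fun k : nat => theta - k%:R) J s g.
have {}gJ : forall i, i \in s -> J (g i).
  apply: gJ => //.
  - by move=> i j /addrI/oppr_inj/eqP; rewrite eqr_nat => /eqP.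
  - by move=> i; have [] := gw i.
  - by move=> y; apply: JZ.
  - by move: Jx; rewrite xs.
have g0 k : k != 0%N -> eps (g k) = 0.
  move=> k0; have [hg _] := gw k; apply: eps_weight hg _.
  by rewrite -subr_eq0 addrAC subrr sub0r oppr_eq0 pnatr_eq0.
have [s0|s0] := boolP (0%N \in s); last first.
  case/negP: ex; rewrite xs; apply/eqP; rewrite big_seq.
  apply: (big_ind (fun y : V => eps y = 0)); [exact: eps0| |].
    by move=> y1 y2 h1 h2; apply: (subspaceD eps_ker_subspace).
  by move=> k ks; apply: g0; apply: contraNneq s0 => <-.
have [_ /(_ erefl)[a ga]] := gw 0%N.
have aN0 : a != 0.
  apply: contraNneq ex => a0; rewrite xs (bigD1_seq 0%N) //= ga a0 scale0r add0r.
  apply/eqP; apply: (big_ind (fun y : V => eps y = 0)); [exact: eps0| |exact: g0].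
  by move=> y1 y2 h1 h2; apply: (subspaceD eps_ker_subspace).
have := subspaceZ a^-1 sJ (gJ 0%N s0); rewrite ga scalerA mulVf // scale1r.
exact.
Qed.

Lemma hw_proper (J : N -> Prop) : J 0 ->
    (forall (u : B) x y, J x -> J y -> J (u *: x + y)) -> ~ (forall x, J x) ->
  forall x, J x -> forall u : B, eps (u *: x) = 0.
Proof.
move=> J0 JP Jprop x Jx u; apply/eqP/negP => /negP ux; apply: Jprop => y.
have JZ (v : B) y' : J y' -> J (v *: y') by move=> Jy; rewrite -[_ *: _]addr0; apply: JP.
have [v ->] := cyc y; exact: (JZ v _ (hw_mem J0 JP (JZ u _ Jx) ux)).
Qed.

Variables (L : lmodType B) (pi : {linear N -> L}).
Hypotheses (pi_surj : forall y, exists x, y = pi x)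
  (pi0 : forall x, pi x = 0 <-> forall u : B, eps (u *: x) = 0).

Let piZ (u : B) x : pi (u *: x) = u *: pi x. Proof. exact: linearZZ. Qed.

Let piw : pi w != 0.
Proof.
by apply/eqP => /pi0/(_ 1); rewrite scale1r eps_w => /eqP; rewrite oner_eq0.
Qed.

Lemma hw_quotient_simple : simple_module L.
Proof.
split=> [|S [S0 SP]]; first by exists (pi w).
have [Sall|Sproper] := pselect (forall x, pi x \in S).
  by right=> y; have [x ->] := pi_surj y.
left=> y; have [x ->] := pi_surj y => Sx; apply/pi0.
apply: (hw_proper (J := fun x => pi x \in S)) => //; first by rewrite linear0.
by move=> u x1 x2 S1 S2; rewrite linearP; apply: SP.
Qed.

Lemma hw_quotient_charge (y : L) : z *: y = c%:A *: y.
Proof. by have [x ->] := pi_surj y; rewrite -!piZ zN. Qed.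

Lemma hw_quotient_casimir (y : L) : sl2_cas *: y = chi%:A *: y.
Proof. by have [x ->] := pi_surj y; rewrite -!piZ hw_casimir. Qed.

Let l0 : {v : restrict_scalars L | v != 0} := exist _ (pi w : restrict_scalars L) piw.
Local Notation psi := (@act K B L l0).

Let ewL : psi e (pi w) = 0. Proof. by rewrite actE -piZ ew linear0. Qed.
Let pwL : psi p (pi w) = 0. Proof. by rewrite actE -piZ pw linear0. Qed.
Let hwL : psi h (pi w) = theta *: (pi w : restrict_scalars L).
Proof. by rewrite actE -piZ hw piZ. Qed.

Lemma hw_quotient_nilpotent n : mu = n%:R -> annihilator L (sl2f ^+ n.+1).
Proof.
move=> muE y; have [x ->] := pi_surj y; have [u ->] := cyc x.
rewrite piZ.
have F0 : (psi sl2f ^+ n.+1) (pi w) = 0.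
  by rewrite -rmorphXn actE -piZ; apply/pi0/eps_singular.
have := Fpow_hwv gen cN0 hw_quotient_charge ewL pwL hwL hw_quotient_casimir F0 u.
by rewrite -rmorphXn !actE.
Qed.

(** From [F^n w = 0] the exponent could be lowered step by step down to [w = 0]. *)
Lemma hw_quotient_not_nilpotent : (forall n, mu <> n%:R) ->
  forall n, ~ annihilator L (sl2f ^+ n).
Proof.
move=> muN n /(_ (pi w)) Fn.
have : (psi sl2f ^+ n) (pi w) = 0 by rewrite -rmorphXn actE.
elim: n {Fn} => [/eqP|n IH F0]; first by apply/negP.
by have [/IH//|/muN] :=
  Fpow_hwv_lower gen cN0 hw_quotient_charge ewL pwL hwL hw_quotient_casimir F0.
Qed.
End SimpleQuotient.

(** * The Verma module is nonzero *)

(* The Verma module of sl2 with highest weight [theta + 1/2] tensored with the Fock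
   space of the Weyl algebra: [a (i, j)] is the coefficient of [F^i q^j w]; infinite
   combinations are allowed, which is harmless. *)
Section FockModel.
Variables (K : numFieldType) (c theta : K).
Hypothesis cN0 : c != 0.

Definition fock_space : Type := nat * nat -> K^o.
HB.instance Definition _ := GRing.Lmodule.on fock_space.
Local Notation W := fock_space.

Lemma fockP (a b : W) : (forall i j, a (i, j) = b (i, j)) -> a = b.
Proof. by move=> ab; apply/funext => -[i j]. Qed.

Lemma fockDE (a b : W) ij : (a + b) ij = a ij + b ij. Proof. by []. Qed.
Lemma fockNE (a : W) ij : (- a) ij = - a ij. Proof. by []. Qed.
Lemma fock0E ij : (0 : W) ij = 0. Proof. by []. Qed.
Lemma fockZE r (a : W) ij : (r *: a) ij = r * a ij. Proof. by []. Qed.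

Definition fock_vac : W := fun ij => (ij == (0, 0)%N)%:R.

Lemma fock_vac_neq0 : fock_vac != 0.
Proof.
apply/eqP => /(congr1 (fun a : W => a (0, 0)%N))/eqP.
by rewrite /fock_vac eqxx oner_eq0.
Qed.

Let v0 : {v : W | v != 0} := exist _ fock_vac fock_vac_neq0.

(** The formulas transcribe [e = E + p^2/2c], [h = H - (pq + qp)/2c] and [f = F - q^2/2c]: the value
    at [(i, j)] collects the monomials that are sent to [F^i q^j w]. Thus [p^2/2c] takes [q^(j+2)]
    to [c/2 (j+1)(j+2) q^j]. *)
Definition fock_e (a : W) : W := fun ij => let: (i, j) := ij in
  i.+1%:R * (theta + 2^-1 - i%:R) * a (i.+1, j)
  + c / 2 * j.+1%:R * j.+2%:R * a (i, j.+2).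
Definition fock_h (a : W) : W := fun ij => let: (i, j) := ij in
  (theta - 2 * i%:R - j%:R) * a (i, j).
Definition fock_f (a : W) : W := fun ij => let: (i, j) := ij in
  (if i is i'.+1 then a (i', j) else 0)
  - (2 * c)^-1 * (if j is j'.+2 then a (i, j') else 0).
Definition fock_p (a : W) : W := fun ij => let: (i, j) := ij in
  c * j.+1%:R * a (i, j.+1).
Definition fock_q (a : W) : W := fun ij => let: (i, j) := ij in
  if j is j'.+1 then a (i, j') else 0.

Ltac fock_linear := apply/is_linearP => r a b; apply: fockP => i j;
  rewrite fockDE fockZE /=.

Lemma fock_e_linear : fock_e \in @is_linear K W.
Proof. by fock_linear; rewrite !fockDE !fockZE; ring. Qed.
Lemma fock_h_linear : fock_h \in @is_linear K W.
Proof. by fock_linear; rewrite !fockDE !fockZE; ring. Qed.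
Lemma fock_f_linear : fock_f \in @is_linear K W.
Proof.
by fock_linear; case: i => [|i]; case: j => [|[|j]]; rewrite ?fockDE ?fockZE; ring.
Qed.
Lemma fock_p_linear : fock_p \in @is_linear K W.
Proof. by fock_linear; rewrite !fockDE !fockZE; ring. Qed.
Lemma fock_q_linear : fock_q \in @is_linear K W.
Proof. by fock_linear; case: j => [|j]; rewrite ?fockDE ?fockZE; ring. Qed.

Definition op_e : endo v0 := Endo v0 fock_e_linear.
Definition op_h : endo v0 := Endo v0 fock_h_linear.
Definition op_f : endo v0 := Endo v0 fock_f_linear.
Definition op_p : endo v0 := Endo v0 fock_p_linear.
Definition op_q : endo v0 := Endo v0 fock_q_linear.

Lemma fock_opP (v : {v : W | v != 0}) (x y : endo v) :
  (forall a i j, x a (i, j) = y a (i, j)) -> x = y.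
Proof. by move=> xy; apply: endoP => a; apply: fockP. Qed.

Ltac fock_br := refine (fock_opP _) => a i j;
  rewrite /br ?endoDE ?endoNE ?endoZE !endoME
    ?fockDE ?fockNE ?fockZE ?endo1E ?endo0E ?fock0E /=.

Lemma fock_rel : schrodinger_rel c op_e op_h op_f op_p op_q.
Proof.
split.
- by fock_br; field.
- by fock_br; case: i => [|i]; case: j => [|[|j]]; field; rewrite ?cN0 ?pnatr_eq0.
- by fock_br; case: i => [|i]; case: j => [|[|j]]; field; rewrite ?cN0 ?pnatr_eq0.
- by fock_br; case: j => [|j]; field; rewrite ?cN0 ?pnatr_eq0.
- by fock_br; field; rewrite ?cN0 ?pnatr_eq0.
- by fock_br; field; rewrite ?cN0 ?pnatr_eq0.
- by fock_br; case: i => [|i]; case: j => [|[|j]]; field; rewrite ?cN0 ?pnatr_eq0.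
- by fock_br; case: i => [|i]; case: j => [|[|[|j]]]; field; rewrite ?cN0 ?pnatr_eq0.
- by fock_br; case: j => [|j]; field; rewrite ?cN0 ?pnatr_eq0.
- by fock_br; case: j => [|j]; field; rewrite ?cN0 ?pnatr_eq0.
Qed.
End FockModel.

Section FockRepresentation.
Variables (K : numFieldType) (v0 : {v : fock_space K | v != 0}) (c : K).
Variables (e h f p q : endo v0).
Hypothesis rel : schrodinger_rel c e h f p q.
Local Notation coord := Defs.coord.

Definition fock_rep (x : schrodinger K) : endo v0 :=
  coord 0 x *: e + (coord 1 x *: h + (coord 2 x *: f + (coord 3 x *: p
  + (coord 4 x *: q + coord 5 x *: c%:A)))).

Lemma fock_repE x a i j : fock_rep x a (i, j) =
  coord 0 x * e a (i, j) + coord 1 x * h a (i, j) + coord 2 x * f a (i, j)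
  + coord 3 x * p a (i, j) + coord 4 x * q a (i, j) + coord 5 x * (c * a (i, j)).
Proof. by rewrite /fock_rep !endoDE !endoZE !fockDE !fockZE !addrA. Qed.

Lemma br1 (x : endo v0) : br x 1 = 0.
Proof. by rewrite /br mulr1 mul1r subrr. Qed.

Lemma fock_rep_br x y : fock_rep (sch_bracket x y) = br (fock_rep x) (fock_rep y).
Proof.
have [d0 d1 d2 [d3 d4 d5]] := coord_bracket x y.
have b1 (a : endo v0) : br 1 a = 0 by rewrite brC br1 oppr0.
refine (fock_opP _) => a i j; rewrite fock_repE d0 d1 d2 d3 d4 d5.
rewrite /fock_rep !(brDl, brDr) !(brZl, brZr) !brxx !br1 !b1.
rewrite (brC h e) (brC e f) (brC h f) (brC e q) (brC e p) (brC h p) (brC f p)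
  (brC f q) (brC h q) (brC p q).
case: rel => -> -> -> -> -> -> -> -> -> ->.
rewrite !(endoDE, endoNE, endoZE, fockDE, fockNE, fockZE, endo1E, endo0E, fock0E).
ring.
Qed.

End FockRepresentation.

(** * Modules induced from a character *)

Section InducedCharacter.
Variables (K : fieldType) (A B : algType K).
Variables (phi : {rmorphism A -> B}) (chi : {rmorphism A -> K^o}).
Hypotheses (phiL : linear phi) (chiL : linear chi).
Local Notation M := (ext_scalars phi (char_module chi)).

Definition ind_vec : M := tens phi 1 (1 : char_module chi).

Let tensK (n : K) : tens phi 1 (n : char_module chi) = (n%:A : B) *: ind_vec.
Proof.
have chin : chi n%:A = n by rewrite -[n%:A]addr0 chiL rmorph1 rmorph0 addr0; apply: mulr1.
have phin : phi n%:A = n%:A by rewrite -[n%:A in LHS]addr0 phiL rmorph1 rmorph0 addr0.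
transitivity (tens phi 1 ((n%:A : A) *: (1 : char_module chi))).
  congr tens; exact: (esym (etrans (mulr1 _) chin)).
by rewrite -tens_balanced mul1r [LHS]tensE phin.
Qed.

Lemma ind_cyclic (x : M) : exists b : B, x = b *: ind_vec.
Proof.
have [r ->] := tens_span x.
elim/big_rec: _ => [|n _ _ [b ->]]; first by exists 0; rewrite scale0r.
exists (r@_n * n%:A + b); rewrite scalerDl -scalerA -tensK.
by congr (_ + _); exact: tensE.
Qed.

Lemma ind_vec_phi (a : A) (b : B) (r : K) : phi a = b -> chi a = r ->
  b *: ind_vec = (r%:A : B) *: ind_vec.
Proof.
move=> <- <-; rewrite -tensK /ind_vec tensZ mulr1 -[phi a]mul1r tens_balanced.
by congr tens; apply: mulr1.
Qed.

Variables (V : lmodType K) (v0 : {v : V | v != 0}) (rho : {lrmorphism B -> endo v0}).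
Variable vac : V.

(** The map taking [b] and [n] to [n l(rho b vac)] is balanced because [A] acts on [vac] through
    [chi], so it factors through the tensor product. Then [b *: ind_vec] is nonzero whenever
    [l (rho b vac)] is. *)
Lemma ind_functional (l : V -> K) :
    linear_for *%R l -> (forall a, rho (phi a) vac = (chi a : K) *: vac) ->
  exists eps : M -> K, forall b : B, eps (b *: ind_vec) = l (rho b vac).
Proof.
move=> linl vacE.
have l0 : l 0 = 0.
  by have := linl (-1) 0 0; rewrite scaler0 addr0 mulN1r => /eqP; rewrite addNr => /eqP.
have lD x y : l (x + y) = l x + l y by rewrite -[x]scale1r linl mul1r scale1r.
have lZ a x : l (a *: x) = a * l x by rewrite -[_ *: x]addr0 linl l0 addr0.
have [|||F _ FE] := @tens_universal _ _ phi (char_module chi) K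
    (fun b (n : K) => n * l (rho b vac)).
- by move=> b b' n; rewrite raddfD endoDE lD mulrDr.
- by move=> b n n'; apply: mulrDl.
- move=> b a n; rewrite rmorphM endoME vacE linearZZ lZ mulrA.
  by congr (_ * _); apply: mulrC.
exists F => b; rewrite /ind_vec tensZ mulr1 FE; exact: mul1r.
Qed.

Lemma character_vec_ind (X : Type) (g : X -> A) :
    (forall S : A -> Prop, subspace S -> S 1 ->
      (forall x u, S u -> S (g x * u)) -> forall u, S u) ->
    (forall x, rho (phi (g x)) vac = (chi (g x) : K) *: vac) ->
  forall a, rho (phi a) vac = (chi a : K) *: vac.
Proof.
move=> gen vacE; apply: gen => [||x u vu].
- split=> [|r a b va vb]; first by rewrite !rmorph0 endo0E scale0r.
  by rewrite phiL chiL linearP endoDE endoZE va vb scalerDl scalerA.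
- by rewrite !rmorph1 endo1E scale1r.
- by rewrite !rmorphM endoME vu linearZ /= vacE scalerA mulrC.
Qed.
End InducedCharacter.

Section SchrodingerGen.
Variable K : numFieldType.
Local Notation inj := (@uea_inj K (schrodinger K)).

Lemma uea_schrodinger_gen :
  schrodinger_gen (inj (sch_e K)) (inj (sch_h K)) (inj (sch_f K))
    (inj (sch_p K)) (inj (sch_q K)) (inj (sch_z K)).
Proof.
split.
- exact: uea_schrodinger_rel.
- exact: uea_z_comm.
- exact: sch_uea_ind.
Qed.
End SchrodingerGen.

Section FockVacuum.
Variables (K : numFieldType) (c theta : K).
Local Notation vac := (fock_vac K).

Lemma op_e_vac : op_e c theta vac = 0.
Proof. by apply: fockP => i j; rewrite fock0E /= /fock_vac !xpair_eqE andbF !mulr0 addr0. Qed.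

Lemma op_p_vac : op_p c vac = 0.
Proof. by apply: fockP => i j; rewrite fock0E /= /fock_vac xpair_eqE andbF mulr0. Qed.

Lemma op_h_vac : op_h theta vac = theta *: vac.
Proof.
apply: fockP => i j; rewrite fockZE /= /fock_vac xpair_eqE.
by case: i => [|i]; case: j => [|j]; rewrite /=; ring.
Qed.
End FockVacuum.

Section Weights.
Variables (K : numFieldType) (lambda : weight K).
Local Notation coord := Defs.coord.

Definition weight_h : K := lambda (vsproj (cartan K) (sch_h K)).

Lemma sch_h_cartan : sch_h K \in cartan K.
Proof. by apply/cartanP; exists 1, 0; rewrite scale1r scale0r addr0. Qed.
Lemma sch_z_cartan : sch_z K \in cartan K.
Proof. by apply/cartanP; exists 0, 1; rewrite scale1r scale0r add0r. Qed.

Lemma borel_charE (x : borel_alg K) :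
  borel_char lambda x = coord 1 (borel_incl x) * weight_h
                      + coord 5 (borel_incl x) * weight_z lambda.
Proof.
have /memv_addP[u uc [v vn xE]] := borel_inclP x.
have xu : daddv_pi (cartan K) (nplus K) (borel_incl x) = u.
  have nc : (nplus K :&: cartan K)%VS = 0%VS by rewrite capvC cartan_nplus_disjoint.
  have := daddv_pi_add (cartan_nplus_disjoint K) (memv_add (mem0v (cartan K)) vn).
  rewrite add0r (daddv_pi_id nc vn) => /eqP; rewrite -subr_eq0 addrK => /eqP v0.
  by rewrite xE linearD /= v0 addr0 (daddv_pi_id (cartan_nplus_disjoint K) uc).
rewrite /borel_char xu xE.
have /cartanP[a [b uE]] := uc; have /nplusP[a' [b' vE]] := vn.
have c1 : coord 1 (u + v) = a.
  by rewrite uE vE !(linearD, linearZ) /= !Defs.coord_basis //= !mulr0 mulr1 !addr0.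
have c5 : coord 5 (u + v) = b.
  by rewrite uE vE !(linearD, linearZ) /= !Defs.coord_basis //= !mulr0 mulr1 !addr0 add0r.
rewrite c1 c5 uE /weight_h /weight_z.
by rewrite linearD /= !linearZ /= linearD /= !linearZ.
Qed.

Definition borel_of (x : schrodinger K) : borel_alg K := vsproj (borel K) x.

Lemma borel_ofK x : x \in borel K -> borel_incl (borel_of x) = x.
Proof. exact: vsprojK. Qed.

Lemma sch_e_borel : sch_e K \in borel K.
Proof.
apply: (subvP (addvSr _ _)); apply/nplusP; exists 1, 0.
by rewrite scale1r scale0r addr0.
Qed.
Lemma sch_p_borel : sch_p K \in borel K.
Proof.
apply: (subvP (addvSr _ _)); apply/nplusP; exists 0, 1.
by rewrite scale1r scale0r add0r.
Qed.
Lemma sch_h_borel : sch_h K \in borel K.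
Proof. exact/(subvP (addvSl _ _))/sch_h_cartan. Qed.
Lemma sch_z_borel : sch_z K \in borel K.
Proof. exact/(subvP (addvSl _ _))/sch_z_cartan. Qed.

End Weights.

Section Verma.
Variables (K : numFieldType) (lambda : weight K).
Hypothesis cN0 : weight_z lambda != 0.
Local Notation U := (uea (schrodinger K)).
Local Notation inj := (@uea_inj K (schrodinger K)).
Local Notation c := (weight_z lambda).
Local Notation theta := (weight_h lambda).
Local Notation phi := (uea_map (borel_incl_morphism K)).
Local Notation chi := (uea_lift (borel_char_morphism lambda)).
Local Notation coord := Defs.coord.

Local Notation ops := (fock_rep c (op_e c theta) (op_h theta) (op_f c) (op_p c) (op_q K)).

Lemma fock_rep_morphism : is_lie_morphism ops.
Proof.
split=> [a x y|x y]; last exact: (fock_rep_br (fock_rel theta cN0) x y).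
refine (fock_opP _) => b i j.
transitivity (a * ops x b (i, j) + ops y b (i, j)); last by [].
by rewrite !fock_repE !coord_linear; ring.
Qed.

Definition fock_lift := uea_lift fock_rep_morphism.
HB.instance Definition _ := GRing.LRMorphism.on fock_lift.

Let phi_linear : linear phi. Proof. exact: uea_lift_linear. Qed.
Let chi_linear : linear chi. Proof. exact: uea_lift_linear. Qed.

Lemma uea_map_inj (x : borel_alg K) : phi (uea_inj x) = inj (borel_incl x).
Proof. exact: (uea_lift_inj (borel_incl_morphism K)). Qed.

Lemma fock_lift_inj x : fock_lift (inj x) = ops x.
Proof. exact: (uea_lift_inj fock_rep_morphism). Qed.

Lemma borel_char_inj (x : borel_alg K) : chi (uea_inj x) = borel_char lambda x.
Proof. exact: (uea_lift_inj (borel_char_morphism lambda)). Qed.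

Lemma fock_rep_borel (x : borel_alg K) :
  ops (borel_incl x) (fock_vac K) = (borel_char lambda x : K) *: fock_vac K.
Proof.
have [x2 x4] := borel_coord (borel_inclP x).
apply: fockP => i j; rewrite fock_repE x2 x4 fockZE borel_charE.
by rewrite op_e_vac op_p_vac op_h_vac !fock0E fockZE; ring.
Qed.

Lemma fock_lift_vac (a : uea (borel_alg K)) :
  fock_lift (phi a) (fock_vac K) = (chi a : K) *: fock_vac K.
Proof.
apply: (character_vec_ind phi_linear chi_linear (@uea_ind K (borel_alg K))) => x.
have h : fock_lift (phi (uea_inj x)) = ops (borel_incl x).
  exact: (etrans (congr1 fock_lift (uea_map_inj x)) (fock_lift_inj _)).
refine (etrans (congr1 (fun t : endo _ => t (fock_vac K)) h) _).
refine (etrans (fock_rep_borel x) _).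
exact: (congr1 (fun r : K => r *: fock_vac K) (esym (borel_char_inj x))).
Qed.

Definition verma_vec : verma lambda := ind_vec phi chi.

Lemma verma_cyclic (x : verma lambda) : exists u : U, x = u *: verma_vec.
Proof. exact: (ind_cyclic phi_linear chi_linear). Qed.

Lemma verma_borel (x : schrodinger K) : x \in borel K ->
  inj x *: verma_vec = ((coord 1 x * theta + coord 5 x * c)%:A : U) *: verma_vec.
Proof.
move=> xb.
have h := etrans (uea_map_inj (borel_of x)) (congr1 inj (borel_ofK xb)).
have hc := etrans (borel_char_inj (borel_of x)) (borel_charE lambda (borel_of x)).
rewrite (borel_ofK xb) in hc.
exact: (ind_vec_phi phi_linear chi_linear h hc).
Qed.

(** With [u = 1] the value is 1, so the Verma module is nonzero. *)
Lemma verma_functional : exists eps : verma lambda -> K,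
  forall u : U, eps (u *: verma_vec) = fock_lift u (fock_vac K) (0, 0)%N.
Proof.
have [|eps epsE] := ind_functional (rho := fock_lift) (l := fun a => a (0, 0)%N) _
  fock_lift_vac; last by exists eps.
by move=> a x y.
Qed.

End Verma.

(** * Simple highest weight modules *)

Section CyclicModules.
Variables (K : numFieldType) (B : algType K) (e h f p q z : B).
Hypothesis gen : schrodinger_gen e h f p q z.
Variable c : K.
Hypothesis cN0 : c != 0.
Variables (N : lmodType B) (w : N) (theta : K).
Hypotheses (cyc : forall x, exists u : B, x = u *: w).
Hypotheses (ew : e *: w = 0) (pw : p *: w = 0) (hw : h *: w = theta%:A *: w)
  (zw : z *: w = c%:A *: w).

Lemma cyclic_charge (x : N) : z *: x = c%:A *: x.
Proof.
have [u ->] := cyc x; rewrite scalerA (gen_z gen) -scalerA zw !scalerA.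
by rewrite mulr_algl mulr_algr.
Qed.

Variables (V : lmodType K) (v0 : {v : V | v != 0}) (rho : {lrmorphism B -> endo v0}).
Variables (vac : V) (l : V -> K) (eps : N -> K).
Hypotheses (linl : linear_for *%R l) (l_h : forall a, l (rho h a) = theta * l a)
  (l_vac : l vac = 1) (epsE : forall u : B, eps (u *: w) = l (rho u vac)).

Lemma eps_linear a x y : eps ((a%:A : B) *: x + y) = a * eps x + eps y.
Proof.
have [u ->] := cyc x; have [u' ->] := cyc y.
rewrite scalerA -scalerDl !epsE mulr_algl -linl.
by rewrite linearP endoDE endoZE.
Qed.

Lemma eps_hE x : eps (h *: x) = theta * eps x.
Proof. by have [u ->] := cyc x; rewrite scalerA !epsE rmorphM endoME l_h. Qed.

Lemma eps_wE : eps w = 1.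
Proof. by have := epsE 1; rewrite scale1r rmorph1 endo1E l_vac. Qed.

(** The set divided out in [simple_hw], for an arbitrary cyclic module. *)
Definition proper_span : set N := [set v : N | exists2 P : {pred N},
  GRing.submod_closed P /\ (exists w', w' \notin P) & v \in P].

(** The vectors whose whole orbit is killed by [eps] form a submodule, proper since [eps w = 1], and
    by [hw_proper] it contains every proper submodule. *)
Lemma proper_span_ker x :
  mod_pi proper_span x = 0 <-> forall u : B, eps (u *: x) = 0.
Proof.
have -> : (mod_pi proper_span x = 0) <-> x \in submod_gen proper_span.
  by have := mod_pi_eq proper_span x 0; rewrite raddf0 subr0.
have epsK := eps_ker_subspace eps_linear.
split=> [/submod_genP/(_ [pred y | `[< forall u : B, eps (u *: y) = 0 >]]) xS|x0].
  apply/asboolP/xS.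
    split=> [|a y y' /asboolP y0 /asboolP y0']; apply/asboolP => u.
      by rewrite scaler0 (eps0 eps_linear).
    rewrite scalerDr scalerA.
    exact: (subspaceD epsK (y0 (u * a)) (y0' u)).
  move=> y [P [[P0 PP] [w' w'P]] Py]; apply/asboolP.
  apply: (hw_proper gen cN0 cyclic_charge cyc ew pw hw eps_linear eps_hE eps_wE
    (J := fun y => y \in P)) => //.
  by move=> Pall; move: (Pall w'); rewrite (negPf w'P).
apply: submod_gen_sub; exists (fun y => `[< forall u : B, eps (u *: y) = 0 >]).
  split; last first.
    exists w; apply/negP => /asboolP/(_ 1); rewrite scale1r eps_wE => /eqP.
    by rewrite oner_eq0.
  split=> [|a y y' /asboolP y0 /asboolP y0']; apply/asboolP => u.
    by rewrite scaler0 (eps0 eps_linear).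
  rewrite scalerDr scalerA; exact: (subspaceD epsK (y0 (u * a)) (y0' u)).
exact/asboolP.
Qed.

Local Notation L := (mod_quot proper_span).
Local Notation mu := (theta + 2^-1).

Theorem max_quotient_hw :
  [/\ simple_module L, forall y : L, z *: y = c%:A *: y,
      forall y : L, sl2_cas e h f p q c *: y = (mu * (mu + 2))%:A *: y,
      forall n, mu = n%:R -> annihilator L (sl2f f q c ^+ n.+1)
    & (forall n, mu <> n%:R) -> forall n, ~ annihilator L (sl2f f q c ^+ n)].
Proof.
have surj := @mod_pi_surj _ _ proper_span.
split.
- exact: (hw_quotient_simple gen cN0 cyclic_charge cyc ew pw hw eps_linear eps_hE eps_wE
    surj proper_span_ker).
- exact: (hw_quotient_charge cyclic_charge surj).
- exact: (hw_quotient_casimir gen cN0 cyclic_charge cyc ew pw hw eps_linear eps_wE surj).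
- exact: (hw_quotient_nilpotent gen cN0 cyclic_charge cyc ew pw hw eps_linear eps_hE eps_wE
    surj proper_span_ker).
- exact: (hw_quotient_not_nilpotent gen cN0 cyclic_charge cyc ew pw hw eps_linear eps_wE
    surj proper_span_ker).
Qed.
End CyclicModules.

(** * Annihilators are determined by c, chi and the nilpotency of F *)

Section AnnihilatorInvariants.
Variables (K : numFieldType) (B : algType K) (e h f p q z : B).
Hypothesis gen : schrodinger_gen e h f p q z.
Variable c : K.
Hypothesis cN0 : c != 0.
Local Notation sl2f := (sl2f f q c).
Local Notation sl2_cas := (sl2_cas e h f p q c).

Lemma nilpotency_index (N : lmodType B) chi n : (exists v : N, v != 0) ->
    (forall x : N, z *: x = c%:A *: x) -> (forall x : N, sl2_cas *: x = chi%:A *: x) ->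
    annihilator N (sl2f ^+ n) ->
  exists k, chi = k%:R * (k%:R + 2) /\
    forall m, annihilator N (sl2f ^+ m) <-> (k < m)%N.
Proof.
move=> [v vN0] zN casN Fn.
pose v0 : {v : restrict_scalars N | v != 0} := exist _ (v : restrict_scalars N) vN0.
have exF : exists m, `[< annihilator N (sl2f ^+ m) >] by exists n; apply/asboolP.
(* The least exponent is not 0, because [1] does not kill a nonzero module; it is written
   [k + 1]. *)
case: (ex_minnP exF) => -[|k] /asboolP Fk kmin.
  by case/eqP: (vN0); rewrite -[v]scale1r; apply: Fk.
have actF m : annihilator N (sl2f ^+ m) <-> act v0 sl2f ^+ m = 0.
  have [h1 h2] := nonzero_act v0 (sl2f ^+ m).
  have <- : act v0 (sl2f ^+ m) = act v0 sl2f ^+ m by exact: rmorphXn.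
  split=> [Nm|F0]; first by apply/eqP; apply: contrapT => /negP/h1.
  by apply: contrapT => /h2/eqP.
exists k; split=> [|m].
  apply: (nilpotent_casimir (split_sl2 (act_split_rel gen cN0 v0 zN casN))).
    exact/actF.
  by apply/eqP => /actF Fk'; have := kmin k; rewrite ltnn => /(_ (introT (asboolP _) Fk')).
split=> [Fm|km]; first exact/kmin/asboolP.
by move=> x; rewrite -(subnK km) exprD -scalerA Fk scaler0.
Qed.

Lemma annihilator_eq (M L : lmodType B) chi :
    (exists v : M, v != 0) -> (exists v : L, v != 0) ->
    (forall m : M, z *: m = c%:A *: m) -> (forall m : L, z *: m = c%:A *: m) ->
    (forall m : M, sl2_cas *: m = chi%:A *: m) ->
    (forall m : L, sl2_cas *: m = chi%:A *: m) ->
    ((exists n, annihilator M (sl2f ^+ n)) <-> exists n, annihilator L (sl2f ^+ n)) ->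
  annihilator M = annihilator L.
Proof.
move=> M0 L0 zM zL CM CL ML.
have FML n : annihilator M (sl2f ^+ n) <-> annihilator L (sl2f ^+ n).
  have [[m Mm]|noM] := pselect (exists n, annihilator M (sl2f ^+ n)); last first.
    by split=> Fn; case: noM; [|apply/ML]; exists n.
  have [m' Lm] : exists n, annihilator L (sl2f ^+ n) by apply/ML; exists m.
  have [k [chik Mk]] := nilpotency_index M0 zM CM Mm.
  have [k' [chik' Lk]] := nilpotency_index L0 zL CL Lm.
  suff kk' : k = k' by rewrite Mk Lk kk'.
  move: chik'; rewrite chik -!natrD -!natrM => /eqP; rewrite eqr_nat => /eqP.
  (* The function [k (k + 2)] is strictly increasing on natural numbers. *)
  by case: (ltngtP k k') => // kk' kE; [have := ltn_mul kk' (leq_add kk' (leqnn 2))|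
    have := ltn_mul kk' (leq_add kk' (leqnn 2))]; rewrite kE ltnn.
apply/seteqP; split.
  by apply: (annihilator_sub gen cN0 M0 zM zL CM CL) => n /FML.
by apply: (annihilator_sub gen cN0 L0 zL zM CL CM) => n /FML.
Qed.
End AnnihilatorInvariants.

Section SimpleHighestWeight.
Variable K : numFieldType.
Local Notation U := (uea (schrodinger K)).
Local Notation inj := (@uea_inj K (schrodinger K)).
Local Notation cas := (sl2_cas (inj (sch_e K)) (inj (sch_h K)) (inj (sch_f K))
  (inj (sch_p K)) (inj (sch_q K))).
Local Notation sl2fU := (sl2f (inj (sch_f K)) (inj (sch_q K))).

Lemma weight_exists (a b : K) :
  exists lambda : weight K, weight_h lambda = a /\ weight_z lambda = b.
Proof.
pose g (x : subvs_of (cartan K)) : K^o :=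
  Defs.coord 1 (vsval x) * a + Defs.coord 5 (vsval x) * b.
have gL : linear g.
  move=> r x y; rewrite /g linearP !coord_linear.
  by rewrite /GRing.scale /=; ring.
pose gl : {linear subvs_of (cartan K) -> K^o} :=
  HB.pack g (GRing.isLinear.Build _ _ _ _ g gL).
exists (linfun gl); rewrite /weight_h /weight_z !lfunE /= /g.
rewrite !vsprojK ?sch_h_cartan ?sch_z_cartan // !Defs.coord_basis //=.
by rewrite mul1r !mul0r addr0 add0r mul1r.
Qed.

Lemma verma_weight (lambda : weight K) x (r : K) : x \in borel K ->
    Defs.coord 1 x * weight_h lambda + Defs.coord 5 x * weight_z lambda = r ->
  inj x *: verma_vec lambda = (r%:A : U) *: verma_vec lambda.
Proof. by move=> xb <-; apply: verma_borel. Qed.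

Lemma fock_lift_h (lambda : weight K) (cN0 : weight_z lambda != 0) a :
  fock_lift cN0 (inj (sch_h K)) a (0, 0)%N = weight_h lambda * a (0, 0)%N.
Proof.
rewrite fock_lift_inj fock_repE !Defs.coord_basis //=.
by rewrite !mul0r !addr0 add0r mul1r mulr0 !subr0.
Qed.

Lemma scale_zero (B : algType K) (N : lmodType B) (v : N) : (0%:A : B) *: v = 0.
Proof. by rewrite !scale0r. Qed.

Lemma verma_e (lambda : weight K) : inj (sch_e K) *: verma_vec lambda = 0.
Proof.
refine (etrans (verma_weight (sch_e_borel K) _) (scale_zero _)).
by rewrite !Defs.coord_basis //= !mul0r addr0.
Qed.
Lemma verma_p (lambda : weight K) : inj (sch_p K) *: verma_vec lambda = 0.
Proof.
refine (etrans (verma_weight (sch_p_borel K) _) (scale_zero _)).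
by rewrite !Defs.coord_basis //= !mul0r addr0.
Qed.
Lemma verma_h (lambda : weight K) : inj (sch_h K) *: verma_vec lambda =
  ((weight_h lambda)%:A : U) *: verma_vec lambda.
Proof.
apply: (verma_weight (sch_h_borel K)).
by rewrite !Defs.coord_basis //= mul0r mul1r addr0.
Qed.
Lemma verma_z (lambda : weight K) : inj (sch_z K) *: verma_vec lambda =
  ((weight_z lambda)%:A : U) *: verma_vec lambda.
Proof.
apply: (verma_weight (sch_z_borel K)).
by rewrite !Defs.coord_basis //= mul0r mul1r add0r.
Qed.

Theorem simple_hw_facts (lambda : weight K) (c := weight_z lambda)
    (mu := weight_h lambda + 2^-1) (L := simple_hw lambda) : c != 0 ->
  [/\ simple_module L, forall y : L, inj (sch_z K) *: y = c%:A *: y,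
      forall y : L, cas c *: y = (mu * (mu + 2))%:A *: y,
      forall n, mu = n%:R -> annihilator L (sl2fU c ^+ n.+1)
    & (forall n, mu <> n%:R) -> forall n, ~ annihilator L (sl2fU c ^+ n)].
Proof.
move=> cN0.
have [eps epsE] := verma_functional cN0.
have [ew pw] := (verma_e lambda, verma_p lambda).
have [hw zw] := (verma_h lambda, verma_z lambda).
apply: (@max_quotient_hw _ _ _ _ _ _ _ _ (uea_schrodinger_gen K) _ cN0 _ _ _
  (verma_cyclic (lambda := lambda)) ew pw hw zw _ _ (fock_lift cN0) (fock_vac K)
  (fun a => a (0, 0)%N) eps _ (fock_lift_h cN0) _ epsE).
- by move=> r a b.
- by rewrite /fock_vac eqxx.
Qed.
End SimpleHighestWeight.

(** * Realizing the invariants of a simple module by a highest weight *)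

Section CasimirCharacter.
Variables (K : numClosedFieldType) (B : algType K) (e h f p q z : B).
Hypotheses (gen : schrodinger_gen e h f p q z) (uncK : uncountable_field K).

Lemma casimir_character (c : K) (M : lmodType B) : c != 0 -> simple_module M ->
    (forall m : M, z *: m = c%:A *: m) ->
  exists chi : K, forall m : M, sl2_cas e h f p q c *: m = chi%:A *: m.
Proof.
move=> cN0 simpleM zM; have [b span_b] := schrodinger_countable_span gen.
have [[v vN0] _] := simpleM.
pose v0 : {v : restrict_scalars M | v != 0} := exist _ (v : restrict_scalars M) vN0.
apply: (dixmier_schur span_b uncK simpleM) => [x y|u x]; first exact: scalerDr.
exact: (congr1 (fun g : endo v0 => g x) (sl2_cas_comm gen cN0 v0 zM u)).
Qed.

Lemma casimir_weight (chi : K) :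
  exists mu : K, chi = mu * (mu + 2) /\ forall n, mu <> n%:R.
Proof.
(* [chi + 1 = (mu + 1)^2], so the candidates for [mu] are [s - 1] and [- s - 1]. *)
pose s := sqrtC (chi + 1).
have sE : chi = s ^+ 2 - 1 by rewrite sqrtCK addrK.
have [[n nE]|no] := pselect (exists n : nat, s - 1 = n%:R); last first.
  exists (s - 1); split; first by rewrite sE; ring.
  by move=> n nE; apply: no; exists n.
exists (- s - 1); split=> [|m mE]; first by rewrite sE; ring.
have : (n + m + 2)%:R = 0 :> K by rewrite !natrD -nE -mE; ring.
by move/eqP; rewrite pnatr_eq0 addn2.
Qed.
End CasimirCharacter.

Section Main.
Variable K : numClosedFieldType.
Hypothesis uncK : uncountable_field K.
Local Notation U := (uea (schrodinger K)).
Local Notation inj := (@uea_inj K (schrodinger K)).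
Local Notation cas := (sl2_cas (inj (sch_e K)) (inj (sch_h K)) (inj (sch_f K))
  (inj (sch_p K)) (inj (sch_q K))).
Local Notation sl2fU := (sl2f (inj (sch_f K)) (inj (sch_q K))).

Lemma same_invariants (c chi mu : K) (M : lmodType U) (lambda : weight K) :
    c != 0 -> simple_module M -> central_charge M c ->
    (forall m : M, cas c *: m = chi%:A *: m) ->
    weight_z lambda = c -> weight_h lambda + 2^-1 = mu -> chi = mu * (mu + 2) ->
    ((exists n, annihilator M (sl2fU c ^+ n)) <->
     exists n, annihilator (simple_hw lambda) (sl2fU c ^+ n)) ->
  annihilator M = annihilator (simple_hw lambda).
Proof.
move=> cN0 simpleM zM CM lz lh chiE ML.
have lN0 : weight_z lambda != 0 by rewrite lz.
have [simpleL zL CL _ _] := simple_hw_facts lN0.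
rewrite lh -chiE lz in zL CL.
exact: (annihilator_eq (uea_schrodinger_gen K) cN0 (proj1 simpleM) (proj1 simpleL)
  zM zL CM CL ML).
Qed.

Lemma simple_annihilator_hw (c : K) (M : lmodType U) :
    c != 0 -> simple_module M -> central_charge M c ->
  exists2 lambda : weight K,
    weight_z lambda != 0 & annihilator M = annihilator (simple_hw lambda).
Proof.
move=> cN0 simpleM zM.
have [chi CM] := casimir_character (uea_schrodinger_gen K) uncK cN0 simpleM zM.
have [[n Mn]|no] := pselect (exists n, annihilator M (sl2fU c ^+ n)).
  have [k [chiE Mk]] :=
    nilpotency_index (uea_schrodinger_gen K) cN0 (proj1 simpleM) zM CM Mn.
  (* The 1/2 compensates the shift in [hwv_H]: now [mu = k] is a natural number, and F is nilpotent
     on the highest weight module as well. *)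
  have [lambda [lh lz]] := weight_exists (k%:R - 2^-1) c.
  have lhE : weight_h lambda + 2^-1 = k%:R by rewrite lh subrK.
  exists lambda; first by rewrite lz.
  apply: (same_invariants cN0 simpleM zM CM lz lhE chiE).
  have lN0 : weight_z lambda != 0 by rewrite lz.
  have [_ _ _ /(_ k lhE) Lk _] := simple_hw_facts lN0.
  rewrite lz in Lk.
  by split=> _; [exists k.+1|exists n].
have [mu [chiE muN]] := casimir_weight chi.
have [lambda [lh lz]] := weight_exists (mu - 2^-1) c.
have lhE : weight_h lambda + 2^-1 = mu by rewrite lh subrK.
exists lambda; first by rewrite lz.
apply: (same_invariants cN0 simpleM zM CM lz lhE chiE).
have lN0 : weight_z lambda != 0 by rewrite lz.
have [_ _ _ _ LN] := simple_hw_facts lN0.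
rewrite lhE lz in LN.
by split=> [/no|[m /(LN muN)]].
Qed.
End Main.

Theorem corollary30 (R : realType) :
  [set J : set (uea (schrodinger R[i])) |
     exists M : lmodType (uea (schrodinger R[i])),
       [/\ simple_module M,
           exists2 c : R[i], c != 0 & central_charge M c
         & J = annihilator M]]
  = [set J : set (uea (schrodinger R[i])) |
       exists2 lambda : weight R[i],
         weight_z lambda != 0 & J = annihilator (simple_hw lambda)].
Proof.
apply/seteqP; split=> J.
  move=> [M [simpleM [c cN0 zM] ->]].
  have [lambda lz ML] :=
    simple_annihilator_hw (@complex_uncountable R) cN0 simpleM zM.
  by exists lambda.
move=> [lambda lz ->]; exists (simple_hw lambda).
have [simpleL zL _ _ _] := @simple_hw_facts R[i] lambda lz.
by split=> //; exists (weight_z lambda).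
Qed.
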